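(* Let $w_\epsilon(x,t)$ satisfy the two-dimensional helical Euler equation $\partial_t w+Hw\cdot\nabla w=0$, with initial vorticity $w_{\epsilon,0}\in L^1_2\cap L^\infty_2(\mathbb{R}^2)$. Assume that $w_{\epsilon,0}$ is non-negative, $$\int_{\mathbb{R}^2}w_{\epsilon,0}(x)\,dx=1\qquad\text{and}\qquad\int_{\mathbb{R}^2}|x|^2w_{\epsilon,0}(x)\,dx\lesssim\epsilon^2 .$$ Then for any $\alpha<1$ and $t\ge0$ there holds $$\int_{|x|\ge\epsilon^\alpha}w_\epsilon(x,t)\,dx\lesssim\epsilon^{2-2\alpha}.$$ In particular, $w_\epsilon(\cdot,t)$ converges to the Dirac measure (at the origin) in distribution as $\epsilon\to0$.
   Context: Notation. For $x\in\mathbb{R}^2$, $\langle x\rangle=\sqrt{1+|x|^2}$ and $R_\theta x=(x_1\cos\theta+x_2\sin\theta,\,-x_1\sin\theta+x_2\cos\theta)$. For $x\in\mathbb{R}^3$, $\xi(x)=(x_2,-x_1,1)$; $\wedge$ is the cross product in $\mathbb{R}^3$. $a\lesssim b$ means $a\le Cb$ with $C>0$ independent of $x,y,\epsilon$. Weighted spaces on $\mathbb{R}^2$: $\|g\|_{L^p_m}=\left(\int_{\mathbb{R}^2}\langle y\rangle^{pm}|g(y)|^p\,dy\right)^{1/p}$ for $1\le p<\infty$, and $\|g\|_{L^\infty_m}=\sup_x\langle x\rangle^m|g(x)|$. Two-dimensional helical Euler equation: $\partial_t w+Hw\cdot\nabla w=0$ on $\mathbb{R}^2$, where, for $x,y\in\mathbb{R}^2$,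 $$K(x,y)=-\frac1{4\pi}\int_{\mathbb{R}}\frac{(x_1,x_2,0)-(R_a y,a)}{|(x_1,x_2,0)-(R_a y,a)|^3}\wedge\xi\big((R_a y,a)\big)\,da,$$ $U(x)=\int_{\mathbb{R}^2}K(x,y)w(y)\,dy=(U^1,U^2,U^3)$ and $Hw(x)=(U^1,U^2)+(-x_2,x_1)U^3$ (a divergence-free field). Weak solution: for all $t\ge 0$ and all $\phi\in C_c^\infty(\mathbb{R}^2\times[0,\infty))$, $$\int_{\mathbb{R}^2}w(x,t)\phi(x,t)\,dx-\int_{\mathbb{R}^2}w(x,0)\phi(x,0)\,dx=\int_0^t\int_{\mathbb{R}^2}w(\partial_t\phi+Hw\cdot\nabla\phi)\,dx\,ds.$$ For every positive integer $m$ the equation is globally well-posed in $L^1_m\cap L^\infty_m(\mathbb{R}^2)$; the solution $w_\epsilon$ is the one in this class (here with $m=2$). *)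

(* Defs.v *)
From HB Require Import structures.
From mathcomp Require Import all_boot all_order all_algebra.
From mathcomp Require Import all_classical all_reals all_analysis.

Set Implicit Arguments.
Unset Strict Implicit.
Unset Printing Implicit Defensive.

Import Order.TTheory GRing.Theory Num.Theory.
Import numFieldNormedType.Exports.

Local Open Scope classical_set_scope.
Local Open Scope ring_scope.

(* The library norm on [R * R] and on ['rV[R]_n] is the maximum norm, hence the
   explicit Euclidean norms [enorm2] and [enorm3]. *)

Section plane_and_space.
Context {R : realType}.
Implicit Types (x y : R * R) (u v : 'rV[R]_3).

Definition enorm2 x : R := Num.sqrt (x.1 ^+ 2 + x.2 ^+ 2).

Definition japanese x : R := Num.sqrt (1 + enorm2 x ^+ 2).

Definition rot (a : R) x : R * R :=
  (x.1 * cos a + x.2 * sin a, - x.1 * sin a + x.2 * cos a).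

Definition vec3 (a b c : R) : 'rV[R]_3 := \row_i [:: a; b; c]`_i.

Definition coord1 u : R := u ord0 (inord 0).
Definition coord2 u : R := u ord0 (inord 1).
Definition coord3 u : R := u ord0 (inord 2).

Definition enorm3 u : R :=
  Num.sqrt (coord1 u ^+ 2 + coord2 u ^+ 2 + coord3 u ^+ 2).

Definition cross u v : 'rV[R]_3 :=
  vec3 (coord2 u * coord3 v - coord3 u * coord2 v)
       (coord3 u * coord1 v - coord1 u * coord3 v)
       (coord1 u * coord2 v - coord2 u * coord1 v).

Definition embed x (a : R) : 'rV[R]_3 := vec3 x.1 x.2 a.

Definition xi u : 'rV[R]_3 := vec3 (coord2 u) (- coord1 u) 1.

End plane_and_space.

Section helical_euler.
Context {R : realType}.
Implicit Types (x y : R * R) (g : R * R -> R) (w : R -> R * R -> R).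

Definition leb1 : {measure set (measurableTypeR R) -> \bar R} :=
  @lebesgue_measure R.

(* [lebesgue_measure] lives on the copy [measurableTypeR R] of [R]; [plane] is
   convertible to [R * R]. *)
Definition plane : measurableType _ :=
  (measurableTypeR R * measurableTypeR R)%type.

Definition leb2 : {measure set plane -> \bar R} :=
  (@lebesgue_measure R \x @lebesgue_measure R)%E.

(* For finite [p] this is (\int <y>^(p m) |g y|^p dy)^(1/p); for [p = +oo] it is
   the essential supremum of <x>^m |g x|. *)
Definition wnorm (p : \bar R) (m : nat) g : \bar R :=
  Lnorm leb2 p (fun x => (japanese x ^+ m * g x)%:E).

Definition Lpm (p : \bar R) (m : nat) : set (R * R -> R) :=
  [set g | measurable_fun [set: plane] g /\ (wnorm p m g < +oo)%E].

Definition kernel_integrand x y (a : R) : 'rV[R]_3 :=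
  let p := embed x 0 in
  let q := embed (rot a y) a in
  (enorm3 (p - q) ^+ 3)^-1 *: cross (p - q) (xi q).

Definition K x y : 'rV[R]_3 :=
  \row_i (- (4 * pi)^-1 * \int[leb1]_a (kernel_integrand x y a ord0 i)).

Definition U g x : 'rV[R]_3 := \row_i \int[leb2]_y (K x y ord0 i * g y).

Definition H g x : R * R :=
  (coord1 (U g x) - x.2 * coord3 (U g x),
   coord2 (U g x) + x.1 * coord3 (U g x)).

(* On a finite-dimensional space this is the usual class C^k. *)
Fixpoint Ck {V : normedModType R} (k : nat) (f : V -> R) : Prop :=
  match k with
  | 0 => continuous f
  | k.+1 => (forall z, differentiable f z) /\ (forall v, Ck k ('D_v f))
  end.

(* Smooth compactly supported functions of (x, t) on the whole of R^2 x R; only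
   their values for t >= 0 are used below. Since every smooth function on
   R^2 x [0, +oo) with compact support is the restriction of such a function,
   these restrictions are the class C_c^oo(R^2 x [0, +oo)), whose members need
   not vanish at t = 0. *)
Definition test_function (phi : R * R * R -> R) : Prop :=
  (forall k, Ck k phi) /\ compact (closure [set z | phi z != 0]).

Definition dt (phi : R * R * R -> R) x (t : R) : R :=
  'D_((0, 0), 1) phi (x, t).

Definition dx1 (phi : R * R * R -> R) x (t : R) : R :=
  'D_((1, 0), 0) phi (x, t).

Definition dx2 (phi : R * R * R -> R) x (t : R) : R :=
  'D_((0, 1), 0) phi (x, t).

Definition weak_solution w : Prop :=
  forall (t : R) (phi : R * R * R -> R), 0 <= t -> test_function phi ->
  \int[leb2]_x (w t x * phi (x, t)) - \int[leb2]_x (w 0 x * phi (x, 0)) =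
  \int[leb1]_(s in `[0, t])
    \int[leb2]_x (w s x *
      (dt phi x s
       + ((H (w s) x).1 * dx1 phi x s + (H (w s) x).2 * dx2 phi x s))).

(* The solution class is L^oo_loc([0, +oo); L^1_m \cap L^oo_m); [w t] is the
   vorticity at time [t], and [w] is only constrained for t >= 0. *)
Definition helical_euler_solution (m : nat) (w0 : R * R -> R) w : Prop :=
  [/\ measurable_fun (`[0, +oo[ `*` setT : set (measurableTypeR R * plane))
        (fun z => w z.1 z.2),
      (forall t : R, 0 <= t -> (Lpm 1 m `&` Lpm +oo m) (w t)),
      (forall T : R, exists M : R, forall t : R, 0 <= t <= T ->
         (wnorm 1 m (w t) <= M%:E)%E /\ (wnorm +oo m (w t) <= M%:E)%E),
      {ae leb2, forall x, w 0 x = w0 x} &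
      weak_solution w].

(* Convergence in distribution, along the filter [F], of the absolutely
   continuous measures of densities [rho i] to the measure [nu]. *)
Definition cvg_in_distribution {I : Type} (F : set_system I)
    (rho : I -> R * R -> R) (nu : {measure set plane -> \bar R}) : Prop :=
  forall f : R * R -> R, continuous f ->
    (exists M : R, forall x, `|f x| <= M) ->
    (fun i => \int[leb2]_x (f x * rho i x)%:E)%E @ F -->
      (\int[nu]_x (f x)%:E)%E.

End helical_euler.

(* Main.v *)
(* Mass and second moment are conserved. For the moment this is the identity
   x.H(w)(x) = int (x1 K1 + x2 K2)(x, y) w(y) dy, whose kernel is antisymmetric in
   (x, y): the substitution a -> -a exchanges the two points of the helical
   filaments. As H(w) grows at most linearly, |x|^2 may be used as a test function
   after a cutoff. So int |x|^2 w(t) = O(eps^2), and Chebyshev's inequality gives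
   both conclusions, provided that w(t) is non-negative.

   The sign of w(t) is propagated by duality, without constructing the flow of the
   velocity b, which is log-Lipschitz with linear growth. Let b_n be b mollified at
   scale 2^-n, so that |b - b_n| = O(n 2^-n) and |grad b_n| = O(n). Replacing a
   non-negative test function psi at time s + h by psi o (id + h b_n(s')) at time s,
   for a suitable s' in [s, s + h], changes the integral against w by at most
   O(h n 2^-n |grad psi|) + O_n(h^2) in the unfavourable direction. Over a time tau
   the gradient of psi grows by a factor e^(C n tau), which is less than (3/2)^n when
   tau is small, so the total error tends to 0 as h -> 0 and then n -> oo; the
   interval [0, t] is covered by finitely many such blocks. *)

Require Import Defs.
From HB Require Import structures.
From mathcomp Require Import all_boot all_order all_algebra.
From mathcomp Require Import all_classical all_reals all_analysis.
From mathcomp Require Import measurable_realfun ess_sup_inf.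
From mathcomp Require Import ring lra.

Set Implicit Arguments.
Unset Strict Implicit.
Unset Printing Implicit Defensive.

Import Order.TTheory GRing.Theory Num.Theory.
Import numFieldNormedType.Exports.

Local Open Scope classical_set_scope.
Local Open Scope ring_scope.

(** * Integrals of real-valued functions *)

(** The weight of order 2 is spent exactly. The helical distance is bounded below by the planar one
    divided by 2<y> or, by symmetry, by 2<x>. The size of the kernel pays with <y> and becomes
    <y>^2/|x - y|; its Lipschitz estimate pays with <x>, harmless on bounded sets, because <y>^3
    would exceed the weight.

    The velocity is merely measurable in time, so the time s' of a backward step is chosen where the
    pairing of w with b_n . grad psi exceeds its mean over the step by at most h. Only a lower bound
    is wanted, and this one-sided choice replaces continuity of b in time.

    Test functions are relaxed to compactly supported C^{1,1} functions with explicit gradient, a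
    class stable under composition with id + h b_n whose constants can be followed separately: the
    gradient bound has to compete with 2^-n, whereas its Lipschitz constant may depend on n in any
    way, since it only enters errors in h^2.

    The sign of w(t) is used in dual form throughout, against continuous functions of quadratic
    growth. *)

Section integration.
Context d (T : measurableType d) (R : realType) (mu : {measure set T -> \bar R}).
Implicit Types (f g h : T -> R).

Local Notation integr f := (mu.-integrable setT (EFin \o f)).

Lemma integr_measurable f : integr f -> measurable_fun setT f.
Proof. by move=> /measurable_int/measurable_EFinP. Qed.

Lemma integr_le_ae f g : measurable_fun setT f -> integr g ->
  {ae mu, forall x, `|f x| <= g x} -> integr f.
Proof.
move=> mf ig fg; apply/integrableP; split; first exact/measurable_EFinP.
move/integrableP : (ig) => [mg]; apply: le_lt_trans.
apply: ae_ge0_le_integral => //.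
- apply: measurableT_comp => //; exact/measurable_EFinP.
- exact: measurableT_comp.
- by apply: filterS fg => x fgx _ /=; rewrite lee_fin (le_trans fgx)// ler_norm.
Qed.

Lemma integr_le f g : measurable_fun setT f -> integr g ->
  (forall x, `|f x| <= g x) -> integr f.
Proof. by move=> mf ig fg; apply: integr_le_ae ig _ => //; exact: aeW. Qed.

Lemma integr_norm f : integr f -> integr (fun x => `|f x|).
Proof. exact: integrable_norm. Qed.

Lemma integrD f g : integr f -> integr g -> integr (fun x => f x + g x).
Proof. by move=> i1 i2; exact: (integrableD _ i1 i2). Qed.

Lemma integrB f g : integr f -> integr g -> integr (fun x => f x - g x).
Proof. by move=> i1 i2; exact: (integrableB _ i1 i2). Qed.

Lemma integrZ c f : integr f -> integr (fun x => c * f x).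
Proof. by move=> i1; exact: (integrableZl measurableT c i1). Qed.

Lemma integrM f g C : measurable_fun setT g -> integr f ->
  (forall x, `|g x| <= C) -> integr (fun x => f x * g x).
Proof.
move=> mg intf gC; apply: (@integr_le _ (fun x => C * `|f x|)).
- by apply: measurable_funM => //; exact: integr_measurable.
- exact/integrZ/integr_norm.
- by move=> x; rewrite normrM mulrC ler_wpM2r.
Qed.

Lemma eq_integr f g : f =1 g -> integr f -> integr g.
Proof. by move=> /funext ->. Qed.

Lemma RintD f g : integr f -> integr g ->
  \int[mu]_x (f x + g x) = \int[mu]_x f x + \int[mu]_x g x.
Proof. exact: RintegralD. Qed.

Lemma RintB f g : integr f -> integr g ->
  \int[mu]_x (f x - g x) = \int[mu]_x f x - \int[mu]_x g x.
Proof. exact: RintegralB. Qed.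

Lemma RintZ c f : integr f -> \int[mu]_x (c * f x) = c * \int[mu]_x f x.
Proof. by move=> i1; exact: RintegralZl. Qed.

Lemma eq_Rint f g : f =1 g -> \int[mu]_x f x = \int[mu]_x g x.
Proof. by move=> fg; apply: eq_Rintegral => x _. Qed.

Lemma EFin_Rint f : integr f -> (\int[mu]_x f x)%:E = (\int[mu]_x (f x)%:E)%E.
Proof. by move=> i1; rewrite /Rintegral fineK//; exact: integrable_fin_num. Qed.

Lemma ae_eq_Rint f g : measurable_fun setT f -> measurable_fun setT g ->
  {ae mu, forall x, f x = g x} -> \int[mu]_x f x = \int[mu]_x g x.
Proof.
move=> mf mg fg; congr fine; apply: ae_eq_integral => //.
- exact/measurable_EFinP.
- exact/measurable_EFinP.
- by apply: filterS fg => x /= -> _.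
Qed.

Lemma le_Rint f g : integr f -> integr g -> (forall x, f x <= g x) ->
  \int[mu]_x f x <= \int[mu]_x g x.
Proof. by move=> i1 i2 fg; apply: le_Rintegral => // x _. Qed.

Lemma ae_le_Rint f g : integr f -> integr g -> {ae mu, forall x, f x <= g x} ->
  \int[mu]_x f x <= \int[mu]_x g x.
Proof.
move=> i1 i2 fg.
have [mf mg] := (integr_measurable i1, integr_measurable i2).
(* [f'] agrees with [f] almost everywhere and lies below [g] everywhere. *)
pose f' x := Order.min (f x) (g x).
have mf' : measurable_fun setT f' by exact: measurable_minr.
have e : {ae mu, forall x, f x = f' x}.
  by apply: filterS fg => x fgx; rewrite /f' min_l.
have if' : integr f'.
  apply: (@integr_le _ (fun x => `|f x| + `|g x|)) => //.
    by apply: integrD; exact: integr_norm.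
  by move=> x; rewrite /f' minEle; case: ifP => _; rewrite ?lerDl ?lerDr.
rewrite (ae_eq_Rint mf mf' e); apply: le_Rint => // x.
by rewrite /f' ge_min lexx orbT.
Qed.

Lemma norm_Rint_le_ae f g : measurable_fun setT f -> integr g ->
  {ae mu, forall x, `|f x| <= g x} -> `|\int[mu]_x f x| <= \int[mu]_x g x.
Proof.
move=> mf ig fg; have intf := integr_le_ae mf ig fg.
apply: le_trans (le_normr_Rintegral _ intf) _ => //.
by apply: ae_le_Rint => //; exact: integr_norm.
Qed.

Lemma norm_Rint_le f g : measurable_fun setT f -> integr g ->
  (forall x, `|f x| <= g x) -> `|\int[mu]_x f x| <= \int[mu]_x g x.
Proof. by move=> mf ig fg; apply: norm_Rint_le_ae => //; exact: aeW. Qed.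

Lemma norm_Rint_le_norm f : integr f -> `|\int[mu]_x f x| <= \int[mu]_x `|f x|.
Proof. by move=> ?; exact: le_normr_Rintegral. Qed.

Lemma Rint_ge0 f : (forall x, 0 <= f x) -> 0 <= \int[mu]_x f x.
Proof. by move=> f0; apply: Rintegral_ge0 => x _. Qed.

Lemma integr_fin f (C : R) : measurable_fun setT f -> (forall x, 0 <= f x) ->
  (\int[mu]_x (f x)%:E <= C%:E)%E -> integr f /\ \int[mu]_x f x <= C.
Proof.
move=> mf f0 fC.
have intf : integr f.
  apply/integrableP; split; first exact/measurable_EFinP.
  under eq_integral do rewrite /= ger0_norm//.
  by apply: le_lt_trans fC _; rewrite ltry.
by split=> //; rewrite -lee_fin EFin_Rint.
Qed.

Lemma cvg_Rint (u : nat -> T -> R) f g :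
  (forall n, measurable_fun setT (u n)) -> measurable_fun setT f -> integr g ->
  (forall n x, `|u n x| <= g x) -> (forall x, u ^~ x @ \oo --> f x) ->
  (fun n => \int[mu]_x u n x) @ \oo --> \int[mu]_x f x.
Proof.
move=> mu_ mf ig ug uf.
have [] := @dominated_convergence _ _ _ mu setT measurableT
  (fun n x => (u n x)%:E) (EFin \o f) (EFin \o g).
- by move=> n; exact/measurable_EFinP.
- exact/measurable_EFinP.
- by apply: aeW => x _; apply/cvg_EFin; [exact: nearW|exact: uf].
- exact: ig.
- by apply: aeW => x n _ /=; rewrite lee_fin.
move=> iF _ cF; apply/fine_cvg; rewrite -/(Rintegral _ _ _).
by rewrite EFin_Rint.
Qed.

Lemma indicM_integr (A : set T) f : measurable A -> integr f ->
  integr (fun x => \1_A x * f x).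
Proof.
move=> mA intf; apply: (@integr_le _ (fun x => `|f x|)).
- apply: measurable_funM; last exact: integr_measurable.
  exact: measurable_indic.
- exact: integr_norm.
- by move=> x; rewrite normrM indicE; case: (x \in A);
    rewrite ?normr1 ?mul1r// normr0 mul0r.
Qed.

Lemma integr_indic (A : set T) : measurable A -> (mu A < +oo)%E ->
  integr (\1_A : T -> R).
Proof.
move=> mA muA; apply/integrableP; split.
  by apply/measurable_EFinP; exact: measurable_indic.
under eq_integral do rewrite /= ger0_norm//.
by rewrite integral_indic// setIT.
Qed.

Lemma Rint_indic (A : set T) : measurable A ->
  \int[mu]_x (\1_A x : R) = fine (mu A).
Proof. by move=> mA; rewrite /Rintegral integral_indic// setIT. Qed.

End integration.

(** * Measurability and exchange of iterated integrals *)

Section parameter_integrals.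
Context d1 d2 (T1 : measurableType d1) (T2 : measurableType d2) (R : realType).
Variables (m1 : {sigma_finite_measure set T1 -> \bar R})
          (m2 : {sigma_finite_measure set T2 -> \bar R}).

(** Tonelli applies to the positive and negative parts separately, and [fine] sends their extended
    difference, infinite values included, to a measurable real function. *)
Lemma measurable_Rint (f : T1 * T2 -> R) : measurable_fun setT f ->
  measurable_fun setT (fun x => \int[m2]_y f (x, y)).
Proof.
move=> mf; apply: (measurableT_comp (@fine_measurable R _ measurableT)).
rewrite (_ : (fun x => _) =
  (fun x => \int[m2]_y (EFin \o f)^\+ (x, y)) \-
  (fun x => \int[m2]_y (EFin \o f)^\- (x, y)))%E; last first.
  apply/funext => x; rewrite [LHS]integralE.
  by congr (_ - _)%E; apply: eq_integral => y _; rewrite ?funeposE ?funenegE.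
apply: emeasurable_funB.
- apply: (measurable_fun_fubini_tonelli_F (m2:=m2) (EFin \o f)^\+%E) => //.
  by apply: measurable_funepos; exact/measurable_EFinP.
- apply: (measurable_fun_fubini_tonelli_F (m2:=m2) (EFin \o f)^\-%E) => //.
  by apply: measurable_funeneg; exact/measurable_EFinP.
Qed.

(** Fubini's theorem in the form used for the singular kernel: the bound [g] on the inner integrals
    of |f| provides integrability on the product, and integrability of every section lets real and
    extended inner integrals be exchanged. *)
Lemma Rint_swap (f : T1 * T2 -> R) (g : T1 -> R) : measurable_fun setT f ->
  (forall x, m2.-integrable setT (fun y => (f (x, y))%:E)) ->
  m1.-integrable setT (EFin \o g) ->
  (forall x, \int[m2]_y `|f (x, y)| <= g x) ->
  (forall y, m1.-integrable setT (fun x => (f (x, y))%:E)) ->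
  \int[m1]_x \int[m2]_y f (x, y) = \int[m2]_y \int[m1]_x f (x, y).
Proof.
move=> mf i2 ig fg i1.
have iprod : (m1 \x m2)%E.-integrable setT (EFin \o f).
  apply/integrable12ltyP; first exact/measurable_EFinP.
  have [_] := integrableP _ _ _ ig; apply: le_lt_trans.
  have m' : measurable_fun setT (fun x => \int[m2]_y `|f (x, y)|).
    by apply: (@measurable_Rint (fun z => `|f z|)); exact: measurableT_comp.
  rewrite [leLHS](_ : _ = \int[m1]_x (\int[m2]_y `|f (x, y)|)%:E)%E.
    apply: ge0_le_integral => //.
    - by move=> x _; rewrite lee_fin; apply: Rint_ge0.
    - exact/measurable_EFinP.
    - by apply: measurableT_comp => //; exact: measurable_int ig.
    - by move=> x _; rewrite lee_fin (le_trans (fg x))// ler_norm.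
  by apply: eq_integral => x _; rewrite (EFin_Rint (integr_norm (i2 x))).
rewrite [LHS]/Rintegral [RHS]/Rintegral; congr fine.
under eq_integral do rewrite (EFin_Rint (i2 _)).
rewrite (Fubini iprod); apply: eq_integral => y _.
by rewrite (EFin_Rint (i1 _)).
Qed.

End parameter_integrals.

(** * The plane: Borel sets, sigma-finiteness, boxes *)

#[global] Instance ae_leb2_filter (R : realType) :
  Filter (nbhs (almost_everywhere (@leb2 R))).
Proof. exact: ae_filter_ringOfSetsType. Qed.

Section plane_integrals.
Context {R : realType}.
Implicit Types (x y z : R * R) (v : R * R -> R) (r : R).

(** An open set is the countable union of the rational squares that it contains. This links the
    product sigma-algebra of [plane] to the topology of the plane, whence continuous functions are
    measurable. *)
Lemma open_plane_measurable (A : set (R * R)) : open A ->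
  measurable (A : set (@plane R)).
Proof.
move=> oA.
pose F (a b r : rat) : set (@plane R) :=
  if `[< ball ((ratr a, ratr b) : R * R) (ratr r : R) `<=` A >] then
    (ball (ratr a : R) (ratr r)) `*` (ball (ratr b : R) (ratr r)) else set0.
have -> : A = \bigcup_a \bigcup_b \bigcup_r F a b r.
  apply/seteqP; split=> [x Ax|x [a _ [b _ [r _]]]].
    have /nbhs_ballP[e /= e0 eA] := open_nbhs_nbhs (conj oA Ax).
    (* A rational radius below e / 2, and a centre within that radius of [x], keep the whole square
       inside the ball of radius e. *)
    have /rat_in_itvoo[r] : 0 < e / 2 by rewrite divr_gt0.
    rewrite in_itv/= => /andP[r0 re].
    have /rat_in_itvoo[a] : x.1 < x.1 + ratr r by rewrite ltrDl.
    rewrite in_itv/= => /andP[a0 ar].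
    have /rat_in_itvoo[b] : x.2 < x.2 + ratr r by rewrite ltrDl.
    rewrite in_itv/= => /andP[b0 br].
    exists a => //; exists b => //; exists r => //; rewrite /F.
    case: asboolP => [_|[]].
      by split; rewrite /ball/= ltr_norml; apply/andP; split; lra.
    move=> y [/= y1 y2]; apply: eA; split=> /=.
      by move: y1; rewrite /ball/= !ltr_norml => /andP[h1 h2]; apply/andP; split; lra.
    by move: y2; rewrite /ball/= !ltr_norml => /andP[h1 h2]; apply/andP; split; lra.
  by rewrite /F; case: asboolP => [h xF|_ []//]; apply: h; exact: xF.
do 3 (apply: bigcupT_measurable_rat => ?).
rewrite /F; case: asboolP => // _.
by apply: measurableX; exact: measurable_ball.
Qed.

Lemma continuous_plane_measurable (f : R * R -> R) : continuous f ->
  measurable_fun setT (f : @plane R -> R).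
Proof.
move=> /continuousP cf; apply: (measurability _ (RGenOpens.measurableE R)).
move=> _ [_ [a [b ->] <-]]; rewrite setTI; apply: open_plane_measurable.
exact/cf/interval_open.
Qed.

(** Lebesgue measure with its sigma-finite structure, which the type of [leb1] forgets and Tonelli
    requires. *)
Definition sleb1 : {sigma_finite_measure set (measurableTypeR R) -> \bar R} :=
  @lebesgue_measure R.

(** A named carrier to which the sigma-finite structure of the product measure is attached, through
    the exhaustion by the squares [-n, n]^2. *)
Definition leb2_fun : set (@plane R) -> \bar R := leb2.

HB.instance Definition _ := Measure.copy leb2_fun leb2.

Let leb2_sigma_finite : sigma_finite setT leb2_fun.
Proof.
pose I (n : nat) : set R := [set` `[- n%:R, n%:R]%R].
exists (fun n => I n `*` I n).
  apply/seteqP; split=> // x _.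
  exists (Num.truncn (Num.max `|x.1| `|x.2|)).+1 => //.
  have := truncnS_gt (Num.max `|x.1| `|x.2|).
  rewrite gt_max => /andP[/ltW h1 /ltW h2].
  by split; rewrite /I/= in_itv/= -ler_norml.
move=> n; split; first by apply: measurableX; exact: measurable_itv.
rewrite /leb2_fun.
have -> : @leb2 R (I n `*` I n) =
    (@lebesgue_measure R (I n) * @lebesgue_measure R (I n))%E.
  by apply: (@product_measure1E _ _ _ _ R lebesgue_measure sleb1);
    exact: measurable_itv.
rewrite /I.
by rewrite !lebesgue_measure_itv/= !lte_fin; case: ifPn => _;
  rewrite ?mule0 ?ltry//= -EFinB -EFinM ltry.
Qed.

HB.instance Definition _ := Measure_isSigmaFinite.Build _ _ _ leb2_fun
  leb2_sigma_finite.

Definition sleb2 : {sigma_finite_measure set (@plane R) -> \bar R} := leb2_fun.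

Lemma measurable_Rint1 d (T : measurableType d) (f : T -> R -> R) :
  measurable_fun setT (fun z : T * measurableTypeR R => f z.1 z.2) ->
  measurable_fun setT (fun s => \int[leb1]_a f s a).
Proof. exact: (@measurable_Rint _ _ _ _ R sleb1). Qed.

Lemma measurable_Rint2 d (T : measurableType d) (f : T -> R * R -> R) :
  measurable_fun setT (fun z : T * plane => f z.1 z.2) ->
  measurable_fun setT (fun s => \int[leb2]_y f s y).
Proof. exact: (@measurable_Rint _ _ _ _ R sleb2). Qed.

Lemma measurable_comp1 d (T : measurableType d) (f : R -> R) (g : T -> R) :
  continuous f -> measurable_fun setT g -> measurable_fun setT (fun s => f (g s)).
Proof.
by move=> cf mg; apply: measurableT_comp => //; exact: continuous_measurable_fun.
Qed.

(* [powR] at exponent [-1] is the inverse on nonnegative numbers. *)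
Lemma measurable_inv d (T : measurableType d) (g : T -> R) :
  measurable_fun setT g -> (forall s, 0 <= g s) ->
  measurable_fun setT (fun s => (g s)^-1).
Proof.
move=> mg g0; rewrite (_ : (fun s => _) = (fun s => (g s) `^ (- 1))).
  exact: (measurableT_comp (measurable_powR (-1 : R)) mg).
by apply/funext => s; rewrite powR_inv1.
Qed.

Lemma plane_normE x : `|x| = Num.max `|x.1| `|x.2|.
Proof. by []. Qed.

Lemma plane_norm1 x : `|x.1| <= `|x|.
Proof. by rewrite plane_normE le_max lexx. Qed.

Lemma plane_norm2 x : `|x.2| <= `|x|.
Proof. by rewrite plane_normE le_max lexx orbT. Qed.

Lemma plane_norm_le x r : (`|x| <= r) = (`|x.1| <= r) && (`|x.2| <= r).
Proof. by rewrite plane_normE ge_max. Qed.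

Lemma measurable_normB x :
  measurable_fun setT (fun y : plane => `|y - x| : R).
Proof.
rewrite (_ : (fun y => _) = (fun y : plane => Num.max `|y.1 - x.1| `|y.2 - x.2|)) //.
apply: measurable_maxr; apply: measurableT_comp => //.
  by apply: measurable_funB => //; exact: measurable_fst.
by apply: measurable_funB => //; exact: measurable_snd.
Qed.

(** A square of side 2 r, the norm being the maximum norm. As a product of intervals it has an
    explicit measure, which is why the dyadic decompositions below use it in place of Euclidean
    discs. *)
Definition box x r : set (@plane R) := [set y | `|y - x| <= r].

Lemma boxE x r : box x r = `[x.1 - r, x.1 + r]%classic `*` `[x.2 - r, x.2 + r]%classic.
Proof.
apply/seteqP; split=> y; rewrite /box/= plane_norm_le/= !in_itv/= !ler_distl.
  by move=> /andP[-> ->].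
by move=> [-> ->].
Qed.

Lemma measurable_box x r : measurable (box x r).
Proof. by rewrite boxE; apply: measurableX; exact: measurable_itv. Qed.

Lemma leb2_box x r : 0 <= r -> leb2 (box x r) = (4 * r ^+ 2)%:E.
Proof.
move=> r0; pose I (a : R) : set R := [set` `[a - r, a + r]%R].
rewrite boxE -/(I x.1) -/(I x.2).
have -> : @leb2 R (I x.1 `*` I x.2) =
    (@lebesgue_measure R (I x.1) * @lebesgue_measure R (I x.2))%E.
  by apply: (@product_measure1E _ _ _ _ R lebesgue_measure sleb1);
    exact: measurable_itv.
have H a : @lebesgue_measure R (I a) = (2 * r)%:E.
  rewrite lebesgue_measure_itv/= lte_fin; case: ifPn => [_|].
    by rewrite -EFinB; congr EFin; ring.
  by rewrite -leNgt => h; congr EFin; lra.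
by rewrite !H -EFinM; congr EFin; ring.
Qed.

Lemma set1_box x : [set x] = box x 0.
Proof.
apply/seteqP; split=> y; rewrite /box/=; first by move=> ->; rewrite subrr normr0.
by rewrite normr_le0 subr_eq0 => /eqP.
Qed.

Lemma ae_neq x : {ae leb2, forall y : R * R, y <> x}.
Proof.
exists [set x]; split.
- by rewrite set1_box; exact: measurable_box.
- by rewrite set1_box leb2_box// expr0n mulr0.
- by move=> y /= /contrapT.
Qed.

End plane_integrals.

Section monotone_limit.
Context d (T : measurableType d) (R : realType) (mu : {measure set T -> \bar R}).

Lemma cvgn_ge (u : nat -> R) (l c : R) :
  u @ \oo --> l -> (forall n, c <= u n) -> c <= l.
Proof.
by move=> ul cu; rewrite -(cvg_lim _ ul)//; apply: limr_ge; [exact: cvgP ul|exact: nearW].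
Qed.

Lemma cvgn_le (u : nat -> R) (l c : R) :
  u @ \oo --> l -> (forall n, u n <= c) -> l <= c.
Proof.
by move=> ul cu; rewrite -(cvg_lim _ ul)//; apply: limr_le; [exact: cvgP ul|exact: nearW].
Qed.

(** Monotone convergence for truncated singularities: the uniform bound on the truncations makes the
    limit integrable. *)
Lemma integr_lim (u : nat -> T -> R) (f : T -> R) (C : R) :
  (forall n, measurable_fun setT (u n)) -> measurable_fun setT f ->
  (forall n x, 0 <= u n x) ->
  (forall x n m, (n <= m)%N -> u n x <= u m x) ->
  (forall x, u ^~ x @ \oo --> f x) ->
  (forall n, mu.-integrable setT (EFin \o u n)) ->
  (forall n, \int[mu]_x u n x <= C) ->
  mu.-integrable setT (EFin \o f) /\ \int[mu]_x f x <= C.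
Proof.
move=> mu_ mf u0 und uf iu uC.
apply: integr_fin => //.
  by move=> x; apply: (cvgn_ge (uf x)).
rewrite (_ : (\int[mu]_x (f x)%:E = \int[mu]_x limn (fun n => (u n x)%:E))%E); last first.
  apply: eq_integral => x _; apply/esym/cvg_lim => //.
  by apply/cvg_EFin; [exact: nearW|exact: uf].
have mun n : measurable_fun setT (EFin \o u n) by exact/measurable_EFinP.
rewrite monotone_convergence//; last 2 first.
- by move=> n x _; rewrite lee_fin.
- by move=> x _ n m nm; rewrite lee_fin und.
apply: lime_le.
  apply: ereal_nondecreasing_is_cvgn => n m nm; apply: ge0_le_integral => //.
  - by move=> x _; rewrite lee_fin.
  - exact: mun.
  - exact: mun.
  - by move=> x _; rewrite lee_fin und.
have H n : (\int[mu]_x (u n x)%:E <= C%:E)%E by rewrite -EFin_Rint// lee_fin.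
exact: nearW.
Qed.

End monotone_limit.

(** * Weakly singular integrals in the plane *)

Section singular_integrals.
Context {R : realType}.
Implicit Types (x y : R * R).
Variables (v : R * R -> R) (V : R).
Hypothesis mv : measurable_fun setT (v : plane -> R).
Hypothesis v0 : forall y, 0 <= v y.
Hypothesis iv : leb2.-integrable setT (EFin \o v).
Hypothesis vV1 : \int[leb2]_y v y <= V.
Hypothesis vVoo : {ae leb2, forall y, v y <= V}.

Lemma bound_ge0 : 0 <= V.
Proof. by apply: le_trans vV1; exact: Rint_ge0. Qed.

Lemma Rint_box x r : 0 <= r -> \int[leb2]_y (\1_(box x r) y * v y) <= 4 * V * r ^+ 2.
Proof.
move=> r0.
have i1 : leb2.-integrable setT (EFin \o (\1_(box x r) : plane -> R)).
  apply: integr_indic; first exact: measurable_box.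
  by rewrite leb2_box// ltry.
apply: (@le_trans _ _ (\int[leb2]_y (V * \1_(box x r) y))).
  apply: ae_le_Rint.
  - by apply: indicM_integr => //; exact: measurable_box.
  - exact: integrZ.
  - by apply: filterS vVoo => y vy; rewrite mulrC ler_wpM2r.
rewrite RintZ// Rint_indic; last exact: measurable_box.
by rewrite leb2_box//= mulrCA mulrA.
Qed.

(** Truncation of the singularity at radius r / 2^m: [m] counts the dyadic layers kept inside the
    box of radius [r]. *)
Definition shell p x r m y : R :=
  \1_(box x r `\` box x (r / 2 ^+ m)) y * (v y / `|y - x| ^+ p).

Lemma measurable_vdiv p x : measurable_fun setT (fun y : plane => v y / `|y - x| ^+ p).
Proof.
apply: measurable_funM => //; apply: measurable_inv; last by move=> ?; exact: exprn_ge0.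
by apply: measurable_funX; exact: measurable_normB.
Qed.

Lemma measurable_shell p x r m : measurable_fun setT (shell p x r m : plane -> R).
Proof.
apply: measurable_funM; last exact: measurable_vdiv.
by apply: measurable_indic; apply: measurableD; exact: measurable_box.
Qed.

Lemma vdiv_ge0 p x y : 0 <= v y / `|y - x| ^+ p.
Proof. by rewrite divr_ge0// exprn_ge0. Qed.

Lemma shell_ge0 p x r m y : 0 <= shell p x r m y.
Proof. by rewrite mulr_ge0// vdiv_ge0. Qed.

Lemma shell_in p x r m y : r / 2 ^+ m < `|y - x| -> `|y - x| <= r ->
  shell p x r m y = v y / `|y - x| ^+ p.
Proof.
move=> h1 h2; rewrite /shell indicE mem_set ?mul1r//; split => //.
by rewrite /box/=; apply/negP; rewrite -ltNge.
Qed.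

Lemma shell_out p x r m y : ~ (r / 2 ^+ m < `|y - x| /\ `|y - x| <= r) ->
  shell p x r m y = 0.
Proof.
move=> h; rewrite /shell indicE memNset ?mul0r// => -[h1 h2]; apply: h.
by split=> //; rewrite ltNge; apply/negP.
Qed.

Lemma shell_integr p x r m : 0 < r -> leb2.-integrable setT (EFin \o shell p x r m).
Proof.
move=> r0; apply: (@integr_le _ _ _ leb2 _ (fun y => (2 ^+ m / r) ^+ p * v y)).
- exact: measurable_shell.
- exact: integrZ.
- move=> y; rewrite ger0_norm ?shell_ge0//.
  have [[h1 h2]|h] := pselect (r / 2 ^+ m < `|y - x| /\ `|y - x| <= r).
    rewrite shell_in// mulrC ler_wpM2r// -exprVn lerXn2r ?nnegrE//.
    + by rewrite divr_ge0// ltW.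
    + rewrite -[leRHS]invrK lef_pV2 ?posrE ?invr_gt0 ?divr_gt0//.
        by rewrite invf_div ltW.
      by apply: lt_trans h1; rewrite divr_gt0.
  by rewrite shell_out// mulr_ge0// exprn_ge0// divr_ge0// ltW.
Qed.

(** The layer between r / 2^(m+1) and r / 2^m carries mass at most 4 V (r / 2^m)^2 by the bound on
    [v], and the singular weight there is at most (2^(m+1) / r)^p. *)
Lemma shell_step p x r m : 0 < r -> \int[leb2]_y shell p x r m.+1 y <=
  \int[leb2]_y shell p x r m y +
  (2 ^+ m.+1 / r) ^+ p * (4 * V * (r / 2 ^+ m) ^+ 2).
Proof.
move=> r0.
have c0 : 0 <= (2 ^+ m.+1 / r) ^+ p by rewrite exprn_ge0// divr_ge0// ltW.
have ib : leb2.-integrable setT (EFin \o (fun y => \1_(box x (r / 2 ^+ m)) y * v y)).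
  by apply: indicM_integr => //; exact: measurable_box.
apply: (@le_trans _ _ (\int[leb2]_y shell p x r m y + (2 ^+ m.+1 / r) ^+ p *
    \int[leb2]_y (\1_(box x (r / 2 ^+ m)) y * v y))); last first.
  by rewrite lerD2l ler_wpM2l// Rint_box// divr_ge0// ltW.
rewrite -RintZ// -RintD//; [|exact: shell_integr|exact: integrZ].
apply: le_Rint.
- exact: shell_integr.
- by apply: integrD; [exact: shell_integr|exact: integrZ].
move=> y; have [[h1 h2]|h] := pselect (r / 2 ^+ m.+1 < `|y - x| /\ `|y - x| <= r); last first.
  by rewrite shell_out// addr_ge0 ?shell_ge0// mulr_ge0// mulr_ge0.
have [h3|h3] := ltP (r / 2 ^+ m) `|y - x|.
  by rewrite !shell_in// lerDl mulr_ge0// mulr_ge0.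
rewrite shell_in// ler_wpDl ?shell_ge0//.
rewrite indicE mem_set// mul1r mulrC ler_wpM2r// -exprVn lerXn2r ?nnegrE//.
  by rewrite divr_ge0// ltW.
rewrite -[leRHS]invrK lef_pV2 ?posrE ?invr_gt0 ?divr_gt0//.
  by rewrite invf_div ltW.
by apply: lt_trans h1; rewrite divr_gt0.
Qed.

Lemma shell0 p x r : \int[leb2]_y shell p x r 0 y = 0.
Proof.
rewrite (eq_Rint leb2 (g := fun=> 0)) ?Rintegral_cst ?mul0r// => y.
rewrite shell_out// expr0 divr1 => -[h1 h2].
by move: (lt_le_trans h1 h2); rewrite ltxx.
Qed.

(** For p = 1 the layer number m contributes 8 V r / 2^m, a geometric series with sum 16 V r. *)
Lemma shell1_le x r m : 0 < r ->
  \int[leb2]_y shell 1 x r m y <= 16 * V * r * (1 - (2 ^+ m)^-1).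
Proof.
move=> r0; elim: m => [|m ih]; first by rewrite shell0 expr0 invr1 subrr mulr0.
apply: le_trans (shell_step _ _ _ r0) _; apply: le_trans (lerD ih (lexx _)) _.
rewrite le_eqVlt; apply/orP; left; apply/eqP.
have := gt_eqF r0; have : (2 ^+ m != 0 :> R) by rewrite expf_neq0.
rewrite expr1 ![2 ^+ m.+1]exprS; move: (2 ^+ m) => c c0 /negbT r0'.
by field; rewrite c0 r0'.
Qed.

(** For p = 2 every layer contributes the same 16 V. This is the logarithmic divergence from which
    the factor n of the log-Lipschitz modulus comes. *)
Lemma shell2_le x r m : 0 < r -> \int[leb2]_y shell 2 x r m y <= 16 * V * m%:R.
Proof.
move=> r0; elim: m => [|m ih]; first by rewrite shell0 mulr0.
apply: le_trans (shell_step _ _ _ r0) _; apply: le_trans (lerD ih (lexx _)) _.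
rewrite le_eqVlt; apply/orP; left; apply/eqP.
have := gt_eqF r0; have : (2 ^+ m != 0 :> R) by rewrite expf_neq0.
rewrite -[m.+1%:R]natr1 ![2 ^+ m.+1]exprS; move: (2 ^+ m) => c c0 /negbT r0'.
by field; rewrite c0 r0'.
Qed.

Definition near1 x r y : R := \1_(box x r) y * (v y / `|y - x|).

Lemma near1_int x r : 0 < r -> leb2.-integrable setT (EFin \o near1 x r) /\
  \int[leb2]_y near1 x r y <= 16 * V * r.
Proof.
move=> r0; apply: (@integr_lim _ _ _ leb2 (shell 1 x r)).
- by move=> n; exact: measurable_shell.
- apply: measurable_funM; last exact: (measurable_vdiv 1).
  by apply: measurable_indic; exact: measurable_box.
- by move=> n y; exact: shell_ge0.
- move=> y n m nm.
  have [[h1 h2]|h] := pselect (r / 2 ^+ n < `|y - x| /\ `|y - x| <= r); last first.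
    by rewrite shell_out// shell_ge0.
  rewrite !shell_in//; apply: le_lt_trans h1.
  by rewrite ler_pM2l// lef_pV2 ?posrE// ler_eXn2l// ltr1n.
- move=> y; have [->|yx] := eqVneq y x.
    (* At the centre the integrand is 0, since the inverse of 0 is 0. *)
    rewrite /near1 subrr normr0 invr0 !mulr0.
    rewrite (_ : (fun n => _) = cst 0); first exact: cvg_cst.
    by apply/funext => n; rewrite /shell subrr normr0 expr1 invr0 !mulr0.
  have d0 : 0 < `|y - x| by rewrite normr_gt0 subr_eq0.
  have [h|h] := leP `|y - x| r; last first.
    rewrite (_ : (fun n => _) = cst 0).
      by rewrite /near1 indicE memNset ?mul0r; [exact: cvg_cst|
        rewrite /box/=; apply/negP; rewrite -ltNge].
    by apply/funext => n; rewrite shell_out// => -[_]; rewrite leNgt h.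
  apply: cvg_near_cst; near=> n.
  rewrite /near1 indicE mem_set// mul1r shell_in//.
  rewrite ltr_pdivrMr// mulrC -ltr_pdivrMr//.
  apply: lt_trans (_ : n%:R < _); last by rewrite -natrX ltr_nat ltn_expl.
  by near: n; exact: nbhs_infty_gtr.
- by move=> n; exact: shell_integr.
- move=> n; apply: le_trans (shell1_le _ _ r0) _.
  have V0 := bound_ge0.
  rewrite ler_piMr ?lerBlDr ?lerDl ?invr_ge0 ?exprn_ge0//.
  by rewrite !mulr_ge0// ltW.
Unshelve. all: by end_near. Qed.

Definition far p x r y : R := \1_(~` box x r) y * (v y / `|y - x| ^+ p).

Lemma measurable_far p x r : measurable_fun setT (far p x r : plane -> R).
Proof.
apply: measurable_funM; last exact: measurable_vdiv.
by apply: measurable_indic; apply: measurableC; exact: measurable_box.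
Qed.

Lemma farE p x r y : r < `|y - x| -> far p x r y = v y / `|y - x| ^+ p.
Proof.
by move=> h; rewrite /far indicE mem_set ?mul1r// /setC/box/=; apply/negP; rewrite -ltNge.
Qed.

Lemma far_out p x r y : `|y - x| <= r -> far p x r y = 0.
Proof. by move=> h; rewrite /far indicE memNset ?mul0r// /setC/box/=; apply. Qed.

(** The [n] layers between 2^-n and 1 cost 16 V each; beyond distance 1 the weight is below 1 and
    the total mass [V] suffices. *)
Lemma far2_int x n : leb2.-integrable setT (EFin \o far 2 x (2 ^+ n)^-1) /\
  \int[leb2]_y far 2 x (2 ^+ n)^-1 y <= 16 * V * n.+1%:R.
Proof.
have i1 : leb2.-integrable setT (EFin \o (fun y => shell 2 x 1 n y + v y)).
  by apply: integrD => //; exact: shell_integr.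
have le1 y : `|far 2 x (2 ^+ n)^-1 y| <= shell 2 x 1 n y + v y.
  have [h|h] := leP `|y - x| (2 ^+ n)^-1.
    by rewrite far_out// normr0 addr_ge0// shell_ge0.
  rewrite farE// ger0_norm ?vdiv_ge0//.
  have [h1|h1] := leP `|y - x| 1; first by rewrite shell_in// ?div1r// lerDl.
  rewrite ler_wpDl ?shell_ge0// ler_piMr// invf_le1 ?exprn_gt0 ?(lt_trans _ h1)//.
  by rewrite exprn_ege1// ltW.
have i2 : leb2.-integrable setT (EFin \o far 2 x (2 ^+ n)^-1).
  by apply: integr_le i1 le1; exact: measurable_far.
split=> //; apply: (@le_trans _ _ (\int[leb2]_y (shell 2 x 1 n y + v y))).
  by apply: le_Rint => // y; apply: le_trans (ler_norm _) (le1 y).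
rewrite RintD//; last exact: shell_integr.
rewrite -[n.+1%:R]natr1 mulrDr mulr1 lerD//; first exact: shell2_le.
by apply: (le_trans vV1); have := bound_ge0; lra.
Qed.

(** Cut at distance 1: the singularity costs 16 V and the rest at most the total mass V. *)
Lemma riesz_int x : leb2.-integrable setT (EFin \o (fun y => v y / `|y - x|)) /\
  \int[leb2]_y (v y / `|y - x|) <= 17 * V.
Proof.
have [i1 b1] := near1_int x ltr01.
have i2 : leb2.-integrable setT (EFin \o (fun y => near1 x 1 y + v y)) by exact: integrD.
have le1 y : `|v y / `|y - x| | <= near1 x 1 y + v y.
  have := vdiv_ge0 1 x y; rewrite expr1 => h0; rewrite ger0_norm//.
  have [h|h] := leP `|y - x| 1.
    by rewrite /near1 indicE mem_set// mul1r lerDl.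
  rewrite ler_wpDl ?mulr_ge0// ?invr_ge0// ler_piMr// invf_le1 ?(lt_trans _ h)//.
  exact: ltW.
split; first by apply: integr_le i2 le1; exact: (measurable_vdiv 1).
apply: (@le_trans _ _ (\int[leb2]_y (near1 x 1 y + v y))).
  apply: le_Rint => //; first by apply: integr_le i2 le1; exact: (measurable_vdiv 1).
  by move=> y; apply: le_trans (ler_norm _) (le1 y).
rewrite RintD// (_ : 17 * V = 16 * V * 1 + V) ?lerD//; ring.
Qed.

End singular_integrals.

(** * Elementary calculus on the line *)

Section one_variable.
Context {R : realType}.

(** No order is imposed between [a] and [b]; the intermediate point is therefore located by its
    distance to [a]. *)
Lemma mvt1 (f df : R -> R) (a b : R) : (forall t : R, is_derive t 1 f (df t)) ->
  exists2 c, `|c - a| <= `|b - a| & f b - f a = df c * (b - a).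
Proof.
move=> fd.
have cf : continuous f.
  by move=> t; apply/differentiable_continuous/derivable1_diffP; have [] := fd t.
have [ab|ba] := leP a b.
  have [c] := MVT_segment ab (fun t _ => fd t) (continuous_subspaceT cf).
  rewrite in_itv/= => /andP[ac cb] e; exists c => //.
  by rewrite !ger0_norm ?subr_ge0// lerD2r.
have [c] := MVT_segment (ltW ba) (fun t _ => fd t) (continuous_subspaceT cf).
rewrite in_itv/= => /andP[ac cb] e; exists c.
  by rewrite !ler0_norm ?subr_le0 ?(ltW ba)// lerN2 lerD2r.
by rewrite -opprB e -mulrN opprB.
Qed.

Lemma sin_norm_le (a : R) : `|sin a| <= `|a|.
Proof.
have [c _] := @mvt1 sin cos 0 a (@is_derive_sin R).
rewrite sin0 !subr0 => ->; rewrite normrM ler_piMl//.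
by rewrite ler_norml cos_geN1 cos_le1.
Qed.

Lemma one_sub_cos_le (a : R) : 2 * (1 - cos a) <= a ^+ 2.
Proof.
have e : a = a / 2 + a / 2 by field.
have := cos2Dsin2 (a / 2); have := sin_norm_le (a / 2).
rewrite -ler_sqr ?nnegrE// !real_normK ?num_real// => h1 h2.
by rewrite {1}e cosD; nra.
Qed.

Lemma Rint_oppi (f : R -> R) : leb1.-integrable setT (EFin \o f) ->
  leb1.-integrable setT (EFin \o (fun a => f (- a))) /\
  \int[leb1]_a f (- a) = \int[leb1]_a f a.
Proof.
move=> intf.
have mf := measurable_int _ intf.
pose N : measurableTypeR R -> measurableTypeR R := -%R.
have mN : measurable_fun setT N by exact: oppr_measurable.
have mfN : measurable_fun setT ((EFin \o f) \o N) by exact: measurableT_comp.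
have eN (h : R -> \bar R) : (\int[pushforward leb1 N]_(a in setT) h a = \int[leb1]_a h a)%E.
  by apply: eq_measure_integral => A mA _ /=; rewrite /leb1 -(lebesgue_measureN mA).
have iN : leb1.-integrable setT (EFin \o (fun a => f (- a))).
  apply/integrableP; split => //.
  have := @ge0_integral_pushforward _ _ _ _ R N mN leb1 setT (fun a => `|(f a)%:E|%E) measurableT.
  rewrite preimage_setT eN => <- //.
    by have [] := integrableP _ _ _ intf.
  exact: measurableT_comp.
split=> //; congr fine.
have e := @integral_pushforward _ _ _ _ R N mN leb1 setT ((EFin \o f) \o N) mfN.
transitivity (\int[pushforward leb1 N]_(a in setT) ((EFin \o f) \o N) a)%E.
  by rewrite eN.
rewrite e//; first by apply: eq_integral => a _ /=; rewrite /N opprK.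
by rewrite preimage_setT; apply: eq_integrable intf => // a _ /=; rewrite /N opprK.
Qed.

Lemma Rint_opp (f : R -> R) : leb1.-integrable setT (EFin \o f) ->
  \int[leb1]_a f (- a) = \int[leb1]_a f a.
Proof. by move=> /Rint_oppi[]. Qed.

Lemma measurable_cauchy (r : R) : measurable_fun setT (fun a : R => (a ^+ 2 + r ^+ 2)^-1).
Proof.
apply: measurable_inv.
  by apply: measurable_funD => //; exact: exprn_measurable.
by move=> a; rewrite addr_ge0// sqr_ge0.
Qed.

Lemma cauchy_integral (r : R) : 0 < r ->
  leb1.-integrable setT (EFin \o (fun a : R => (a ^+ 2 + r ^+ 2)^-1)) /\
  \int[leb1]_a (a ^+ 2 + r ^+ 2)^-1 <= pi / r.
Proof.
move=> r0; have r2 (a : R) : 0 < a ^+ 2 + r ^+ 2.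
  by rewrite ltr_wpDl ?sqr_ge0// exprn_gt0.
have cf : continuous (fun a : R => (a ^+ 2 + r ^+ 2)^-1).
  move=> a; apply: cvgV; first by rewrite gt_eqF.
  by apply: cvgD; [exact: exprn_continuous|exact: cvg_cst].
apply: integr_fin.
- exact: measurable_cauchy.
- by move=> a; rewrite invr_ge0 ltW.
rewrite ge0_symfun_integralT//; last 2 first.
- by move=> a; rewrite invr_ge0 ltW.
- by move=> a /=; rewrite sqrrN.
have -> : [set x : R | 0 <= x] = `[0, +oo[%classic.
  by apply/seteqP; split => x /=; rewrite in_itv/= andbT.
have dF (x : R) : is_derive x 1 (fun a : R => r^-1 * atan (r^-1 * a)) (x ^+ 2 + r ^+ 2)^-1.
  apply: is_derive_eq.
  rewrite /GRing.scale/= ?mulr1 ?addr0 ?add0r.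
  have r1 : r != 0 by rewrite gt_eqF.
  have h := lt0r_neq0 (r2 x).
  have h1 : 1 + (r^-1 * x) ^+ 2 != 0.
    by rewrite lt0r_neq0// ltr_pwDl// sqr_ge0.
  by field; rewrite h r1.
set F := fun a : R => r^-1 * atan (r^-1 * a) in dF.
have dF1 (x : R) : derivable F x 1 by have [] := dF x.
have cF : continuous F.
  by move=> x; apply/differentiable_continuous/derivable1_diffP.
rewrite (@ge0_continuous_FTC2y _ _ F 0 (r^-1 * (pi / 2))).
- rewrite /F mulr0 atan0 mulr0 -EFinB -EFinM lee_fin.
  by rewrite le_eqVlt; apply/orP; left; apply/eqP; field; rewrite gt_eqF.
- by move=> x _; rewrite invr_ge0 ltW.
- exact: continuous_subspaceT.
- apply: cvgM; first exact: cvg_cst.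
  apply: (@cvg_comp _ _ _ (fun a : R => r^-1 * a) atan _ (pinfty_nbhs R)); last exact: cvgy_atan.
  apply/cvgryPge => A; apply: filterS (nbhs_pinfty_ge (num_real (r * A))) => x.
  by rewrite -ler_pdivlMl ?invr_gt0// invrK.
- by move=> x _.
- by apply: cvg_at_right_filter; exact: cF.
- by move=> x _; rewrite derive1E; have [_ ->] := dF x.
Qed.

End one_variable.

(** * The helical kernel *)

Section helical_kernel.
Context {R : realType}.
Implicit Types (x y : R * R) (a : R) (k : 'I_3).

(** The square of the Japanese bracket, see [japanese_sqr]: the weight of order 2, as a
    polynomial. *)
Definition sqweight x : R := 1 + x.1 ^+ 2 + x.2 ^+ 2.

Lemma sqweight_ge1 x : 1 <= sqweight x.
Proof. by rewrite /sqweight -addrA lerDl addr_ge0 ?sqr_ge0. Qed.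

Lemma sqweight_gt0 x : 0 < sqweight x.
Proof. exact: lt_le_trans (sqweight_ge1 x). Qed.

Lemma japanese_sqr x : japanese x ^+ 2 = sqweight x.
Proof.
rewrite /japanese /enorm2 sqr_sqrtr; last by rewrite addr_ge0// sqr_ge0.
by rewrite sqr_sqrtr ?addr_ge0 ?sqr_ge0// addrA.
Qed.

Lemma japaneseE x : japanese x = Num.sqrt (sqweight x).
Proof. by rewrite -japanese_sqr sqrtr_sqr ger0_norm// sqrtr_ge0. Qed.

Lemma japanese_ge1 x : 1 <= japanese x.
Proof. by rewrite japaneseE -[leLHS]sqrtr1 ler_wsqrtr// sqweight_ge1. Qed.

Lemma japanese_le x : japanese x <= sqweight x.
Proof. by rewrite -japanese_sqr ler_eXnr// japanese_ge1. Qed.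

(* Squared distance, and numerator of the kernel, between [x] at height [0] and
   the point of the helical filament through [y] at height [a]. *)
Definition sqdist x y a : R :=
  (x.1 - (Defs.rot a y).1) ^+ 2 + (x.2 - (Defs.rot a y).2) ^+ 2 + a ^+ 2.

Definition knum (k : nat) x y a : R :=
  match k with
  | 0 => x.2 - (Defs.rot a y).2 - a * (Defs.rot a y).1
  | 1 => - (x.1 - (Defs.rot a y).1) - a * (Defs.rot a y).2
  | _ => - ((x.1 - (Defs.rot a y).1) * (Defs.rot a y).1 + (x.2 - (Defs.rot a y).2) * (Defs.rot a y).2)
  end.

Lemma sqdist_ge0 x y a : 0 <= sqdist x y a.
Proof. by rewrite !addr_ge0 ?sqr_ge0. Qed.

Lemma vec3E (c0 c1 c2 : R) :
  (coord1 (vec3 c0 c1 c2) = c0) * (coord2 (vec3 c0 c1 c2) = c1) *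
  (coord3 (vec3 c0 c1 c2) = c2).
Proof. by rewrite /coord1 /coord2 /coord3 /vec3 !mxE !inordK. Qed.

Lemma vec3B (a0 a1 a2 b0 b1 b2 : R) :
  vec3 a0 a1 a2 - vec3 b0 b1 b2 = vec3 (a0 - b0) (a1 - b1) (a2 - b2).
Proof. by apply/rowP => -[[|[|[|i]]] hi]; rewrite !mxE. Qed.

Lemma kernel_integrandE x y a k :
  kernel_integrand x y a ord0 k =
  (Num.sqrt (sqdist x y a) ^+ 3)^-1 * knum k x y a.
Proof.
rewrite /kernel_integrand /embed vec3B mxE /enorm3 /xi /cross !vec3E.
have -> : (x.1 - (Defs.rot a y).1) ^+ 2 + (x.2 - (Defs.rot a y).2) ^+ 2 + (0 - a) ^+ 2 =
  sqdist x y a by rewrite /sqdist sub0r sqrrN.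
congr (_ * _).
by case: k => -[|[|[|k]]] hk; rewrite /vec3 mxE//=; ring.
Qed.

Lemma Kentry x y k : K x y ord0 k =
  - (4 * pi)^-1 * \int[leb1]_a ((Num.sqrt (sqdist x y a) ^+ 3)^-1 * knum k x y a).
Proof.
by rewrite /K mxE; congr (_ * _); apply: eq_Rint => a; rewrite kernel_integrandE.
Qed.

Lemma rot_sqr a y : (Defs.rot a y).1 ^+ 2 + (Defs.rot a y).2 ^+ 2 = y.1 ^+ 2 + y.2 ^+ 2.
Proof. by rewrite /Defs.rot/=; have := cos2Dsin2 a; nra. Qed.

(** The screw motion of angle -a is an isometry. It carries the point at height a on the filament of
    [y] to [y] at height 0, and [x] to the point at height -a on its own filament. Algebraically the
    difference is a multiple of cos^2 + sin^2 - 1. *)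
Lemma sqdist_sym x y a : sqdist x y a = sqdist y x (- a).
Proof.
rewrite /sqdist /Defs.rot/= cosN sinN; have /eqP := cos2Dsin2 a.
rewrite -subr_eq0.
move: (cos a) (sin a) x y => c s [x1 x2] [y1 y2] /= /eqP e.
apply/eqP; rewrite -subr_eq0; apply/eqP.
transitivity ((y1 ^+ 2 + y2 ^+ 2 - x1 ^+ 2 - x2 ^+ 2) * (c ^+ 2 + s ^+ 2 - 1)).
  by ring.
by rewrite e mulr0.
Qed.

(** With z the rotation of [y] by a, the part in [x] is x2 z1 - x1 z2 - a (x . z). Exchanging the
    points reverses the determinant, and keeps the scalar product while a changes sign. *)
Lemma knum_antisym x y a :
  x.1 * knum 0 x y a + x.2 * knum 1 x y a +
  (y.1 * knum 0 y x (- a) + y.2 * knum 1 y x (- a)) = 0.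
Proof. by rewrite /knum /Defs.rot/= cosN sinN; ring. Qed.

Lemma sqdist_ge_height x y a : a ^+ 2 <= sqdist x y a.
Proof. by rewrite /sqdist lerDr addr_ge0 ?sqr_ge0. Qed.

Lemma rot_sub_le y a :
  (y.1 - (Defs.rot a y).1) ^+ 2 + (y.2 - (Defs.rot a y).2) ^+ 2 <=
  a ^+ 2 * (y.1 ^+ 2 + y.2 ^+ 2).
Proof.
have -> : (y.1 - (Defs.rot a y).1) ^+ 2 + (y.2 - (Defs.rot a y).2) ^+ 2 =
    2 * (1 - cos a) * (y.1 ^+ 2 + y.2 ^+ 2).
  rewrite /Defs.rot/=; have /eqP := cos2Dsin2 a; rewrite -subr_eq0 => /eqP e.
  apply/eqP; rewrite -subr_eq0; apply/eqP.
  transitivity ((y.1 ^+ 2 + y.2 ^+ 2) * (cos a ^+ 2 + sin a ^+ 2 - 1)); first by ring.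
  by rewrite e mulr0.
by rewrite ler_wpM2r ?addr_ge0 ?sqr_ge0// one_sub_cos_le.
Qed.

(** Rotation by a moves [y] by at most |a| |y|, and the height contributes a^2 to [sqdist]. Hence
    the planar distance is at most a multiple of <y> times the helical one. *)
Lemma sqr_norm_le_sqdist_r x y a : `|x - y| ^+ 2 <= 2 * sqweight y * sqdist x y a.
Proof.
have h := rot_sub_le y a; have ha := sqdist_ge_height x y a.
have hs := sqdist_ge0 x y a.
have ey : 0 <= y.1 ^+ 2 + y.2 ^+ 2 by rewrite addr_ge0 ?sqr_ge0.
have h' : a ^+ 2 * (y.1 ^+ 2 + y.2 ^+ 2) <= sqdist x y a * (y.1 ^+ 2 + y.2 ^+ 2).
  by rewrite ler_wpM2r.
have hd : (x.1 - (Defs.rot a y).1) ^+ 2 + (x.2 - (Defs.rot a y).2) ^+ 2 <= sqdist x y a.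
  by rewrite /sqdist lerDl sqr_ge0.
have sq2 (p q r : R) : (p - q) ^+ 2 <= 2 * (p - r) ^+ 2 + 2 * (q - r) ^+ 2.
  have := sqr_ge0 (p + q - 2 * r); nra.
have s1 := sqr_ge0 (x.1 - (Defs.rot a y).1); have s2 := sqr_ge0 (x.2 - (Defs.rot a y).2).
have s3 := sqr_ge0 (y.1 - (Defs.rot a y).1); have s4 := sqr_ge0 (y.2 - (Defs.rot a y).2).
have h1 := sq2 x.1 y.1 (Defs.rot a y).1; have h2 := sq2 x.2 y.2 (Defs.rot a y).2.
rewrite plane_normE /sqweight; case: (leP `|_| _) => _;
  rewrite real_normK ?num_real//=; lra.
Qed.

(** The numerator is a component of the cross product of the difference of the two points with [xi],
    whose Euclidean length is <y> by [rot_sqr]. The factor 2 leaves room for estimating each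
    component separately. *)
Lemma knum_le k x y a :
  `|knum k x y a| <= 2 * japanese y * Num.sqrt (sqdist x y a).
Proof.
rewrite -ler_sqr ?nnegrE// ?mulr_ge0 ?sqrtr_ge0// real_normK ?num_real//.
rewrite !exprMn japanese_sqr sqr_sqrtr ?sqdist_ge0//.
have := rot_sqr a y; have := sqweight_ge1 y; rewrite /sqdist /sqweight /knum.
move: (Defs.rot a y) => [z1 z2]/= h1 h2.
have sD (p q : R) : (p + q) ^+ 2 <= 2 * p ^+ 2 + 2 * q ^+ 2.
  have := sqr_ge0 (p - q); nra.
have key (A B C D E : R) : 0 <= A -> 0 <= B -> 0 <= C -> 0 <= D -> 0 <= E ->
    2 * B + 2 * (C * D) <= 2 ^+ 2 * (1 + (D + E)) * (A + B + C).
  move=> A0 B0 C0 D0 E0.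
  have := mulr_ge0 D0 A0; have := mulr_ge0 D0 B0; have := mulr_ge0 D0 C0.
  have := mulr_ge0 E0 A0; have := mulr_ge0 E0 B0; have := mulr_ge0 E0 C0.
  by move=> *; nra.
rewrite -[1 + _ + _]addrA -h2; case: k => -[|[|[|k]]] hk //=.
- by apply: le_trans (sD _ _) _; rewrite sqrrN exprMn key ?sqr_ge0.
- apply: le_trans (sD _ _) _; rewrite !sqrrN exprMn.
  by rewrite [z1 ^+ 2 + _]addrC [(x.1 - z1) ^+ 2 + _]addrC key ?sqr_ge0.
- rewrite sqrrN; have := sqr_ge0 ((x.1 - z1) * z2 - (x.2 - z2) * z1).
  move: (x.1 - z1) (x.2 - z2) => p q h.
  have {}h : (p * z1 + q * z2) ^+ 2 <= (p ^+ 2 + q ^+ 2) * (z1 ^+ 2 + z2 ^+ 2) by nra.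
  apply: le_trans h _.
  have pq : 0 <= p ^+ 2 + q ^+ 2 by rewrite addr_ge0 ?sqr_ge0.
  have zz : 0 <= z1 ^+ 2 + z2 ^+ 2 by rewrite addr_ge0 ?sqr_ge0.
  have := sqr_ge0 a; move: (p ^+ 2 + q ^+ 2) (z1 ^+ 2 + z2 ^+ 2) (a ^+ 2) pq zz.
  by move=> A B C A0 B0 C0; have := mulr_ge0 A0 B0; have := mulr_ge0 B0 C0; nra.
Qed.

(** Reciprocal of the helical distance. It is 0 where the distance vanishes, so that [kint_le] holds
    at every height. *)
Definition rsig x y a : R := (Num.sqrt (sqdist x y a))^-1.

Lemma rsig_ge0 x y a : 0 <= rsig x y a.
Proof. by rewrite invr_ge0 sqrtr_ge0. Qed.

Lemma rsig_sqr x y a : rsig x y a ^+ 2 = (sqdist x y a)^-1.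
Proof. by rewrite exprVn sqr_sqrtr ?sqdist_ge0. Qed.

Lemma japanese_ge0 x : 0 <= japanese x.
Proof. exact: le_trans ler01 (japanese_ge1 x). Qed.

Lemma kint_le x y a k :
  `|rsig x y a ^+ 3 * knum k x y a| <= 2 * japanese y * (sqdist x y a)^-1.
Proof.
rewrite normrM ger0_norm ?exprn_ge0 ?rsig_ge0//.
have [s0|s0] := eqVneq (Num.sqrt (sqdist x y a)) 0.
  rewrite /rsig s0 invr0 expr0n/= mul0r.
  by rewrite !mulr_ge0 ?invr_ge0 ?sqdist_ge0 ?japanese_ge0.
have := ler_wpM2l (exprn_ge0 3 (rsig_ge0 x y a)) (knum_le k x y a).
move=> /le_trans; apply; rewrite -rsig_sqr le_eqVlt; apply/orP; left; apply/eqP.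
by rewrite /rsig; field.
Qed.

Lemma knum_lip k x x' y a :
  `|knum k x y a - knum k x' y a| <= 2 * japanese y * `|x - x'|.
Proof.
have j1 := japanese_ge1 y; have n1 := plane_norm1 (x - x'); have n2 := plane_norm2 (x - x').
have n0 := normr_ge0 (x - x').
have jn : `|x - x'| <= 2 * japanese y * `|x - x'| by rewrite ler_peMl//; lra.
have [] : `|(Defs.rot a y).1| <= japanese y /\ `|(Defs.rot a y).2| <= japanese y.
  have hz : (Defs.rot a y).1 ^+ 2 <= sqweight y /\ (Defs.rot a y).2 ^+ 2 <= sqweight y.
    rewrite /sqweight -addrA -(rot_sqr a).
    by have := sqr_ge0 (Defs.rot a y).1; have := sqr_ge0 (Defs.rot a y).2; split; lra.
  by case: hz => h1 h2; split; rewrite -ler_sqr ?nnegrE ?japanese_ge0//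
    real_normK ?num_real// japanese_sqr.
rewrite /knum; move: (Defs.rot a y) => [r1 r2]/= z1 z2.
case: k => -[|[|[|k]]] hk //=.
- by apply: le_trans jn; apply: le_trans n2; rewrite le_eqVlt; apply/orP; left;
  apply/eqP; congr `|_|; rewrite /=; ring.
- apply: le_trans jn; apply: le_trans n1; rewrite -normrN le_eqVlt; apply/orP; left.
  by apply/eqP; congr `|_|; rewrite /=; ring.
- have -> : - ((x.1 - r1) * r1 + (x.2 - r2) * r2) -
      - ((x'.1 - r1) * r1 + (x'.2 - r2) * r2) =
    - ((x - x').1 * r1 + (x - x').2 * r2) by rewrite /=; ring.
  rewrite normrN.
  apply: le_trans (ler_normD _ _) _; rewrite !normrM.
  rewrite (_ : 2 * _ * _ = `|x - x'| * japanese y + `|x - x'| * japanese y); last by ring.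
  by rewrite lerD// ler_pM.
Qed.

Lemma sqrt_sqdist_lip x x' y a :
  `|Num.sqrt (sqdist x y a) - Num.sqrt (sqdist x' y a)| <= 2 * `|x - x'|.
Proof.
set s := Num.sqrt _; set s' := Num.sqrt (sqdist x' y a).
have s0 : 0 <= s by exact: sqrtr_ge0.
have s'0 : 0 <= s' by exact: sqrtr_ge0.
have n1 := plane_norm1 (x - x'); have n2 := plane_norm2 (x - x').
have [e|ss0] := eqVneq (s + s') 0.
  have [-> ->] : s = 0 /\ s' = 0 by split; lra.
  by rewrite subrr normr0 mulr_ge0.
have ss : 0 < s + s' by rewrite lt0r ss0 addr_ge0.
rewrite -(ler_pM2r ss) -[X in `|_| * X <= _](gtr0_norm ss) -normrM.
have -> : (s - s') * (s + s') = s ^+ 2 - s' ^+ 2 by ring.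
rewrite !sqr_sqrtr ?sqdist_ge0//.
have bd (p : R) (t : R) : p ^+ 2 <= t -> `|p| <= Num.sqrt t.
  by move=> h; rewrite -sqrtr_sqr ler_wsqrtr.
pose z := Defs.rot a y.
have -> : sqdist x y a - sqdist x' y a = (x - x').1 * ((x.1 - z.1) + (x'.1 - z.1)) +
   (x - x').2 * ((x.2 - z.2) + (x'.2 - z.2)) by rewrite /sqdist -/z /=; ring.
have h (u : R * R) : `|u.1 - z.1| <= Num.sqrt (sqdist u y a) /\ `|u.2 - z.2| <= Num.sqrt (sqdist u y a).
  split; apply: bd; rewrite /sqdist -/z.
    by rewrite -addrA lerDl addr_ge0 ?sqr_ge0.
  by rewrite [_ + (u.2 - z.2) ^+ 2]addrC -addrA lerDl addr_ge0 ?sqr_ge0.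
have [h1 h2] := h x; have [h3 h4] := h x'; rewrite -/s -/s' in h1 h2 h3 h4.
apply: le_trans (ler_normD _ _) _; rewrite !normrM.
rewrite (_ : 2 * _ * _ = `|x - x'| * (s + s') + `|x - x'| * (s + s')); last by ring.
by rewrite lerD// ler_pM// (le_trans (ler_normD _ _))// lerD.
Qed.

(** A change of numerator plus a change of cubed distance. In the second term the bound on the
    numerator cancels one power of s', and the mixed products are absorbed by p q^2 + p^2 q <= p^3 +
    q^3, which leaves the pairs (x, y) and (x', y) decoupled. *)
Lemma kint_lip k x x' y a : 0 < sqdist x y a -> 0 < sqdist x' y a ->
  `|rsig x y a ^+ 3 * knum k x y a - rsig x' y a ^+ 3 * knum k x' y a| <=
  10 * japanese y * `|x - x'| * (rsig x y a ^+ 3 + rsig x' y a ^+ 3).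
Proof.
move=> s0 s'0.
have j0 := japanese_ge0 y.
have nl := knum_lip k x x' y a; have nb := knum_le k x' y a.
have sl := sqrt_sqdist_lip x x' y a.
rewrite /rsig; move: nl nb sl.
have : 0 < Num.sqrt (sqdist x y a) by rewrite sqrtr_gt0.
have : 0 < Num.sqrt (sqdist x' y a) by rewrite sqrtr_gt0.
move: (Num.sqrt (sqdist x y a)) (Num.sqrt (sqdist x' y a)) => s s' s'p sp.
move: (knum k x y a) (knum k x' y a) (japanese y) j0 (normr_ge0 (x - x')).
move: `|x - x'| => e n n' j j0 e0 nl nb sl.
have sn : s != 0 by rewrite gt_eqF. have s'n : s' != 0 by rewrite gt_eqF.
have -> : s^-1 ^+ 3 * n - s'^-1 ^+ 3 * n' =
  s^-1 ^+ 3 * (n - n') + n' * ((s' - s) * (s ^+ 2 + s * s' + s' ^+ 2) / (s ^+ 3 * s' ^+ 3)).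
  by field; rewrite ?sn ?s'n.
apply: le_trans (ler_normD _ _) _.
have p0 : 0 <= (s ^+ 2 + s * s' + s' ^+ 2) / (s ^+ 3 * s' ^+ 3).
  by rewrite !mulr_ge0// ?invr_ge0 ?addr_ge0 ?mulr_ge0 ?exprn_ge0// ltW.
have s3 : 0 <= s^-1 ^+ 3 by rewrite exprn_ge0// invr_ge0 ltW.
rewrite normrM (ger0_norm s3) -[X in n' * X]mulrA normrM normrM (ger0_norm p0).
apply: (@le_trans _ _ (s^-1 ^+ 3 * (2 * j * e) + (2 * j * s') *
   (2 * e * ((s ^+ 2 + s * s' + s' ^+ 2) / (s ^+ 3 * s' ^+ 3))))).
  rewrite lerD//; first by rewrite ler_wpM2l// exprn_ge0// invr_ge0 ltW.
  apply: ler_pM => //; first by rewrite mulr_ge0.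
  by rewrite ler_wpM2r// distrC.
have -> : s^-1 ^+ 3 * (2 * j * e) + (2 * j * s') *
   (2 * e * ((s ^+ 2 + s * s' + s' ^+ 2) / (s ^+ 3 * s' ^+ 3))) =
  2 * j * e * (s^-1 ^+ 3 + 2 * (s^-1 * s'^-1 ^+ 2 + s^-1 ^+ 2 * s'^-1 + s^-1 ^+ 3)).
  by field; rewrite ?sn ?s'n.
have je : 0 <= j * e by rewrite mulr_ge0.
have ap : 0 <= s^-1 by rewrite invr_ge0 ltW.
have bp : 0 <= s'^-1 by rewrite invr_ge0 ltW.
move: s^-1 s'^-1 ap bp => p q {}p0 q0.
have h1 : p * q ^+ 2 + p ^+ 2 * q <= p ^+ 3 + q ^+ 3.
  have := mulr_ge0 (addr_ge0 p0 q0) (sqr_ge0 (p - q)); nra.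
have p3 := exprn_ge0 3 p0; have q3 := exprn_ge0 3 q0.
have h2 : p ^+ 3 + 2 * (p * q ^+ 2 + p ^+ 2 * q + p ^+ 3) <= 5 * (p ^+ 3 + q ^+ 3) by lra.
rewrite (_ : 10 * _ * _ * _ = 2 * j * e * (5 * (p ^+ 3 + q ^+ 3))); last by ring.
by rewrite ler_wpM2l// -mulrA mulr_ge0.
Qed.

End helical_kernel.

(** * Kernel bounds after integration along the filament *)

Section kernel_estimates.
Context {R : realType}.
Implicit Types (x y : R * R) (a r : R) (k : 'I_3).

Section measurability.
Context d (T : measurableType d) (x1 x2 y1 y2 h : T -> R).
Hypotheses (mx1 : measurable_fun setT x1) (mx2 : measurable_fun setT x2)
  (my1 : measurable_fun setT y1) (my2 : measurable_fun setT y2)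
  (mh : measurable_fun setT h).

Let mcos : measurable_fun setT (fun t => cos (h t)).
Proof. by apply: measurable_comp1 mh; exact: continuous_cos. Qed.

Let msin : measurable_fun setT (fun t => sin (h t)).
Proof. by apply: measurable_comp1 mh; exact: continuous_sin. Qed.

Let mrot1 : measurable_fun setT (fun t => (Defs.rot (h t) (y1 t, y2 t)).1).
Proof. by apply: measurable_funD; apply: measurable_funM. Qed.

Let mrot2 : measurable_fun setT (fun t => (Defs.rot (h t) (y1 t, y2 t)).2).
Proof.
apply: measurable_funD; apply: measurable_funM => //.
exact: measurableT_comp.
Qed.

Lemma measurable_sqdist :
  measurable_fun setT (fun t => sqdist (x1 t, x2 t) (y1 t, y2 t) (h t)).
Proof.
apply: measurable_funD; last exact: measurable_funX.
by apply: measurable_funD; apply: measurable_funX; apply: measurable_funB.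
Qed.

Lemma measurable_knum k :
  measurable_fun setT (fun t => knum k (x1 t, x2 t) (y1 t, y2 t) (h t)).
Proof.
rewrite /knum; case: k => -[|[|k]] _ /=.
- by apply: measurable_funB; [exact: measurable_funB|exact: measurable_funM].
- apply: measurable_funB; last exact: measurable_funM.
  by apply: measurableT_comp => //; exact: measurable_funB.
- apply: measurableT_comp => //.
  by apply: measurable_funD; apply: measurable_funM => //; exact: measurable_funB.
Qed.

Lemma measurable_rsig n :
  measurable_fun setT (fun t => rsig (x1 t, x2 t) (y1 t, y2 t) (h t) ^+ n).
Proof.
apply: measurable_funX; apply: measurable_inv; last by move=> ?; exact: sqrtr_ge0.
by apply: measurable_comp1 measurable_sqdist; exact: sqrt_continuous.
Qed.

Lemma measurable_kint k : measurable_fun setT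
  (fun t => rsig (x1 t, x2 t) (y1 t, y2 t) (h t) ^+ 3 *
            knum k (x1 t, x2 t) (y1 t, y2 t) (h t)).
Proof. by apply: measurable_funM; [exact: measurable_rsig|exact: measurable_knum]. Qed.

End measurability.

Lemma surj2 x : x = (x.1, x.2).
Proof. by case: x. Qed.

Lemma measurable_kint1 x y k : measurable_fun setT
  (fun a : measurableTypeR R => rsig x y a ^+ 3 * knum k x y a).
Proof.
rewrite (surj2 x) (surj2 y).
by apply: (measurable_kint (x1 := fun=> x.1) (x2 := fun=> x.2) (y1 := fun=> y.1)
  (y2 := fun=> y.2)).
Qed.

Lemma measurable_K k :
  measurable_fun setT (fun z : (@plane R * @plane R)%type => K z.1 z.2 ord0 k).
Proof.
rewrite (_ : (fun z => _) = (fun z => - (4 * pi)^-1 *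
   \int[leb1]_a (rsig z.1 z.2 a ^+ 3 * knum k z.1 z.2 a))); last first.
  apply/funext => z; rewrite Kentry; congr (_ * _).
  by apply: eq_Rint => a; rewrite /rsig exprVn.
apply: measurable_funM => //.
apply: (@measurable_Rint1 R _ _
  (fun (z : (@plane R * @plane R)%type) a => rsig z.1 z.2 a ^+ 3 * knum k z.1 z.2 a)).
rewrite (_ : (fun z => _) = (fun z : ((@plane R * @plane R) * measurableTypeR R)%type =>
    rsig (z.1.1.1, z.1.1.2) (z.1.2.1, z.1.2.2) z.2 ^+ 3 *
    knum k (z.1.1.1, z.1.1.2) (z.1.2.1, z.1.2.2) z.2)); last first.
  by apply/funext => -[[[? ?] [? ?]] ?].
have m1 : measurable_fun setT (fun z : ((@plane R * @plane R) * measurableTypeR R)%type => z.1.1).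
  by apply: measurableT_comp; exact: measurable_fst.
have m2 : measurable_fun setT (fun z : ((@plane R * @plane R) * measurableTypeR R)%type => z.1.2).
  by apply: measurableT_comp; [exact: measurable_snd|exact: measurable_fst].
apply: measurable_kint; last exact: measurable_snd.
- by apply: measurableT_comp m1; exact: measurable_fst.
- by apply: measurableT_comp m1; exact: measurable_snd.
- by apply: measurableT_comp m2; exact: measurable_fst.
- by apply: measurableT_comp m2; exact: measurable_snd.
Qed.

Section fixed_pair.
Variables (x y : R * R) (r : R).
Hypotheses (r0 : 0 < r) (rs : forall a, r ^+ 2 <= sqdist x y a).

Lemma sqdist_gt0 a : 0 < sqdist x y a.
Proof. by apply: lt_le_trans (rs a); rewrite exprn_gt0. Qed.

Lemma measurable_rsig1 n :
  measurable_fun setT (fun a : measurableTypeR R => rsig x y a ^+ n).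
Proof.
rewrite (surj2 x) (surj2 y).
by apply: (measurable_rsig (x1 := fun=> x.1) (x2 := fun=> x.2) (y1 := fun=> y.1)
  (y2 := fun=> y.2)).
Qed.

(** The squared helical distance is at least a^2 and at least r^2, hence at least their mean. This
    is the Cauchy profile, whose integral is pi / r. *)
Lemma rsig2_le a : rsig x y a ^+ 2 <= 2 * (a ^+ 2 + r ^+ 2)^-1.
Proof.
have h1 := rs a; have h2 := sqdist_ge_height x y a; have h3 := sqdist_gt0 a.
have h4 : 0 < a ^+ 2 + r ^+ 2 by rewrite ltr_wpDl ?sqr_ge0 ?exprn_gt0.
rewrite rsig_sqr -(ler_pM2r h3) mulVf ?gt_eqF//.
by rewrite mulrAC ler_pdivlMr// mul1r; lra.
Qed.

Lemma rsig_le a : rsig x y a <= r^-1.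
Proof.
have := rs a; have := sqdist_gt0 a => h3 h.
rewrite /rsig lef_pV2 ?posrE ?sqrtr_gt0// -[leLHS]gtr0_norm// -sqrtr_sqr.
exact: ler_wsqrtr.
Qed.

Lemma rsig2_int : leb1.-integrable setT (EFin \o (fun a => rsig x y a ^+ 2)) /\
  \int[leb1]_a (rsig x y a ^+ 2) <= 2 * pi / r.
Proof.
have [i1 b1] := cauchy_integral r0.
have i2 : leb1.-integrable setT (EFin \o (fun a : R => 2 * (a ^+ 2 + r ^+ 2)^-1)).
  exact: integrZ.
have i3 : leb1.-integrable setT (EFin \o (fun a => rsig x y a ^+ 2)).
  apply: integr_le i2 _; first exact: measurable_rsig1.
  by move=> a; rewrite ger0_norm ?sqr_ge0// rsig2_le.
split=> //; apply: (@le_trans _ _ (\int[leb1]_a (2 * (a ^+ 2 + r ^+ 2)^-1))).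
  by apply: le_Rint => // a; exact: rsig2_le.
by rewrite RintZ// -mulrA ler_wpM2l.
Qed.

Lemma rsig3_int : leb1.-integrable setT (EFin \o (fun a => rsig x y a ^+ 3)) /\
  \int[leb1]_a (rsig x y a ^+ 3) <= 2 * pi / r ^+ 2.
Proof.
have [i1 b1] := rsig2_int.
have le3 a : rsig x y a ^+ 3 <= r^-1 * rsig x y a ^+ 2.
  by rewrite exprS ler_wpM2r ?sqr_ge0// rsig_le.
have i2 : leb1.-integrable setT (EFin \o (fun a : R => r^-1 * rsig x y a ^+ 2)).
  exact: integrZ.
have i3 : leb1.-integrable setT (EFin \o (fun a => rsig x y a ^+ 3)).
  apply: integr_le i2 _; first exact: measurable_rsig1.
  by move=> a; rewrite ger0_norm ?exprn_ge0 ?rsig_ge0.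
split=> //; apply: (@le_trans _ _ (\int[leb1]_a (r^-1 * rsig x y a ^+ 2))).
  by apply: le_Rint.
rewrite RintZ// (_ : _ / _ ^+ 2 = r^-1 * (2 * pi / r)).
  by rewrite ler_wpM2l// invr_ge0 ltW.
by field; rewrite gt_eqF.
Qed.

Lemma kint_integrable k :
  leb1.-integrable setT (EFin \o (fun a => rsig x y a ^+ 3 * knum k x y a)).
Proof.
have [i1 b1] := rsig2_int.
apply: (@integr_le _ _ _ leb1 _ (fun a => 2 * japanese y * rsig x y a ^+ 2)).
- exact: measurable_kint1.
- exact: integrZ.
- by move=> a; rewrite rsig_sqr; exact: kint_le.
Qed.

Lemma KE k : K x y ord0 k =
  - (4 * pi)^-1 * \int[leb1]_a (rsig x y a ^+ 3 * knum k x y a).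
Proof. by rewrite Kentry; congr (_ * _); apply: eq_Rint => a; rewrite /rsig exprVn. Qed.

Lemma K_le_rho k : `|K x y ord0 k| <= japanese y / r.
Proof.
have [i1 b1] := rsig2_int.
have p0 : 0 < pi :> R := pi_gt0 R.
have c0 : 0 < (4 * pi)^-1 :> R by rewrite invr_gt0 mulr_gt0.
rewrite KE normrM normrN (gtr0_norm c0).
rewrite ler_pdivrMl ?mulr_gt0//.
apply: (@le_trans _ _ (\int[leb1]_a (2 * japanese y * rsig x y a ^+ 2))).
  apply: norm_Rint_le; first exact: measurable_kint1.
    exact: integrZ.
  by move=> a; rewrite rsig_sqr; exact: kint_le.
rewrite RintZ// (_ : 4 * pi * _ = 2 * japanese y * (2 * pi / r)); last by ring.
by rewrite ler_wpM2l// mulr_ge0// japanese_ge0.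
Qed.

End fixed_pair.

(** From [sqr_norm_le_sqdist_r], with 2 in place of the square root of 2. *)
Lemma sqdist_rho_r x y : x != y ->
  0 < `|x - y| / (2 * japanese y) /\
  forall a, (`|x - y| / (2 * japanese y)) ^+ 2 <= sqdist x y a.
Proof.
move=> xy; have j0 : 0 < japanese y by apply: lt_le_trans (japanese_ge1 y).
split; first by rewrite divr_gt0 ?mulr_gt0// normr_gt0 subr_eq0.
move=> a; rewrite expr_div_n exprMn japanese_sqr ler_pdivrMr; last first.
  by rewrite mulr_gt0 ?sqweight_gt0.
apply: le_trans (sqr_norm_le_sqdist_r x y a) _; rewrite mulrC.
rewrite ler_wpM2l ?sqdist_ge0// ler_wpM2r ?ltW ?sqweight_gt0//.
by rewrite expr2; lra.
Qed.

Lemma sqdist_rho_l x y : x != y ->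
  0 < `|x - y| / (2 * japanese x) /\
  forall a, (`|x - y| / (2 * japanese x)) ^+ 2 <= sqdist x y a.
Proof.
rewrite eq_sym => /sqdist_rho_r[h1 h2]; rewrite distrC; split=> // a.
by rewrite sqdist_sym.
Qed.

(** One factor <y> comes from the numerator, the other from the lower bound on the helical distance;
    together they are exactly the weight of order 2. *)
Lemma K_le k x y : x != y -> `|K x y ord0 k| <= 2 * (sqweight y / `|y - x|).
Proof.
move=> xy; have [r0 rs] := sqdist_rho_r xy.
apply: le_trans (K_le_rho r0 rs k) _; rewrite -japanese_sqr (distrC y).
have j0 : 0 < japanese y by apply: lt_le_trans (japanese_ge1 y).
have n0 : 0 < `|x - y| by rewrite normr_gt0 subr_eq0.
rewrite le_eqVlt; apply/orP; left; apply/eqP.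
by field; rewrite !gt_eqF.
Qed.

(** The lower bound [sqdist_rho_l] is chosen so that the two inverse powers of the distance cost
    <x>^2. With [sqdist_rho_r] the total power of <y> would be 3, which the weight of order 2 does
    not control. *)
Lemma K_lip k x x' y : x != y -> x' != y ->
  `|K x y ord0 k - K x' y ord0 k| <= 20 * `|x - x'| *
    (sqweight x * (sqweight y / `|y - x| ^+ 2) +
     sqweight x' * (sqweight y / `|y - x'| ^+ 2)).
Proof.
move=> xy xy'; have [r0 rs] := sqdist_rho_l xy; have [r0' rs'] := sqdist_rho_l xy'.
have [i1 b1] := rsig3_int r0 rs; have [i2 b2] := rsig3_int r0' rs'.
have p0 : 0 < pi :> R := pi_gt0 R.
have c0 : 0 < (4 * pi)^-1 :> R by rewrite invr_gt0 mulr_gt0.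
have j0 (z : R * R) : 0 < japanese z by apply: lt_le_trans (japanese_ge1 z).
have n0 : 0 < `|x - y| by rewrite normr_gt0 subr_eq0.
have n0' : 0 < `|x' - y| by rewrite normr_gt0 subr_eq0.
have k1 := kint_integrable r0 rs k; have k2 := kint_integrable r0' rs' k.
rewrite !KE -mulrBr -RintB// normrM normrN (gtr0_norm c0).
rewrite ler_pdivrMl ?mulr_gt0//.
apply: (@le_trans _ _ (\int[leb1]_a (10 * japanese y * `|x - x'| *
    (rsig x y a ^+ 3 + rsig x' y a ^+ 3)))).
  apply: norm_Rint_le.
  - by apply: measurable_funB; exact: measurable_kint1.
  - by apply: integrZ; exact: integrD.
  - move=> a; apply: kint_lip; [exact: sqdist_gt0 r0 rs a|exact: sqdist_gt0 r0' rs' a].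
rewrite RintZ; last exact: integrD.
rewrite RintD//.
apply: (@le_trans _ _ (10 * japanese y * `|x - x'| *
   (2 * pi / (`|x - y| / (2 * japanese x)) ^+ 2 +
    2 * pi / (`|x' - y| / (2 * japanese x')) ^+ 2))).
  by rewrite ler_wpM2l ?lerD// !mulr_ge0// ltW.
rewrite -!(japanese_sqr x) -!(japanese_sqr x') (distrC y) (distrC y x').
(* The single remaining <y> is enlarged to <y>^2, in order to reuse the singular integrals of the
   weighted vorticity. *)
apply: (@le_trans _ _ (10 * sqweight y * `|x - x'| *
   (2 * pi / (`|x - y| / (2 * japanese x)) ^+ 2 +
    2 * pi / (`|x' - y| / (2 * japanese x')) ^+ 2))).
  apply: ler_wpM2r; last first.
    by apply: ler_wpM2r => //; apply: ler_wpM2l => //; exact: japanese_le.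
  by rewrite addr_ge0// mulr_ge0 ?invr_ge0 ?sqr_ge0// mulr_ge0// ltW.
have jx : japanese x != 0 by rewrite gt_eqF.
have jx' : japanese x' != 0 by rewrite gt_eqF.
have nx : `|x - y| != 0 by rewrite gt_eqF.
have nx' : `|x' - y| != 0 by rewrite gt_eqF.
rewrite le_eqVlt; apply/orP; left; apply/eqP.
move: `|x - y| `|x' - y| (japanese x) (japanese x') nx nx' jx jx' => A B C D A0 B0 C0 D0.
by field; rewrite ?A0 ?B0 ?C0 ?D0.
Qed.

Lemma K_antisym x y : x != y ->
  x.1 * K x y ord0 (inord 0) + x.2 * K x y ord0 (inord 1) =
  - (y.1 * K y x ord0 (inord 0) + y.2 * K y x ord0 (inord 1)).
Proof.
move=> xy; have [r0 rs] := sqdist_rho_l xy.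
have yx : y != x by rewrite eq_sym.
have [r0' rs'] := sqdist_rho_l yx.
have k1 k := kint_integrable r0 rs k; have k2 k := kint_integrable r0' rs' k.
rewrite !KE; set c := - (4 * pi)^-1.
have C (z : R * R) (u v : R) : z.1 * (c * u) + z.2 * (c * v) = c * (z.1 * u + z.2 * v).
  by ring.
rewrite !C -mulrN; congr (_ * _).
rewrite -!RintZ// -!RintD; try exact: integrZ.
pose G a := y.1 * (rsig y x a ^+ 3 * knum (inord 0 : 'I_3) y x a) +
  y.2 * (rsig y x a ^+ 3 * knum (inord 1 : 'I_3) y x a).
have iG : leb1.-integrable setT (EFin \o G) by apply: integrD; exact: integrZ.
have iGN : leb1.-integrable setT (EFin \o (fun a => -1 * G a)) by exact: integrZ.
(* Reflecting the second integral pairs height a on one filament with height -a on the other, as in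
   [knum_antisym]. *)
rewrite -mulN1r -RintZ// -(Rint_opp iGN); apply: eq_Rint => a.
rewrite mulN1r; apply/eqP; rewrite -addr_eq0; apply/eqP.
rewrite /G /rsig (sqdist_sym x y a) !inordK//.
transitivity ((Num.sqrt (sqdist y x (- a)))^-1 ^+ 3 *
  (x.1 * knum 0 x y a + x.2 * knum 1 x y a +
  (y.1 * knum 0 y x (- a) + y.2 * knum 1 y x (- a)))); first by ring.
by rewrite knum_antisym mulr0.
Qed.

End kernel_estimates.

(** * The velocity: linear growth and log-Lipschitz continuity *)

Section velocity.
Context {R : realType}.
Implicit Types (x y : R * R) (k : 'I_3).

Lemma measurable_sqweight : measurable_fun setT (sqweight : @plane R -> R).
Proof.
by apply: measurable_funD; [apply: measurable_funD => //|]; apply: measurable_funX;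
  [exact: measurable_fst|exact: measurable_snd].
Qed.

Lemma norm_le_sqweight x : 1 + `|x| <= 2 * sqweight x.
Proof.
have h (t : R) : `|t| <= (1 + t ^+ 2).
  by rewrite -real_normK ?num_real//; have := sqr_ge0 (1 - `|t|);
  have := normr_ge0 t; nra.
have := h x.1; have := h x.2; have := sqr_ge0 x.1; have := sqr_ge0 x.2.
rewrite /sqweight plane_normE; by case: (leP `|x.1| `|x.2|) => _ *; lra.
Qed.

Section bounds.
Variables (g : R * R -> R) (V : R).
Let v y := sqweight y * `|g y|.
Hypothesis mg : measurable_fun setT (g : plane -> R).
Hypothesis iv : leb2.-integrable setT (EFin \o v).
Hypothesis vV1 : \int[leb2]_y v y <= V.
Hypothesis vVoo : {ae leb2, forall y, v y <= V}.

Let v0 y : 0 <= v y.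
Proof. by rewrite mulr_ge0// ltW// sqweight_gt0. Qed.

Let mv : measurable_fun setT (v : plane -> R).
Proof.
by apply: measurable_funM; [exact: measurable_sqweight|exact: measurableT_comp].
Qed.

Let V0 : 0 <= V.
Proof. by apply: le_trans vV1; exact: Rint_ge0. Qed.

Lemma Kg_le k x y : y <> x -> `|K x y ord0 k * g y| <= 2 * (v y / `|y - x|).
Proof.
move=> /eqP yx; rewrite normrM.
have := K_le k (_ : x != y); rewrite eq_sym => /(_ yx) h.
rewrite (_ : 2 * _ = 2 * (sqweight y / `|y - x|) * `|g y|); last first.
  by rewrite /v -!mulrA; congr (_ * (_ * _)); rewrite mulrC.
by rewrite ler_wpM2r.
Qed.

Lemma measurable_Kg k x : measurable_fun setT (fun y : plane => K x y ord0 k * g y).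
Proof.
apply: measurable_funM => //.
exact: (measurable_fun_pair2 (x : plane) (measurable_K k)).
Qed.

Lemma Kg_integrable k x :
  leb2.-integrable setT (EFin \o (fun y => K x y ord0 k * g y)).
Proof.
have [i1 b1] := riesz_int mv v0 iv vV1 vVoo x.
apply: (@integr_le_ae _ _ _ leb2 _ (fun y => 2 * (v y / `|y - x|))).
- exact: measurable_Kg.
- exact: integrZ.
- by apply: filterS (ae_neq x) => y yx; exact: Kg_le.
Qed.

Lemma UE k x : U g x ord0 k = \int[leb2]_y (K x y ord0 k * g y).
Proof. by rewrite /U mxE. Qed.

Lemma U_le k x : `|U g x ord0 k| <= 34 * V.
Proof.
have [i1 b1] := riesz_int mv v0 iv vV1 vVoo x.
rewrite UE; apply: (@le_trans _ _ (\int[leb2]_y (2 * (v y / `|y - x|)))).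
  apply: norm_Rint_le_ae; first exact: measurable_Kg.
    exact: integrZ.
  by apply: filterS (ae_neq x) => y yx; exact: Kg_le.
by rewrite RintZ//; move: b1; lra.
Qed.

(** Within distance 2 e the two kernels are bounded separately and cost O(e); beyond it the
    Lipschitz bound of the kernel meets n + 1 logarithmic layers. *)
Lemma U_lip k (Q : R) (n : nat) x x' : sqweight x <= Q -> sqweight x' <= Q ->
  `|x - x'| <= (2 ^+ n)^-1 ->
  `|U g x ord0 k - U g x' ord0 k| <= 1800 * Q * V * n.+1%:R * (2 ^+ n)^-1.
Proof.
set e := (2 ^+ n)^-1 => qx qx' xx'.
have e0 : 0 < e by rewrite invr_gt0 exprn_gt0.
have Q1 : 1 <= Q := le_trans (sqweight_ge1 x) qx.
have e2 : 0 < 2 * e by rewrite mulr_gt0.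
have e4 : 0 < 4 * e by rewrite mulr_gt0.
have [i1 b1] := near1_int mv v0 iv vV1 vVoo x e2.
have [i2 b2] := near1_int mv v0 iv vV1 vVoo x' e4.
have [i3 b3] := far2_int mv v0 iv vV1 vVoo x n; rewrite -/e in i3 b3.
have -> : U g x ord0 k - U g x' ord0 k =
    \int[leb2]_y (K x y ord0 k * g y - K x' y ord0 k * g y).
  by rewrite (RintB (Kg_integrable k x) (Kg_integrable k x')); congr (_ - _); exact: UE.
(* The box of radius 4 e around x' contains the box of radius 2 e around x. In the far part 20 (Q +
   4 Q) e = 100 Q e, the 4 coming from |y - x'| >= |y - x| / 2. In total 64 + 128 + 1600 <= 1800. *)
pose h y := 2 * near1 v x (2 * e) y + 2 * near1 v x' (4 * e) y +
  100 * Q * e * far v 2 x e y.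
have i12 : leb2.-integrable setT
    (EFin \o (fun y => 2 * near1 v x (2 * e) y + 2 * near1 v x' (4 * e) y)).
  by apply: integrD; exact: integrZ.
have i3' : leb2.-integrable setT (EFin \o (fun y => 100 * Q * e * far v 2 x e y)).
  exact: integrZ.
have ih : leb2.-integrable setT (EFin \o h) by exact: integrD.
have n1 z r y : 0 <= near1 v z r y.
  by rewrite /near1 mulr_ge0// divr_ge0.
have f1 z r y : 0 <= far v 2 z r y.
  by rewrite /far mulr_ge0// divr_ge0// exprn_ge0.
have c0 : 0 <= 100 * Q * e by rewrite !mulr_ge0// ?ltW//; lra.
apply: (@le_trans _ _ (\int[leb2]_y h y)).
  apply: norm_Rint_le_ae => //.
    by apply: measurable_funB; exact: measurable_Kg.
  apply: filterS2 (ae_neq x) (ae_neq x') => y yx yx'.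
  have [yn|yf] := leP `|y - x| (2 * e).
    apply: le_trans (ler_normB _ _) _; apply: le_trans (lerD (Kg_le k yx) (Kg_le k yx')) _.
    rewrite /h; apply: ler_wpDr; first exact: mulr_ge0 c0 (f1 _ _ _).
    rewrite /near1 !indicE !mem_set ?mul1r//.
    rewrite /box/= -(subrKA x) (le_trans (ler_normD _ _))//.
    by move: xx'; lra.
  rewrite -mulrBl normrM.
  have kl := K_lip k (_ : x != y) (_ : x' != y).
  apply: le_trans (ler_wpM2r _ (kl _ _)) _ => //; try by rewrite eq_sym; apply/eqP.
  rewrite /h; apply: ler_wpDl; first by apply: addr_ge0; apply: mulr_ge0.
  have d0 : 0 < `|y - x| by apply: lt_trans yf; rewrite mulr_gt0.
  rewrite farE; last by lra.
  have d' : `|y - x| / 2 <= `|y - x'|.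
    have := ler_normD (y - x') (x' - x); rewrite subrKA (distrC x') => tri.
    by lra.
  have d'2 : (`|y - x'| ^+ 2)^-1 <= 4 / `|y - x| ^+ 2.
    have -> : 4 / `|y - x| ^+ 2 = ((`|y - x| / 2) ^+ 2)^-1.
      by field; rewrite gt_eqF.
    have d20 : 0 < `|y - x| / 2 by rewrite divr_gt0.
    rewrite lef_pV2 ?posrE ?exprn_gt0//; last exact: lt_le_trans d'.
    by rewrite lerXn2r ?nnegrE// ltW.
  have s0 := sqweight_gt0 y; have s1 := sqweight_gt0 x; have s2 := sqweight_gt0 x'.
  have w0 : 0 <= (`|y - x| ^+ 2)^-1 by rewrite invr_ge0 sqr_ge0.
  have d0' : 0 < `|y - x'| by apply: lt_le_trans d'; rewrite divr_gt0.
  have w0' : 0 <= (`|y - x'| ^+ 2)^-1 by rewrite invr_ge0 sqr_ge0.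
  apply: (@le_trans _ _ (20 * e * (Q * (sqweight y / `|y - x| ^+ 2) +
      Q * (sqweight y * (4 / `|y - x| ^+ 2))) * `|g y|)).
    apply: ler_wpM2r => //; apply: ler_pM.
    - by rewrite mulr_ge0.
    - by apply: addr_ge0; apply: mulr_ge0; [exact: ltW| |exact: ltW|]; rewrite mulr_ge0// ltW.
    - exact: ler_wpM2l.
    - apply: lerD; first by apply: ler_wpM2r => //; rewrite mulr_ge0// ltW.
      apply: ler_pM => //; first exact: ltW.
        by rewrite mulr_ge0// ltW.
      by rewrite ler_pM2l.
  rewrite /v le_eqVlt; apply/orP; left; apply/eqP; ring.
rewrite /h RintD// RintD//; try exact: integrZ.
rewrite !RintZ//.
have b3' := ler_wpM2l c0 b3.
have Ve : 0 <= V * e by rewrite mulr_ge0// ltW.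
have n0 : 1 <= n.+1%:R :> R by rewrite ler1n.
have Vn : V * e <= V * e * n.+1%:R by rewrite ler_peMr.
have Vq : V * e * n.+1%:R <= Q * (V * e * n.+1%:R) by rewrite ler_peMl// mulr_ge0.
have -> : 1800 * Q * V * n.+1%:R * e = 1800 * (Q * (V * e * n.+1%:R)) by ring.
have b3'' : 100 * Q * e * \int[leb2]_x0 far v 2 x e x0 <= 1600 * (Q * (V * e * n.+1%:R)).
  by apply: le_trans b3' _; rewrite le_eqVlt; apply/orP; left; apply/eqP; ring.
move: b1 b2 b3''; lra.
Qed.

Lemma H1E x : (H g x).1 = U g x ord0 (inord 0) - x.2 * U g x ord0 (inord 2).
Proof. by []. Qed.

Lemma H2E x : (H g x).2 = U g x ord0 (inord 1) + x.1 * U g x ord0 (inord 2).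
Proof. by []. Qed.

Lemma H_le x : `|(H g x).1| <= 34 * V * (1 + `|x|) /\ `|(H g x).2| <= 34 * V * (1 + `|x|).
Proof.
have n1 := plane_norm1 x; have n2 := plane_norm2 x.
rewrite H1E H2E mulrDr mulr1 [34 * V * `|x|]mulrC; split.
  apply: le_trans (ler_normB _ _) _; rewrite normrM; apply: lerD; first exact: U_le.
  by apply: ler_pM => //; exact: U_le.
apply: le_trans (ler_normD _ _) _; rewrite normrM; apply: lerD; first exact: U_le.
by apply: ler_pM => //; exact: U_le.
Qed.

(** On the box of radius r the weight is at most 1 + 2 r^2. The factor 1 + r collects one component
    of U and the coordinate that multiplies U^3; the last 34 bounds U^3 where that coordinate itself
    varies. *)
Definition loglip_const (r : R) : R := (1 + r) * 1800 * (1 + 2 * r ^+ 2) + 34.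

Lemma H_lip (r : R) n x x' : `|x| <= r -> `|x'| <= r -> `|x - x'| <= (2 ^+ n)^-1 ->
  `|(H g x).1 - (H g x').1| <= loglip_const r * V * n.+1%:R * (2 ^+ n)^-1 /\
  `|(H g x).2 - (H g x').2| <= loglip_const r * V * n.+1%:R * (2 ^+ n)^-1.
Proof.
move=> xr xr' xx'; set e := (2 ^+ n)^-1 in xx' *.
have e0 : 0 < e by rewrite invr_gt0 exprn_gt0.
have r0 : 0 <= r := le_trans (normr_ge0 _) xr.
have q z : `|z| <= r -> sqweight z <= 1 + 2 * r ^+ 2.
  rewrite plane_norm_le => /andP[h1 h2].
  have s (t : R) : `|t| <= r -> t ^+ 2 <= r ^+ 2.
    by move=> h; rewrite -[t ^+ 2]real_normK ?num_real// lerXn2r// nnegrE.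
  by rewrite /sqweight; have := s _ h1; have := s _ h2; lra.
have L k := U_lip k (q _ xr) (q _ xr') xx'; rewrite -/e in L.
set A := 1800 * _ * V * _ * e in L.
have nn : 1 <= n.+1%:R :> R by rewrite ler1n.
have Ve : 0 <= V * e by rewrite mulr_ge0// ltW.
have Vn : V * e <= V * e * n.+1%:R by rewrite ler_peMr.
have -> : loglip_const r * V * n.+1%:R * e = A + r * A + 34 * (V * e * n.+1%:R).
  by rewrite /loglip_const /A; ring.
have key (c c' u u' t t' : R) : `|u - u'| <= A -> `|t - t'| <= A -> `|c| <= r ->
    `|c - c'| <= e -> `|t'| <= 34 * V ->
    `|u - u'| + `|c * (t - t') + (c - c') * t'| <= A + r * A + 34 * (V * e * n.+1%:R).
  move=> h1 h2 h3 h4 h5; rewrite -addrA; apply: lerD => //.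
  apply: le_trans (ler_normD _ _) _; rewrite !normrM; apply: lerD; first exact: ler_pM.
  apply: (@le_trans _ _ (e * (34 * V))); first exact: ler_pM.
  by rewrite mulrCA ler_wpM2l// mulrC.
have combB (c c' u u' t t' : R) :
    `|u - c * t - (u' - c' * t')| <= `|u - u'| + `|c * (t - t') + (c - c') * t'|.
  apply: le_trans _ (ler_normB _ _); rewrite le_eqVlt; apply/orP; left; apply/eqP.
  by congr `|_|; ring.
have combD (c c' u u' t t' : R) :
    `|u + c * t - (u' + c' * t')| <= `|u - u'| + `|c * (t - t') + (c - c') * t'|.
  apply: le_trans _ (ler_normD _ _); rewrite le_eqVlt; apply/orP; left; apply/eqP.
  by congr `|_|; ring.
have p1 := le_trans (plane_norm1 (x - x')) xx'; have p2 := le_trans (plane_norm2 (x - x')) xx'.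
have q1 := le_trans (plane_norm1 x) xr; have q2 := le_trans (plane_norm2 x) xr.
split.
  have -> := f_equal2 (fun c d : R => c - d) (H1E x) (H1E x').
  apply: le_trans (combB _ _ _ _ _ _) _.
  exact: (key x.2 x'.2 _ _ _ _ (L (inord 0)) (L (inord 2)) q2 p2 (U_le _ _)).
have -> := f_equal2 (fun c d : R => c - d) (H2E x) (H2E x').
apply: le_trans (combD _ _ _ _ _ _) _.
exact: (key x.1 x'.1 _ _ _ _ (L (inord 1)) (L (inord 2)) q1 p1 (U_le _ _)).
Qed.

(** The rotational part (-x2, x1) U^3 of the velocity is orthogonal to x. *)
Lemma H_dot x : x.1 * (H g x).1 + x.2 * (H g x).2 =
  \int[leb2]_y ((x.1 * K x y ord0 (inord 0) + x.2 * K x y ord0 (inord 1)) * g y).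
Proof.
rewrite H1E H2E.
transitivity (x.1 * U g x ord0 (inord 0) + x.2 * U g x ord0 (inord 1)); first by ring.
have i1 := Kg_integrable (inord 0) x; have i2 := Kg_integrable (inord 1) x.
have -> : U g x ord0 (inord 0) = \int[leb2]_y (K x y ord0 (inord 0) * g y) by exact: UE.
have -> : U g x ord0 (inord 1) = \int[leb2]_y (K x y ord0 (inord 1) * g y) by exact: UE.
rewrite -(RintZ x.1 i1) -(RintZ x.2 i2) -(RintD (integrZ x.1 i1) (integrZ x.2 i2)).
by apply: eq_Rint => y; rewrite mulrDl !mulrA.
Qed.

End bounds.
End velocity.

Section velocity_measurability.
Context {R : realType} d (T : measurableType d).
Implicit Types (w : T -> R * R -> R) (k : 'I_3).

(** The space [T] stands for time: drifts are integrated in time, so the velocity must be jointly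
    measurable. *)
Lemma measurable_U w k :
  measurable_fun setT (fun z : (T * @plane R)%type => w z.1 z.2) ->
  measurable_fun setT (fun z : (T * @plane R)%type => U (w z.1) z.2 ord0 k).
Proof.
move=> mw.
rewrite (_ : (fun z => _) =
  (fun z : (T * @plane R)%type => \int[leb2]_y (K z.2 y ord0 k * w z.1 y))); last first.
  by apply/funext => z; exact: UE.
apply: (@measurable_Rint2 R _ _ (fun (z : (T * @plane R)%type) y => K z.2 y ord0 k * w z.1 y)).
have m1 : measurable_fun setT (fun z : ((T * @plane R) * @plane R)%type => (z.1.2, z.2)).
  apply: measurable_fun_pair; last exact: measurable_snd.
  by apply: measurableT_comp; [exact: measurable_snd|exact: measurable_fst].
have m2 : measurable_fun setT (fun z : ((T * @plane R) * @plane R)%type => (z.1.1, z.2)).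
  apply: measurable_fun_pair; last exact: measurable_snd.
  by apply: measurableT_comp; [exact: measurable_fst|exact: measurable_fst].
apply: measurable_funM.
  exact: (measurableT_comp (measurable_K k) m1).
exact: (measurableT_comp mw m2).
Qed.

Lemma measurable_H w :
  measurable_fun setT (fun z : (T * @plane R)%type => w z.1 z.2) ->
  measurable_fun setT (fun z : (T * @plane R)%type => (H (w z.1) z.2).1) /\
  measurable_fun setT (fun z : (T * @plane R)%type => (H (w z.1) z.2).2).
Proof.
move=> mw; have mU k := measurable_U k mw.
have m1 : measurable_fun setT (fun z : (T * @plane R)%type => z.2.1).
  by apply: measurableT_comp; [exact: measurable_fst|exact: measurable_snd].
have m2 : measurable_fun setT (fun z : (T * @plane R)%type => z.2.2).
  by apply: measurableT_comp; [exact: measurable_snd|exact: measurable_snd].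
split.
- by apply: measurable_funB; [exact: mU|apply: measurable_funM; [exact: m2|exact: mU]].
- by apply: measurable_funD; [exact: mU|apply: measurable_funM; [exact: m1|exact: mU]].
Qed.

End velocity_measurability.

(** * Cancellation of the radial flux *)

Section angular_cancellation.
Context {R : realType}.
Implicit Types (x y : R * R).
Variables (g : R * R -> R) (V : R).
Let v y := sqweight y * `|g y|.
Hypothesis mg : measurable_fun setT (g : plane -> R).
Hypothesis iv : leb2.-integrable setT (EFin \o v).
Hypothesis vV1 : \int[leb2]_y v y <= V.
Hypothesis vVoo : {ae leb2, forall y, v y <= V}.

Let v0 y : 0 <= v y.
Proof. by rewrite mulr_ge0// ltW// sqweight_gt0. Qed.

Let mv : measurable_fun setT (v : plane -> R).
Proof.
by apply: measurable_funM; [exact: measurable_sqweight|exact: measurableT_comp].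
Qed.

Let A x y : R := x.1 * K x y ord0 (inord 0) + x.2 * K x y ord0 (inord 1).

Let mA : measurable_fun setT (fun z : (@plane R * @plane R)%type => A z.1 z.2).
Proof.
have m1 : measurable_fun setT (fun z : (@plane R * @plane R)%type => z.1.1).
  by apply: measurableT_comp; [exact: measurable_fst|exact: measurable_fst].
have m2 : measurable_fun setT (fun z : (@plane R * @plane R)%type => z.1.2).
  by apply: measurableT_comp; [exact: measurable_snd|exact: measurable_fst].
apply: measurable_funD; apply: measurable_funM.
- exact: m1.
- exact: measurable_K.
- exact: m2.
- exact: measurable_K.
Qed.

Let f (z : R * R * (R * R)) : R := g z.1 * (A z.1 z.2 * g z.2).

Let mf : measurable_fun setT (f : (@plane R * @plane R)%type -> R).
Proof.
apply: measurable_funM.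
  by apply: measurableT_comp; [exact: mg|exact: measurable_fst].
apply: measurable_funM; first exact: mA.
by apply: measurableT_comp; [exact: mg|exact: measurable_snd].
Qed.

Let A_le x y : y <> x -> `|A x y * g y| <= 4 * (1 + `|x|) * (v y / `|y - x|).
Proof.
move=> yx; rewrite mulrDl; apply: le_trans (ler_normD _ _) _.
have b k (c : R) : `|c| <= 1 + `|x| ->
    `|c * K x y ord0 k * g y| <= (1 + `|x|) * (2 * (v y / `|y - x|)).
  by move=> cx; rewrite -mulrA normrM; apply: ler_pM => //; exact: Kg_le.
rewrite (_ : 4 * _ * _ = (1 + `|x|) * (2 * (v y / `|y - x|)) +
  (1 + `|x|) * (2 * (v y / `|y - x|))); last by ring.
by apply: lerD; apply: b; rewrite ler_wpDl ?plane_norm1 ?plane_norm2.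
Qed.

Let f_le x y : y <> x ->
  `|f (x, y)| <= 4 * (`|g x| * (1 + `|x|)) * (v y / `|y - x|).
Proof.
move=> yx; rewrite /f normrM.
apply: (@le_trans _ _ (`|g x| * (4 * (1 + `|x|) * (v y / `|y - x|)))).
  by apply: ler_wpM2l => //; exact: A_le.
by rewrite le_eqVlt; apply/orP; left; apply/eqP; ring.
Qed.

Let gx_le x : `|g x| * (1 + `|x|) <= 2 * v x.
Proof.
rewrite /v mulrC (mulrA 2); apply: ler_wpM2r => //.
exact: norm_le_sqweight.
Qed.

Let f_antisym x y : y <> x -> f (y, x) = - f (x, y).
Proof.
move=> /eqP yx; rewrite /f/=.
have -> : A y x = - A x y by rewrite /A K_antisym.
by ring.
Qed.

(** Fubini turns the antisymmetry of [f] off the diagonal, a null set in each section, into I = -I.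
    Product integrability is [hb], where 136 = 4 . 2 . 17: the factor 1 + |x| <= 2<x>^2 is absorbed
    by the weight on [g x], and 17 V is the Riesz bound. *)
Lemma angular_cancellation :
  \int[leb2]_x (g x * (x.1 * (H g x).1 + x.2 * (H g x).2)) = 0.
Proof.
have riesz x := riesz_int mv v0 iv vV1 vVoo x.
have mf1 x : measurable_fun setT (fun y : plane => f (x, y)).
  exact: (measurable_fun_pair2 (x : plane) mf).
have mf2 y : measurable_fun setT (fun x : plane => f (x, y)).
  exact: (measurable_fun_pair1 (y : plane) mf).
have i1 x : leb2.-integrable setT (EFin \o (fun y => f (x, y))).
  have [ir _] := riesz x.
  apply: (integr_le_ae (mf1 x) (integrZ (4 * (`|g x| * (1 + `|x|))) ir)).
  by apply: filterS (ae_neq x) => y yx; exact: f_le.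
have i2 y : leb2.-integrable setT (EFin \o (fun x => f (x, y))).
  apply: (@integr_le_ae _ _ _ leb2 _ (fun x => `|f (y, x)|)) => //.
    exact: integr_norm.
  by apply: filterS (ae_neq y) => x xy; rewrite f_antisym ?normrN//; exact: nesym.
have ib : leb2.-integrable setT (EFin \o (fun x => 136 * V * v x)) by exact: integrZ.
have V0 : 0 <= V by apply: le_trans vV1; exact: Rint_ge0.
have hb x : \int[leb2]_y `|f (x, y)| <= 136 * V * v x.
  have [ir br] := riesz x.
  apply: (@le_trans _ _ (\int[leb2]_y (4 * (`|g x| * (1 + `|x|)) * (v y / `|y - x|)))).
    apply: ae_le_Rint; [exact: integr_norm|exact: integrZ|].
    by apply: filterS (ae_neq x) => y yx; exact: f_le.
  rewrite RintZ//.
  apply: (@le_trans _ _ (4 * (2 * v x) * (17 * V))).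
    apply: ler_pM; last exact: br.
    - by apply: mulr_ge0 => //; apply: mulr_ge0 => //; exact: addr_ge0.
    - by apply: Rint_ge0 => y; rewrite divr_ge0.
    - by apply: ler_wpM2l => //; exact: gx_le.
  by rewrite le_eqVlt; apply/orP; left; apply/eqP; ring.
have sw := @Rint_swap _ _ _ _ R sleb2 sleb2 f _ mf i1 ib hb i2.
have e1 : \int[leb2]_x (g x * (x.1 * (H g x).1 + x.2 * (H g x).2)) =
    \int[leb2]_x \int[leb2]_y f (x, y).
  apply: eq_Rint => x; rewrite (H_dot mg iv vV1 vVoo) -RintZ//.
  have [ir _] := riesz x.
  apply: (integr_le_ae _ (integrZ (4 * (1 + `|x|)) ir)).
    apply: measurable_funM => //.
    exact: (measurable_fun_pair2 (x : plane) mA).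
  by apply: filterS (ae_neq x) => y yx; exact: A_le.
have e2 : \int[leb2]_x \int[leb2]_y f (x, y) = \int[leb2]_y \int[leb2]_x f (x, y).
  exact: sw.
have e3 : \int[leb2]_y \int[leb2]_x f (x, y) = - \int[leb2]_x \int[leb2]_y f (x, y).
  have ii : leb2.-integrable setT (EFin \o (fun x => \int[leb2]_y f (x, y))).
    apply: integr_le ib _.
      exact: (@measurable_Rint2 R _ (@plane R) (fun x y => f (x, y)) mf).
    by move=> x; apply: le_trans (norm_Rint_le_norm _) (hb x).
  rewrite -mulN1r -RintZ//; apply: eq_Rint => y.
  rewrite -RintZ//; apply: ae_eq_Rint => //.
    by apply: measurable_funM.
  apply: filterS (ae_neq y) => x xy.
  by rewrite mulN1r -f_antisym//; exact: nesym.
have h (c : R) : c = - c -> c = 0.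
  by move/eqP; rewrite -addr_eq0 -mulr2n mulrn_eq0 => /eqP.
exact: etrans e1 (h _ (etrans e2 e3)).
Qed.

End angular_cancellation.

(** * Smooth functions and mollifiers *)

Section smooth_functions.
Context {R : realType}.
Implicit Types (f g : R -> R).

(** A quadratic remainder is the certificate of differentiability used for constants, affine maps,
    the flat point of [flat] and the restriction of a test function to a line. *)
Lemma is_derive_quadratic f (x d C e : R) : 0 < e ->
  (forall h, `|h| < e -> `|f (x + h) - f x - d * h| <= C * h ^+ 2) ->
  is_derive x 1 f d.
Proof.
move=> e0 fC.
have C0 : 0 <= C.
  have h : `|e / 2| < e by rewrite gtr0_norm ?divr_gt0//; lra.
  have := le_trans (normr_ge0 _) (fC _ h).
  by rewrite pmulr_lge0// exprn_gt0// divr_gt0.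
have cv : (fun h => h^-1 *: ((f \o shift x) (h *: 1) - f x)) @ 0^' --> d.
  apply/cvgrPdist_le => eps eps0.
  have e1 : 0 < Num.min e (eps / (C + 1)).
    by rewrite lt_min e0 divr_gt0// ltr_wpDl.
  near=> h.
  have h0 : h != 0 by near: h; exact: nbhs_dnbhs_neq.
  have hs : `|h| < Num.min e (eps / (C + 1)).
    by near: h; apply: dnbhs0_lt.
  move: hs; rewrite lt_min => /andP[he heps].
  rewrite /= distrC.
  have -> : h^-1 *: (f (h *: 1 + x) - f x) - d = h^-1 * (f (x + h) - f x - d * h).
    by rewrite /GRing.scale/= mulr1 (addrC h); field.
  rewrite normrM normfV ler_pdivrMl ?normr_gt0//.
  apply: le_trans (fC _ he) _; rewrite -real_normK ?num_real// expr2 mulrCA.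
  rewrite ler_wpM2l//.
  have := ltW heps; rewrite ler_pdivlMr ?ltr_wpDl//; apply: le_trans.
  by rewrite mulrC ler_wpM2l// lerDl.
apply: DeriveDef; first by apply/cvg_ex; exists d.
exact: (cvg_lim _ cv).
Unshelve. all: by end_near. Qed.

(** Derivatives are given by witnesses instead of iterated derivation operators, so that closure
    properties are inductions on the order; [smooth_derive] returns to the operator. *)
Fixpoint Cder (k : nat) f : Prop :=
  if k is k.+1 then exists2 f', (forall x : R, is_derive x 1 f (f' x)) & Cder k f'
  else True.

Definition smooth f := forall k, Cder k f.

Lemma CderW k f : Cder k.+1 f -> Cder k f.
Proof.
elim: k f => [//|k ih] f [f' df Cf']; exists f' => //; exact: ih.
Qed.

Lemma is_deriveDf (f g : R -> R) (x a b : R) : is_derive x 1 f a -> is_derive x 1 g b ->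
  is_derive x 1 (fun t => f t + g t) (a + b).
Proof. by move=> df dg; exact: is_deriveD. Qed.

Lemma is_deriveMf (f g : R -> R) (x a b : R) : is_derive x 1 f a -> is_derive x 1 g b ->
  is_derive x 1 (fun t => f t * g t) (a * g x + f x * b).
Proof.
move=> df dg; apply: (is_derive_eq (is_deriveM df dg)).
by rewrite /GRing.scale/= addrC [g x * a]mulrC.
Qed.

Lemma is_derive_affine (c d x : R) : is_derive x 1 (fun t => c * t + d) c.
Proof.
apply: (@is_derive_quadratic _ _ _ 0 1) => // h _.
by rewrite mul0r normr_le0; apply/eqP; ring.
Qed.

Lemma is_derive_compf (f g : R -> R) (x a b : R) : is_derive (g x) 1 f a ->
  is_derive x 1 g b -> is_derive x 1 (fun t => f (g t)) (a * b).
Proof. exact: is_derive1_comp. Qed.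

Lemma Cder_cst k (c : R) : Cder k (fun=> c).
Proof.
elim: k c => // k ih c; exists (fun=> 0); last exact: ih.
move=> x; apply: (@is_derive_quadratic _ _ _ 0 1) => // h _.
by rewrite subrr mul0r subrr normr0 mul0r.
Qed.

Lemma CderD k f g : Cder k f -> Cder k g -> Cder k (fun t => f t + g t).
Proof.
elim: k f g => // k ih f g [f' df Cf] [g' dg Cg].
exists (fun t => f' t + g' t); last exact: ih.
by move=> x; exact: is_deriveDf.
Qed.

Lemma CderM k f g : Cder k f -> Cder k g -> Cder k (fun t => f t * g t).
Proof.
elim: k f g => // k ih f g Cf Cg; have [f' df Cf'] := Cf; have [g' dg Cg'] := Cg.
exists (fun t => f' t * g t + f t * g' t).
  by move=> x; exact: is_deriveMf.
by apply: CderD; apply: ih => //; exact: CderW.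
Qed.

Lemma Cder_id k : Cder k id.
Proof.
case: k => // k; exists (fun=> 1); last exact: Cder_cst.
move=> x; apply: (@is_derive_quadratic _ _ _ 0 1) => // h _.
by rewrite mul0r normr_le0; apply/eqP; ring.
Qed.

Lemma Cder_affine k (c d : R) f : Cder k f -> Cder k (fun t => f (c * t + d)).
Proof.
elim: k f => // k ih f [f' df Cf'].
exists (fun t => f' (c * t + d) * c).
  by move=> x; exact: (is_derive_compf (df _) (is_derive_affine c d x)).
by apply: CderM; [exact: ih|exact: Cder_cst].
Qed.

Lemma CderV k f : (forall x, f x != 0) -> Cder k f -> Cder k (fun t => (f t)^-1).
Proof.
move=> f0; elim: k => // k ih Cf; have [f' df Cf'] := Cf.
have CV := ih (CderW Cf).
exists (fun t => - 1 * (f' t * ((f t)^-1 * (f t)^-1))).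
  move=> x; apply: (is_derive_eq (is_deriveV (f0 x) (df x))).
  by rewrite /GRing.scale/=; field.
by apply: CderM; [exact: Cder_cst|apply: CderM => //; exact: CderM].
Qed.

(** The powers x^-m make the family of exp(-1/x) stable under derivation, so that smoothness of all
    members is a single induction on the order. *)
Definition flat (m : nat) (x : R) : R := if 0 < x then x ^- m * expR (- x^-1) else 0.

Lemma flat_ge0 m x : 0 <= flat m x.
Proof.
by rewrite /flat; case: ifPn => // x0; rewrite mulr_ge0 ?expR_ge0 ?invr_ge0 ?exprn_ge0// ltW.
Qed.

Lemma flat_gt0 m x : 0 < x -> 0 < flat m x.
Proof. by move=> x0; rewrite /flat x0 mulr_gt0 ?expR_gt0// invr_gt0 exprn_gt0. Qed.

Lemma flat_out m x : x <= 0 -> flat m x = 0.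
Proof. by rewrite /flat leNgt => /negbTE ->. Qed.

(** The term of order m + 2 of the exponential series leaves a factor x^2, which gives derivative 0
    at the origin. *)
Lemma flat_le_sqr m x : flat m x <= ((m.+2)`!)%:R * x ^+ 2.
Proof.
rewrite /flat; case: ifPn => x0; last by rewrite mulr_ge0// sqr_ge0.
have := expR_ge1Dxn m.+1 (_ : 0 <= x^-1); rewrite invr_ge0 => /(_ (ltW x0)) h.
have {}h : x ^- m.+2 / (m.+2)`!%:R <= expR x^-1.
  by apply: le_trans h; rewrite exprVn lerDr.
have f0 : 0 < (m.+2)`!%:R :> R by rewrite ltr0n fact_gt0.
rewrite expRN ler_pdivrMr ?expR_gt0//.
apply: le_trans (ler_wpM2l _ h); last by rewrite mulr_ge0 ?sqr_ge0// ltW.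
have -> : x ^- m.+2 = x ^- m * x ^- 2 by rewrite -invfM -exprD addn2.
by rewrite le_eqVlt; apply/orP; left; apply/eqP; field; rewrite expf_neq0 !gt_eqF.
Qed.

Lemma is_derive_flat m (x : R) :
  is_derive x 1 (flat m) (- m%:R * flat m.+1 x + flat m.+2 x).
Proof.
have [x0|x0|->] := ltgtP x 0.
- rewrite !flat_out ?(ltW x0)// mulr0 addr0.
  apply: (@is_derive_quadratic _ _ _ 0 (- x)); first by rewrite oppr_gt0.
  move=> h; rewrite ltr_norml opprK => /andP[_ hx].
  by rewrite !flat_out ?(ltW x0) ?mul0r ?subr0 ?normr0//; lra.
- apply: (@near_eq_is_derive R R R (fun t => t^-1 ^+ m * expR (- t^-1))).
    near=> t; have t0 : 0 < t by near: t; exact: lt_nbhsr.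
    by rewrite /flat t0 exprVn.
  have xn : x != 0 by rewrite gt_eqF.
  apply: (@is_derive_eq R R R _ _ _ _ ((m%:R * x^-1 ^+ m.-1) * (- x ^- 2) * expR (- x^-1) +
     x^-1 ^+ m * (expR (- x^-1) * x ^- 2))).
    have dinv : is_derive x 1 (fun t : R => t^-1) (- x ^- 2).
      apply: (is_derive_eq (@is_deriveV _ id x 1 1 xn (is_derive_id _ _))).
      by rewrite /GRing.scale/= mulr1.
    apply: is_deriveMf.
      rewrite (_ : (fun t => _) = (fun t : R => t^-1) ^+ m); last by apply/funext => t; rewrite exprfctE.
      apply: (is_derive_eq (is_deriveX m dinv)).
      by rewrite /GRing.scale.
    apply: is_derive_compf.
    apply: (is_derive_eq (is_deriveN dinv)).
    by rewrite opprK.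
  rewrite /flat x0; case: m => [|m] /=.
    by rewrite !expr0; field.
  by rewrite !exprVn !exprS; field; rewrite xn expf_neq0.
- rewrite !flat_out// mulr0 addr0.
  apply: (@is_derive_quadratic _ _ _ ((m.+2)`!)%:R 1) => // h _.
  by rewrite add0r (@flat_out m 0)// subr0 mul0r subr0 ger0_norm ?flat_ge0// flat_le_sqr.
Unshelve. all: by end_near. Qed.

Lemma smooth_flat m : smooth (flat m).
Proof.
move=> k; elim: k m => // k ih m.
exists (fun x => - m%:R * flat m.+1 x + flat m.+2 x); first exact: is_derive_flat.
by apply: CderD => //; apply: CderM => //; exact: Cder_cst.
Qed.

(** A smooth transition from 1 on x <= 1 to 0 on x >= 2. The denominator is positive because the
    half-lines on which its two terms vanish are disjoint. *)
Definition step (x : R) : R := flat 0 (2 - x) / (flat 0 (2 - x) + flat 0 (x - 1)).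

Let step_den x : 0 < flat 0 (2 - x) + flat 0 (x - 1).
Proof.
have [h|h] := ltP x 2.
  by rewrite ltr_pwDl ?flat_ge0// flat_gt0// subr_gt0.
by rewrite ltr_wpDl ?flat_ge0// flat_gt0//; lra.
Qed.

Lemma smooth_step : smooth step.
Proof.
move=> k.
have h1 : Cder k (fun x => flat 0 (2 - x)).
  rewrite (_ : (fun x => _) = (fun x => flat 0 (- 1 * x + 2))).
    by apply: Cder_affine; exact: smooth_flat.
  by apply/funext => x; congr flat; ring.
apply: CderM => //; apply: CderV; first by move=> x; rewrite gt_eqF.
apply: CderD => //.
rewrite (_ : (fun x => _) = (fun x => flat 0 (1 * x + (- 1)))).
  by apply: Cder_affine; exact: smooth_flat.
by apply/funext => x; congr flat; ring.
Qed.

Lemma step1 x : x <= 1 -> step x = 1.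
Proof.
move=> x1; have := step_den x; rewrite /step (@flat_out 0 (x - 1)) ?subr_le0// addr0.
by move=> h; rewrite divff// gt_eqF.
Qed.

Lemma step0 x : 2 <= x -> step x = 0.
Proof. by move=> x2; rewrite /step (@flat_out 0 (2 - x)) ?subr_le0// mul0r. Qed.

Lemma step_ge0 x : 0 <= step x.
Proof. by rewrite divr_ge0 ?flat_ge0// ltW. Qed.

Lemma step_le1 x : step x <= 1.
Proof. by rewrite ler_pdivrMr// mul1r lerDl flat_ge0. Qed.

(** Equal to 1 on [-1, T + 1] and to 0 outside [-2, T + 2]; the margin makes the derivative vanish
    on [0, T], endpoints included. *)
Definition plateau (T : R) (t : R) : R := step (t - T) * step (- t).

Lemma smooth_plateau T : smooth (plateau T).
Proof.
move=> k; apply: CderM.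
  rewrite (_ : (fun x => _) = (fun x => step (1 * x + (- T)))).
    by apply: Cder_affine; exact: smooth_step.
  by apply/funext => x; congr step; ring.
rewrite (_ : (fun x => _) = (fun x => step (- 1 * x + 0))).
  by apply: Cder_affine; exact: smooth_step.
by apply/funext => x; congr step; ring.
Qed.

Lemma plateau1 T t : - 1 <= t -> t <= T + 1 -> plateau T t = 1.
Proof. by move=> t0 tT; rewrite /plateau !step1 ?mulr1//; lra. Qed.

Lemma plateau0 T t : (T + 2 <= t) || (t <= - 2) -> plateau T t = 0.
Proof.
move=> /orP[h|h]; rewrite /plateau; first by rewrite step0 ?mul0r//; lra.
by rewrite [step (- t)]step0 ?mulr0//; lra.
Qed.

Lemma plateau_ge0 T t : 0 <= plateau T t.
Proof. by rewrite mulr_ge0 ?step_ge0. Qed.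

Lemma plateau_le1 T t : plateau T t <= 1.
Proof. by rewrite mulr_ile1 ?step_ge0 ?step_le1. Qed.

Lemma smooth_derive f : smooth f -> (forall x : R, is_derive x 1 f (f^`()%classic x)) /\ smooth f^`()%classic.
Proof.
move=> sf; have d (x : R) : is_derive x 1 f (f^`()%classic x).
  have [f' df _] := sf 1%N; rewrite derive1E.
  by apply: derivableP; have [] := df x.
split=> // k; have [f' df Cf'] := sf k.+1.
rewrite (_ : f^`()%classic = f')//; apply/funext => x.
by have [_ e1] := d x; have [_ e2] := df x; rewrite -e1 e2.
Qed.

Lemma smooth_deriven f n : smooth f ->
  (forall x : R, is_derive x 1 (f^`(n)%classic) (f^`(n.+1)%classic x)) /\ smooth (f^`(n)%classic).
Proof.
move=> sf; elim: n => [|n [_ ih]].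
  by rewrite derive1n0 derive1n1; have [] := smooth_derive sf.
have [h1 h2] := smooth_derive ih; rewrite -derive1nS in h1 h2.
split=> //; have [h3 _] := smooth_derive h2.
by rewrite -derive1nS in h3.
Qed.

Lemma smooth_continuous f : smooth f -> continuous f.
Proof.
move=> /smooth_derive[df _] x; apply/differentiable_continuous/derivable1_diffP.
by have [] := df x.
Qed.

Lemma derive_out f (r : R) : smooth f -> (forall x, r <= `|x| -> f x = 0) ->
  forall x, r < `|x| -> f^`()%classic x = 0.
Proof.
move=> sf f0 x xr; have [df _] := smooth_derive sf.
have d0 : is_derive x 1 f 0.
  apply: (@is_derive_quadratic _ _ _ 0 (`|x| - r)); first by rewrite subr_gt0.
  move=> h hx; rewrite mul0r subr0 mul0r !f0 ?subrr ?normr0 ?(ltW xr)//.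
  by have := lerB_dist x (- h); rewrite normrN opprK; lra.
by have [_ e1] := df x; have [_ e2] := d0; rewrite -e1 e2.
Qed.

End smooth_functions.

(** * Translation, reflection and integration by parts on the line *)

Section line_integrals.
Context {R : realType}.
Implicit Types (f g : R -> R) (r : R).

Lemma lebesgue_measure_translate (c : R) (A : set R) : measurable A ->
  pushforward (@lebesgue_measure R) (+%R c : _ -> measurableTypeR R) A = lebesgue_measure A.
Proof.
have mT : measurable_fun setT (+%R c : measurableTypeR R -> measurableTypeR R).
  by apply: measurable_funD.
pose T : {mfun (measurableTypeR R) >-> (measurableTypeR R)} :=
  HB.pack (+%R c : measurableTypeR R -> measurableTypeR R)
    (isMeasurableFun.Build _ _ _ _ _ mT).
move=> mA; apply/esym/(lebesgue_measure_unique (mu := pushforward lebesgue_measure T)) => //= _ [[a b]] _ <-.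
rewrite /pushforward.
have -> : +%R c @^-1` `]a, b]%classic = `](a - c), (b - c)]%classic.
  by apply/seteqP; split => x /=; rewrite !in_itv/= ltrBlDl lerBrDl.
by rewrite !lebesgue_measure_itv/= !lte_fin ltrD2r; case: ifP => // _;
  rewrite -!EFinB; congr EFin; ring.
Qed.

Lemma Rint_translate f (c : R) : leb1.-integrable setT (EFin \o f) ->
  leb1.-integrable setT (EFin \o (fun y => f (c + y))) /\
  \int[leb1]_y f (c + y) = \int[leb1]_y f y.
Proof.
move=> intf.
have mf := measurable_int _ intf.
pose N : measurableTypeR R -> measurableTypeR R := +%R c.
have mN : measurable_fun setT N by apply: measurable_funD.
pose g y := f (c + y).
have mg : measurable_fun setT (EFin \o g) by exact: (measurableT_comp mf mN).
have ie (h : R -> \bar R) (mh : measurable_fun setT h) (h0 : forall y, (0 <= h y)%E) :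
    (\int[leb1]_y h (c + y)%R = \int[leb1]_y h y)%E.
  have := @ge0_integral_pushforward _ _ _ _ R N mN leb1 setT h measurableT mh.
  move=> /(_ (fun y _ => h0 y)); rewrite preimage_setT => <-.
  by apply: eq_measure_integral => A mA _; rewrite /= /leb1 -(lebesgue_measure_translate c mA).
have ig : leb1.-integrable setT (EFin \o g).
  apply/integrableP; split=> //.
  rewrite (ie (fun y => `|(f y)%:E|%E)) //.
    by have [] := integrableP _ _ _ intf.
  exact: measurableT_comp.
split=> //; congr fine.
rewrite integralE [RHS]integralE; congr (_ - _)%E.
- transitivity (\int[leb1]_y (EFin \o f)^\+ (c + y)%R)%E.
    by apply: eq_integral => y _; rewrite !funeposE.
  by apply: ie => //; exact: measurable_funepos.
- transitivity (\int[leb1]_y (EFin \o f)^\- (c + y)%R)%E.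
    by apply: eq_integral => y _; rewrite !funenegE.
  by apply: ie => //; exact: measurable_funeneg.
Qed.

Lemma Rint_reflect f (x : R) : leb1.-integrable setT (EFin \o f) ->
  leb1.-integrable setT (EFin \o (fun y => f (x - y))) /\
  \int[leb1]_y f (x - y) = \int[leb1]_y f y.
Proof.
move=> intf; have [i1 e1] := Rint_translate x intf.
have [iN eN] := Rint_oppi i1.
by rewrite -e1 -eN.
Qed.

Lemma smooth_measurable f : smooth f -> measurable_fun setT f.
Proof. by move=> sf; apply: continuous_measurable_fun; exact: smooth_continuous. Qed.

Lemma bounded_support_integrable f r (C : R) : measurable_fun setT f ->
  (forall x, r < `|x| -> f x = 0) -> (forall x, `|f x| <= C) ->
  leb1.-integrable setT (EFin \o f) /\ `|\int[leb1]_x f x| <= C * (2 * Num.max r 0).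
Proof.
move=> mf f0 fC.
(* A negative radius forces [f] to vanish identically and may be replaced by 0. *)
pose m := Num.max r 0.
have m0 : 0 <= m by rewrite le_max lexx orbT.
pose I : set R := [set` `[- m, m]%R].
have mI : measurable I by exact: measurable_itv.
have lI : @lebesgue_measure R I = (2 * m)%:E.
  rewrite /I lebesgue_measure_itv/= lte_fin; case: ifPn => [_|].
    by rewrite -EFinB; congr EFin; ring.
  by rewrite -leNgt => h; congr EFin; lra.
have {}lI : leb1 (I : set (measurableTypeR R)) = (2 * m)%:E := lI.
have iI : leb1.-integrable setT (EFin \o (\1_I : R -> R)).
  by apply: integr_indic => //; rewrite lI ltry.
have le1 x : `|f x| <= C * \1_I x.
  rewrite indicE; have [h|h] := boolP (x \in I).
    by rewrite mulr1.
  rewrite f0 ?normr0 ?mulr0// ltNge; apply: contra h => h.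
  rewrite mem_setE in_itv/= -ler_norml (le_trans h)//.
  by rewrite le_max lexx.
split; first by apply: integr_le (integrZ C iI) le1.
have h := @norm_Rint_le _ _ R leb1 f (fun x => C * \1_I x) mf (integrZ C iI) le1.
apply: (le_trans h).
by rewrite RintZ// Rint_indic// lI.
Qed.

Definition supp_in r f := forall x, r < `|x| -> f x = 0.

Lemma smooth_bounded f r : smooth f -> supp_in r f -> exists2 C, 0 < C & forall x, `|f x| <= C.
Proof.
move=> sf f0.
have cf : continuous (fun x => `|f x|).
  by move=> x; apply: cvg_norm; exact: smooth_continuous.
pose s : R := `|r|.
have s0 : 0 <= s by exact: normr_ge0.
have ss : - s <= s by lra.
have [c _ hc] := EVT_max ss (continuous_subspaceT cf).
exists (`|f c| + 1); first by rewrite ltr_wpDl.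
move=> x; have [h|h] := leP `|x| s.
  by rewrite ler_wpDr// hc// in_itv/= -ler_norml.
by rewrite f0 ?normr0 ?addr_ge0// (le_lt_trans _ h)// ler_norm.
Qed.

Lemma supp_in_derive f r : smooth f -> supp_in r f -> supp_in r f^`()%classic.
Proof.
move=> sf f0 x xr.
pose s := (r + `|x|) / 2.
apply: (@derive_out _ f s sf) => [y ys|]; last by rewrite /s; lra.
by apply: f0; apply: lt_le_trans ys; rewrite /s; lra.
Qed.

Lemma Rint_derive0 f r : smooth f -> supp_in r f -> \int[leb1]_x f^`()%classic x = 0.
Proof.
move=> sf f0; have [df sdf] := smooth_derive sf.
pose s : R := `|r| + 1.
have s0 : 0 < s by rewrite ltr_wpDl.
have rs : r < s by rewrite (le_lt_trans (ler_norm _))// ltrDl.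
have f's := supp_in_derive sf f0.
have e := @continuous_FTC2 R f^`()%classic f (- s) s.
have : (\int[lebesgue_measure]_(x in [set` `[- s, s]%R]) (f^`()%classic x)%:E = (f s)%:E - (f (- s))%:E)%E.
  apply: e.
  - lra.
  - by apply: continuous_subspaceT; exact: smooth_continuous.
  - have cf := smooth_continuous sf.
    split.
    + by move=> x _; have [] := df x.
    + by apply: cvg_at_right_filter; exact: cf.
    + by apply: cvg_at_left_filter; exact: cf.
  - by [].
rewrite !f0 ?normrN ?gtr0_norm// subee// => e1.
rewrite /Rintegral -[RHS]/(fine 0%E) -e1; congr fine; rewrite [RHS]integral_mkcond.
rewrite /leb1; apply: eq_integral => x _; rewrite /patch; case: ifPn => // h.
rewrite f's// ltNge; apply: contra h => h; rewrite mem_setE in_itv/= -ler_norml.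
by apply: le_trans h _; exact: ltW.
Qed.

Lemma smoothM f g : smooth f -> smooth g -> smooth (fun x => f x * g x).
Proof. by move=> sf sg k; exact: CderM. Qed.

Lemma smooth_id : smooth (id : R -> R).
Proof. by move=> k; exact: Cder_id. Qed.

Lemma derive1_unique f (x d : R) : is_derive x 1 f d -> f^`()%classic x = d.
Proof. by move=> h; rewrite derive1E; have [_ ->] := h. Qed.

(** Integrate the derivative of x f(x). For a mollifier this says that convolution with its
    derivative reproduces the slope of an affine function. *)
Lemma Rint_moment f r : smooth f -> supp_in r f ->
  \int[leb1]_x (x * f^`()%classic x) = - \int[leb1]_x f x.
Proof.
move=> sf f0; have [df sdf] := smooth_derive sf.
have sxf : smooth (fun x => x * f x) by apply: smoothM => //; exact: smooth_id.
have xf0 : supp_in r (fun x => x * f x) by move=> x xr; rewrite f0// mulr0.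
have := Rint_derive0 sxf xf0.
have [C C0 fC] := smooth_bounded sf f0.
have [i1 _] := bounded_support_integrable (smooth_measurable sf) f0 fC.
have sxf' : smooth (fun x => x * f^`()%classic x) by apply: smoothM => //; exact: smooth_id.
have xf'0 : supp_in r (fun x => x * f^`()%classic x).
  by move=> x xr; rewrite (supp_in_derive sf f0)// mulr0.
have [C' C'0 fC'] := smooth_bounded sxf' xf'0.
have [i2 _] := bounded_support_integrable (smooth_measurable sxf') xf'0 fC'.
rewrite (eq_Rint leb1 (g := fun x => f x + x * f^`()%classic x)); last first.
  move=> x; apply: derive1_unique.
  have := is_deriveMf (is_derive_id x 1) (df x).
  by rewrite mul1r.
by rewrite RintD// addrC => /eqP; rewrite addr_eq0 => /eqP.
Qed.

End line_integrals.

(** * Frechet differentiability from a quadratic remainder *)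

Section frechet.
Context {R : realType}.

Lemma quadratic_diff (V : normedModType R) (f : V -> R) (L : {linear V -> R}) (z : V) (C : R) :
  continuous L -> (forall u, `|f (z + u) - f z - L u| <= C * `|u| ^+ 2) ->
  differentiable f z /\ forall u, 'D_u f z = L u.
Proof.
move=> cL fC.
have e : f \o shift z = cst (f z) + L +o_ 0 id.
  apply/eqaddoP => _/posnumP[eps]; near=> h.
  rewrite /= !fctE/=.
  have -> : f (h + z) - (f z + L h) = f (z + h) - f z - L h.
    by rewrite (addrC h) opprD addrA.
  apply: le_trans (fC h) _; rewrite expr2 mulrA ler_wpM2r//.
  have C1 : 0 < `|C| + 1 by rewrite ltr_wpDl.
  have hs : `|h| < eps%:num / (`|C| + 1).
    by near: h; apply: nbhs0_lt; rewrite divr_gt0.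
  apply: le_trans (_ : (`|C| + 1) * `|h| <= _).
    by rewrite ler_wpM2r// (le_trans (ler_norm _))// lerDl.
  by rewrite mulrC -ler_pdivlMr// ltW.
have dE := diff_unique cL e.
have df : differentiable f z.
  by apply/diff_locallyP; rewrite dE; split.
by split=> // u; rewrite deriveE// dE.
Unshelve. all: by end_near. Qed.

Lemma quadratic_differentiable (f : R * R * R -> R) (z : R * R * R) (a b c C : R) :
  (forall u : R * R * R, `|f (z + u) - f z - (a * u.1.1 + b * u.1.2 + c * u.2)| <= C * `|u| ^+ 2) ->
  differentiable f z /\ forall u, 'D_u f z = a * u.1.1 + b * u.1.2 + c * u.2.
Proof.
move=> fC.
pose L0 (u : R * R * R) : R := a * u.1.1 + b * u.1.2 + c * u.2.
have L0lin : linear L0.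
  by move=> k [[u1 u2] u3] [[v1 v2] v3]; rewrite /L0 /GRing.scale/= /GRing.scale/=; ring.
pose L : {linear (R * R * R)%type -> R} := HB.pack L0 (GRing.isLinear.Build _ _ _ _ L0 L0lin).
have cL : continuous L.
  move=> u; have c1 : (fst : R * R * R -> _) @ u --> u.1 by exact: cvg_fst.
  have c2 : (snd : R * R * R -> _) @ u --> u.2 by exact: cvg_snd.
  have c11 : (fun u : R * R * R => u.1.1) @ u --> u.1.1 by apply: (cvg_comp _ _ c1); exact: cvg_fst.
  have c12 : (fun u : R * R * R => u.1.2) @ u --> u.1.2 by apply: (cvg_comp _ _ c1); exact: cvg_snd.
  apply: cvgD; last by apply: cvgM => //; exact: cvg_cst.
  by apply: cvgD; apply: cvgM => //; exact: cvg_cst.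
exact: (@quadratic_diff (R * R * R)%type f L z C cL fC).
Qed.

End frechet.

Section product_integral.
Context {R : realType}.

Lemma Rint2_prod (a b : R -> R) : leb1.-integrable setT (EFin \o a) ->
  leb1.-integrable setT (EFin \o b) ->
  leb2.-integrable setT (EFin \o (fun y : R * R => a y.1 * b y.2)) /\
  \int[leb2]_y (a y.1 * b y.2) = (\int[leb1]_s a s) * \int[leb1]_s b s.
Proof.
move=> ia ib.
have ma := integr_measurable ia; have mb := integr_measurable ib.
have m (c e : R -> R) : measurable_fun setT (c : measurableTypeR R -> R) ->
    measurable_fun setT (e : measurableTypeR R -> R) ->
    measurable_fun setT (fun y : (measurableTypeR R * measurableTypeR R)%type => c y.1 * e y.2).
  move=> mc me; apply: measurable_funM.
    by apply: (measurableT_comp mc); exact: measurable_fst.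
  by apply: (measurableT_comp me); exact: measurable_snd.
pose F (y : (measurableTypeR R * measurableTypeR R)%type) : \bar R := (a y.1 * b y.2)%:E.
have mF : measurable_fun setT F by apply/measurable_EFinP; exact: m.
have inner x : (\int[sleb1]_y F (x, y))%E = (a x * \int[leb1]_s b s)%:E.
  rewrite -(@RintZ _ _ R leb1)// EFin_Rint//; exact: integrZ.
have iF : (sleb1 \x sleb1)%E.-integrable setT F.
  apply/integrable12ltyP => //.
  have -> : (\int[sleb1]_x \int[sleb1]_y `|F (x, y)| =
      \int[leb1]_x (`|a x| * \int[leb1]_s `|b s|)%:E)%E.
    apply: eq_integral => x _.
    rewrite -(@RintZ _ _ R leb1); last exact: integr_norm.
    rewrite EFin_Rint; last by apply: integrZ; exact: integr_norm.
    by apply: eq_integral => y _; rewrite /F/= normrM.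
  rewrite -EFin_Rint ?ltry//.
  have := @integrZ _ _ R leb1 (\int[leb1]_s `|b s|) _ (integr_norm ia).
  by apply: eq_integr => x; rewrite mulrC.
have iF2 : leb2.-integrable setT F by exact: iF.
split=> //; rewrite [RHS]mulrC -(@RintZ _ _ R leb1)//; congr fine.
have e := integral12_prod_meas1 iF.
transitivity (\int[sleb1]_x fubini_F sleb1 F x)%E; first exact: esym e.
by apply: eq_integral => x _; rewrite /fubini_F inner mulrC.
Qed.

End product_integral.

(** * Mollifiers and convolution with tensor products *)

Section mollifiers.
Context {R : realType}.
Implicit Types (x y u : R * R) (eta : R * R -> R) (al be th : R -> R).

(** In [mollifier_exists] the constant [C] is chosen before the width [d]: mollifying a function
    whose oscillation at scale [d] is om then gives a gradient of size om C / d. *)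
Record mollifier (C d : R) (th : R -> R) : Prop := Mollifier {
  moll_smooth : smooth th;
  moll_ge0 : forall s, 0 <= th s;
  moll_supp : supp_in d th;
  moll_int : \int[leb1]_s th s = 1;
  moll_dint : \int[leb1]_s `|th^`()%classic s| <= C / d }.

Lemma smooth_integrable th (r : R) : smooth th -> supp_in r th ->
  leb1.-integrable setT (EFin \o th).
Proof.
move=> sth sup; have [C _ thC] := smooth_bounded sth sup.
by have [] := bounded_support_integrable (smooth_measurable sth) sup thC.
Qed.

(** A fixed bump, equal to 1 on [-1/2, 1/2] and supported in [-1, 1], is rescaled to width d and
    divided by its mass. *)
Lemma mollifier_exists : exists2 C : R, 0 < C & forall d : R, 0 < d ->
  exists th, mollifier C d th.
Proof.
pose B (t : R) := step (2 * t + 0) * step (- 2 * t + 0).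
have sB : smooth B.
  by move=> k; apply: CderM; apply: Cder_affine; exact: smooth_step.
have B0 t : 0 <= B t by rewrite mulr_ge0 ?step_ge0.
have supB : supp_in 1 B.
  move=> t t1; rewrite /B; have [t0|t0] := leP 0 t.
    by rewrite step0 ?mul0r//; rewrite ger0_norm// in t1; lra.
  by rewrite [step (- 2 * t + 0)]step0 ?mulr0//; rewrite ltr0_norm// in t1; lra.
have B1 t : `|t| <= 1 / 2 -> B t = 1.
  by rewrite ler_norml => /andP[h1 h2]; rewrite /B !step1 ?mulr1//; lra.
have [dB sB'] := smooth_derive sB.
have supB' := supp_in_derive sB supB.
have [C C0 B'C] := smooth_bounded sB' supB'.
(* Before normalisation the rescaled derivative is at most [C / d] on an interval of length 2 d, and
   the mass divided out is at least d. *)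
exists (2 * C); first by rewrite mulr_gt0.
move=> d d0; have dn : d != 0 by rewrite gt_eqF.
pose b t := B (d^-1 * t + 0).
have sb : smooth b by move=> k; apply: Cder_affine; exact: sB.
have supb : supp_in d b.
  move=> t td; apply: supB; rewrite addr0 normrM gtr0_norm ?invr_gt0//.
  by rewrite mulrC ltr_pdivlMr// mul1r.
have ib := smooth_integrable sb supb.
have b0 t : 0 <= b t by exact: B0.
pose I : set R := [set` `[- (d / 2), d / 2]%R].
have mI : measurable I by exact: measurable_itv.
have lI : @lebesgue_measure R I = d%:E.
  rewrite /I lebesgue_measure_itv/= lte_fin ifT; last by lra.
  by rewrite -EFinB; congr EFin; field.
have {}lI : leb1 (I : set (measurableTypeR R)) = d%:E := lI.
have iI : leb1.-integrable setT (EFin \o (\1_I : R -> R)).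
  by apply: integr_indic => //; rewrite lI ltry.
have cd : d <= \int[leb1]_t b t.
  have -> : d = \int[leb1]_t \1_I t by rewrite Rint_indic// lI.
  apply: (@le_Rint _ _ R leb1) => // t; rewrite indicE; have [h|h] := boolP (t \in I); last exact: b0.
  rewrite /b B1// addr0 normrM gtr0_norm ?invr_gt0// mulrC ler_pdivrMr//.
  by move: h; rewrite mem_setE in_itv/= -ler_norml; lra.
set c := \int[leb1]_t b t in cd.
have c0 : 0 < c by apply: lt_le_trans cd.
have sth : smooth (fun t => c^-1 * b t).
  by apply: smoothM => // k; exact: Cder_cst.
have supth : supp_in d (fun t => c^-1 * b t) by move=> t td; rewrite supb// mulr0.
exists (fun t => c^-1 * b t); split => //.
- by move=> t; rewrite mulr_ge0// invr_ge0 ltW.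
- by rewrite (@RintZ _ _ R leb1)// mulVf// gt_eqF.
have [dth sth'] := smooth_derive sth.
have bd t : `|(fun t => c^-1 * b t)^`()%classic t| <= c^-1 * (C / d).
  have -> : (fun t => c^-1 * b t)^`()%classic t = c^-1 * (B^`()%classic (d^-1 * t + 0) * d^-1).
    apply: derive1_unique.
    have h := @is_derive_compf R B (fun t => d^-1 * t + 0) t _ _ (dB (d^-1 * t + 0)) (is_derive_affine d^-1 0 t).
    have h1 : is_derive t 1 (fun=> c^-1) 0 by exact: is_derive_cst.
    by apply: (is_derive_eq (is_deriveMf h1 h)); rewrite mul0r add0r.
  rewrite normrM ger0_norm ?invr_ge0 ?(ltW c0)// ler_wpM2l ?invr_ge0 ?(ltW c0)//.
  by rewrite normrM (gtr0_norm (_ : 0 < d^-1)) ?invr_gt0// ler_wpM2r ?invr_ge0 ?(ltW d0).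
have mth' : measurable_fun setT (fun t => `|(fun t => c^-1 * b t)^`()%classic t|).
  by apply: measurableT_comp => //; exact: smooth_measurable.
have sup' : forall t, d < `|t| -> `|(fun t => c^-1 * b t)^`()%classic t| = 0.
  by move=> t td; rewrite (supp_in_derive sth supth)// normr0.
have bd' t : `| `|(fun t => c^-1 * b t)^`()%classic t| | <= c^-1 * (C / d).
  by rewrite normr_id.
have [_ h] := bounded_support_integrable mth' sup' bd'.
apply: le_trans (ler_norm _) (le_trans h _).
rewrite max_l ?(ltW d0)//.
have -> : c^-1 * (C / d) * (2 * d) = c^-1 * (2 * C) by field; rewrite gt_eqF//= gt_eqF.
rewrite mulrC ler_wpM2l ?mulr_ge0// ?(ltW C0)//.
by rewrite lef_pV2 ?posrE.
Qed.

(** The derivatives of such a convolution fall on [al] or on [be] and are again of this form, even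
    if [eta] is merely integrable. *)
Definition mconv eta al be x : R :=
  \int[leb2]_y (eta y * (al (x.1 - y.1) * be (x.2 - y.2))).

Section mconv.
Variable eta : R * R -> R.
Hypothesis ieta : leb2.-integrable setT (EFin \o eta).

Lemma measurable_shift2 al be x : measurable_fun setT al -> measurable_fun setT be ->
  measurable_fun setT (fun y : plane => al (x.1 - y.1) * be (x.2 - y.2)).
Proof.
move=> mal mbe; apply: measurable_funM.
  apply: (measurableT_comp mal); apply: measurable_funB => //; exact: measurable_fst.
by apply: (measurableT_comp mbe); apply: measurable_funB => //; exact: measurable_snd.
Qed.

Lemma mconv_integrable al be (A : R) x : measurable_fun setT al -> measurable_fun setT be ->
  (forall s, `|al s| <= A) -> (forall s, `|be s| <= A) ->
  leb2.-integrable setT (EFin \o (fun y => eta y * (al (x.1 - y.1) * be (x.2 - y.2)))).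
Proof.
move=> mal mbe alA beA; apply: (@integrM _ _ _ leb2 _ _ (A * A)) => //.
  exact: measurable_shift2.
by move=> y; rewrite normrM; apply: ler_pM.
Qed.

Lemma taylor1 (f f' : R -> R) (A s t : R) : (forall s : R, is_derive s 1 f (f' s)) ->
  (forall s t, `|f' t - f' s| <= A * `|t - s|) ->
  `|f (s + t) - f s - f' s * t| <= A * t ^+ 2.
Proof.
move=> df fA; have [c cs] := mvt1 s (s + t) df.
rewrite addrAC subrr add0r in cs *; move=> ->.
rewrite -mulrBl normrM -[t ^+ 2]real_normK ?num_real// expr2 mulrA ler_wpM2r//.
apply: le_trans (fA _ _) _; rewrite ler_wpM2l//.
have := le_trans (normr_ge0 _) (fA 0 1); rewrite subr0 normr1 mulr1.
by [].
Qed.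

Lemma lip1 (f f' : R -> R) (A s t : R) : (forall s : R, is_derive s 1 f (f' s)) ->
  (forall s, `|f' s| <= A) -> `|f t - f s| <= A * `|t - s|.
Proof.
move=> df fA; have [c _ ->] := mvt1 s t df.
by rewrite normrM ler_wpM2r.
Qed.

Variables (al al' al'' be be' be'' : R -> R) (A : R).
Hypotheses (dal : forall s : R, is_derive s 1 al (al' s))
  (dal' : forall s : R, is_derive s 1 al' (al'' s))
  (dbe : forall s : R, is_derive s 1 be (be' s))
  (dbe' : forall s : R, is_derive s 1 be' (be'' s)).
Hypotheses (A0 : forall s, `|al s| <= A) (A1 : forall s, `|al' s| <= A)
  (A2 : forall s, `|al'' s| <= A)
  (B0 : forall s, `|be s| <= A) (B1 : forall s, `|be' s| <= A)
  (B2 : forall s, `|be'' s| <= A).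
Hypotheses (mal : measurable_fun setT al) (mal' : measurable_fun setT al')
  (mbe : measurable_fun setT be) (mbe' : measurable_fun setT be').

Let Ap : 0 <= A. Proof. exact: le_trans (normr_ge0 _) (A0 0). Qed.

(** The product of the two increments and one second-order remainder for each factor: three terms,
    hence the constant 3. *)
Lemma tensor_taylor (s t p q n : R) : `|p| <= n -> `|q| <= n ->
  `|al (s + p) * be (t + q) - al s * be t - (al' s * be t * p + al s * be' t * q)| <=
  3 * A ^+ 2 * n ^+ 2.
Proof.
move=> pn qn; have n0 : 0 <= n by apply: le_trans pn.
have h1 := taylor1 s p dal (fun s t => lip1 s t dal' A2).
have h2 := taylor1 t q dbe (fun s t => lip1 s t dbe' B2).
have h3 := lip1 s (s + p) dal A1; have h4 := lip1 t (t + q) dbe B1.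
rewrite addrAC subrr add0r in h3; rewrite addrAC subrr add0r in h4.
have p2 : p ^+ 2 <= n ^+ 2.
  by rewrite -[p ^+ 2]real_normK ?num_real// lerXn2r// nnegrE.
have q2 : q ^+ 2 <= n ^+ 2.
  by rewrite -[q ^+ 2]real_normK ?num_real// lerXn2r// nnegrE.
have -> : al (s + p) * be (t + q) - al s * be t - (al' s * be t * p + al s * be' t * q) =
  (al (s + p) - al s) * (be (t + q) - be t) + ((al (s + p) - al s - al' s * p) * be t +
  al s * (be (t + q) - be t - be' t * q)) by ring.
apply: le_trans (ler_normD _ _) _.
have -> : 3 * A ^+ 2 * n ^+ 2 = (A * n) * (A * n) + ((A * n ^+ 2) * A + A * (A * n ^+ 2)) by ring.
rewrite normrM lerD//.
  apply: ler_pM => //; [apply: le_trans h3 _|apply: le_trans h4 _]; exact: ler_wpM2l.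
apply: le_trans (ler_normD _ _) _; rewrite !normrM lerD//; apply: ler_pM => //.
  by apply: le_trans h1 _; exact: ler_wpM2l.
by apply: le_trans h2 _; exact: ler_wpM2l.
Qed.

Lemma tensor_lip (s t p q n : R) : `|p| <= n -> `|q| <= n ->
  `|al (s + p) * be (t + q) - al s * be t| <= 2 * A ^+ 2 * n.
Proof.
move=> pn qn; have n0 : 0 <= n by apply: le_trans pn.
have h3 := lip1 s (s + p) dal A1; have h4 := lip1 t (t + q) dbe B1.
rewrite addrAC subrr add0r in h3; rewrite addrAC subrr add0r in h4.
have -> : al (s + p) * be (t + q) - al s * be t =
  (al (s + p) - al s) * be (t + q) + al s * (be (t + q) - be t) by ring.
apply: le_trans (ler_normD _ _) _; rewrite !normrM.
have -> : 2 * A ^+ 2 * n = (A * n) * A + A * (A * n) by ring.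
apply: lerD; apply: ler_pM => //.
  by apply: le_trans h3 _; exact: ler_wpM2l.
by apply: le_trans h4 _; exact: ler_wpM2l.
Qed.

Let N := \int[leb2]_y `|eta y|.

Lemma mconv_taylor x u :
  `|mconv eta al be (x + u) - mconv eta al be x -
    (mconv eta al' be x * u.1 + mconv eta al be' x * u.2)| <= 3 * A ^+ 2 * N * `|u| ^+ 2.
Proof.
have i0 z := mconv_integrable z mal mbe A0 B0.
have i1 := mconv_integrable x mal' mbe A1 B0.
have i2 := mconv_integrable x mal mbe' A0 B1.
rewrite /mconv [_ * u.1]mulrC [_ * u.2]mulrC.
rewrite -(RintZ u.1 i1) -(RintZ u.2 i2) -(RintD (integrZ u.1 i1) (integrZ u.2 i2)).
rewrite -(RintB (i0 (x + u)) (i0 x)).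
rewrite -(RintB (integrB (i0 (x + u)) (i0 x)) (integrD (integrZ u.1 i1) (integrZ u.2 i2))).
have -> : 3 * A ^+ 2 * N * `|u| ^+ 2 = 3 * A ^+ 2 * `|u| ^+ 2 * N by ring.
rewrite /N -RintZ; last exact: integr_norm.
apply: norm_Rint_le.
- apply: integr_measurable; apply: integrB; first exact: integrB.
  by apply: integrD; exact: integrZ.
- by apply: integrZ; exact: integr_norm.
move=> y.
have h := tensor_taylor (x.1 - y.1) (x.2 - y.2) (plane_norm1 u) (plane_norm2 u).
rewrite (_ : _ - _ = eta y * (al (x.1 - y.1 + u.1) * be (x.2 - y.2 + u.2) -
   al (x.1 - y.1) * be (x.2 - y.2) -
   (al' (x.1 - y.1) * be (x.2 - y.2) * u.1 + al (x.1 - y.1) * be' (x.2 - y.2) * u.2))).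
  by rewrite normrM mulrC ler_wpM2r.
rewrite [x.1 - y.1 + u.1]addrAC [x.2 - y.2 + u.2]addrAC /=; ring.
Qed.

Lemma mconv_lip x u :
  `|mconv eta al be (x + u) - mconv eta al be x| <= 2 * A ^+ 2 * N * `|u|.
Proof.
have i0 z := mconv_integrable z mal mbe A0 B0.
rewrite /mconv -RintB//.
have -> : 2 * A ^+ 2 * N * `|u| = 2 * A ^+ 2 * `|u| * N by ring.
rewrite /N -RintZ; last exact: integr_norm.
apply: norm_Rint_le.
- by apply: integr_measurable; exact: integrB.
- by apply: integrZ; exact: integr_norm.
move=> y.
have h := tensor_lip (x.1 - y.1) (x.2 - y.2) (plane_norm1 u) (plane_norm2 u).
rewrite (_ : _ - _ = eta y * (al (x.1 - y.1 + u.1) * be (x.2 - y.2 + u.2) -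
   al (x.1 - y.1) * be (x.2 - y.2))).
  by rewrite normrM mulrC ler_wpM2r.
rewrite [x.1 - y.1 + u.1]addrAC [x.2 - y.2 + u.2]addrAC /=; ring.
Qed.

Lemma mconv_bound x : `|mconv eta al be x| <= A ^+ 2 * N.
Proof.
rewrite /N -RintZ; last exact: integr_norm.
apply: norm_Rint_le.
- exact: integr_measurable (mconv_integrable x mal mbe A0 B0).
- by apply: integrZ; exact: integr_norm.
by move=> y; rewrite normrM mulrC expr2 ler_wpM2r// normrM; apply: ler_pM.
Qed.

End mconv.
End mollifiers.

Section mollification.
Context {R : realType}.
Implicit Types (x y u : R * R).

Lemma bounded_supp_integrable2 (f : R * R -> R) (r C : R) :
  measurable_fun setT (f : plane -> R) ->
  (forall x, r < `|x| -> f x = 0) -> (forall x, `|f x| <= C) ->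
  leb2.-integrable setT (EFin \o f).
Proof.
move=> mf f0 fC; pose m := Num.max r 0.
have m0 : 0 <= m by rewrite le_max lexx orbT.
have iI : leb2.-integrable setT (EFin \o (\1_(box 0 m) : @plane R -> R)).
  by apply: integr_indic; [exact: measurable_box|rewrite leb2_box// ltry].
apply: (integr_le mf (integrZ C iI)) => x.
rewrite indicE; have [h|h] := boolP (x \in box 0 m); first by rewrite mulr1.
rewrite f0 ?normr0 ?mulr0// ltNge; apply: contra h => h.
apply/mem_set; rewrite /box/= subr0; apply: (le_trans h); by rewrite le_max lexx.
Qed.

Section fixed_mollifier.
Variables (C d : R) (th : R -> R).
Hypothesis hth : mollifier C d th.

Let sth : smooth th := moll_smooth hth.
Let supth : supp_in d th := moll_supp hth.
Let sth' : smooth th^`()%classic := (smooth_derive sth).2.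
Let supth' : supp_in d th^`()%classic := supp_in_derive sth supth.
Let ith := smooth_integrable sth supth.
Let ith' := smooth_integrable sth' supth'.
Let th0 : forall s, 0 <= th s := moll_ge0 hth.

Lemma moll_shift (s : R) : leb1.-integrable setT (EFin \o (fun t : R => th (s - t))) /\
  \int[leb1]_t th (s - t) = 1.
Proof. by have [h1 h2] := Rint_reflect s ith; rewrite h2 (moll_int hth). Qed.

Lemma moll_dshift (s : R) :
  leb1.-integrable setT (EFin \o (fun t => th^`()%classic (s - t))) /\
  \int[leb1]_t th^`()%classic (s - t) = 0.
Proof. by have [h1 h2] := Rint_reflect s ith'; rewrite h2 (Rint_derive0 sth supth). Qed.

Lemma moll_adshift (s : R) :
  leb1.-integrable setT (EFin \o (fun t => `|th^`()%classic (s - t)|)) /\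
  \int[leb1]_t `|th^`()%classic (s - t)| <= C / d.
Proof.
have [h1 h2] := Rint_reflect s (integr_norm ith').
by split; [exact: h1|rewrite h2 (moll_dint hth)].
Qed.

Lemma moll_xshift (s : R) :
  leb1.-integrable setT (EFin \o (fun t => (t - s) * th (s - t))).
Proof.
have sx : smooth (fun z => z * th z) by apply: smoothM => //; exact: smooth_id.
have xsup : supp_in d (fun z => z * th z) by move=> z zd; rewrite supth// mulr0.
have [h1 _] := Rint_reflect s (smooth_integrable sx xsup).
have := @integrZ _ _ R leb1 (-1) _ h1.
by apply: eq_integr => t; ring.
Qed.

Lemma moll_xdshift (s : R) :
  leb1.-integrable setT (EFin \o (fun t => (t - s) * th^`()%classic (s - t))) /\
  \int[leb1]_t ((t - s) * th^`()%classic (s - t)) = 1.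
Proof.
have sx : smooth (fun z => z * th^`()%classic z) by apply: smoothM => //; exact: smooth_id.
have xsup : supp_in d (fun z => z * th^`()%classic z) by move=> z zd; rewrite supth'// mulr0.
have ix := smooth_integrable sx xsup.
have [h1 h2] := Rint_reflect s ix.
have e t : -1 * ((s - t) * th^`()%classic (s - t)) = (t - s) * th^`()%classic (s - t) by ring.
split; first by have := @integrZ _ _ R leb1 (-1) _ h1; apply: eq_integr.
rewrite -(eq_Rint leb1 e) (RintZ (-1) h1) h2 (Rint_moment sth supth).
by rewrite (moll_int hth); ring.
Qed.

Variable eta : R * R -> R.
Hypothesis ieta : leb2.-integrable setT (EFin \o eta).

Lemma moll_bounds : exists A : R, forall k s, (k <= 4)%N -> `|th^`(k)%classic s| <= A.
Proof.
have b k : exists2 A, 0 < A & forall s, `|th^`(k)%classic s| <= A.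
  have [_ sk] := smooth_deriven k sth.
  have sup k' : supp_in d th^`(k')%classic.
    elim: k' => [|k' ih]; first by rewrite derive1n0.
    by rewrite derive1nS; apply: supp_in_derive ih; have [] := smooth_deriven k' sth.
  exact: smooth_bounded sk (sup k).
have [A0 A0p h0] := b 0%N; have [A1 A1p h1] := b 1%N; have [A2 A2p h2] := b 2%N.
have [A3 A3p h3] := b 3%N; have [A4 A4p h4] := b 4%N.
exists (A0 + A1 + A2 + A3 + A4); case=> [|[|[|[|[|k]]]]] s // _.
- by apply: le_trans (h0 s) _; lra.
- by apply: le_trans (h1 s) _; lra.
- by apply: le_trans (h2 s) _; lra.
- by apply: le_trans (h3 s) _; lra.
- by apply: le_trans (h4 s) _; lra.
Qed.

Let mth := smooth_measurable sth.
Let mth' := smooth_measurable sth'.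

Let bth : exists A, (forall s, `|th s| <= A) /\ (forall s, `|th^`()%classic s| <= A).
Proof.
have [A h] := moll_bounds; exists A; split => s.
  exact: (h 0%N).
by have := h 1%N s isT; rewrite derive1n1.
Qed.

Lemma mconv_th_integrable x :
  [/\ leb2.-integrable setT (EFin \o (fun y => eta y * (th (x.1 - y.1) * th (x.2 - y.2)))),
   leb2.-integrable setT (EFin \o (fun y => eta y * (th^`()%classic (x.1 - y.1) * th (x.2 - y.2)))) &
   leb2.-integrable setT (EFin \o (fun y => eta y * (th (x.1 - y.1) * th^`()%classic (x.2 - y.2))))].
Proof.
have [A [h0 h1]] := bth.
by split; exact: (mconv_integrable ieta (A := A)).
Qed.

Lemma th_out x y : d < `|y - x| -> th (x.1 - y.1) * th (x.2 - y.2) = 0 /\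
  th^`()%classic (x.1 - y.1) * th (x.2 - y.2) = 0 /\
  th (x.1 - y.1) * th^`()%classic (x.2 - y.2) = 0.
Proof.
rewrite ltNge plane_norm_le negb_and -!ltNge => /orP[] /=; rewrite distrC => h.
  by rewrite supth// supth'// !mul0r.
by rewrite [th (_ - y.2)]supth// [th^`()%classic (_ - y.2)]supth'// !mulr0.
Qed.

Lemma moll_close x (c om : R) :
  (forall y, `|y - x| <= d -> `|eta y - c| <= om) -> `|mconv eta th th x - c| <= om.
Proof.
move=> h; have [i0 _ _] := mconv_th_integrable x.
have [i1 e1] := moll_shift x.1; have [i2 e2] := moll_shift x.2.
have [ip ep] := Rint2_prod i1 i2; rewrite e1 e2 mulr1 in ep.
have -> : mconv eta th th x - c =
    \int[leb2]_y (eta y * (th (x.1 - y.1) * th (x.2 - y.2)) -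
      c * (th (x.1 - y.1) * th (x.2 - y.2))).
  by rewrite (RintB i0 (integrZ c ip)) (RintZ c ip) ep mulr1.
rewrite -[leRHS]mulr1 -ep -(RintZ om ip).
apply: norm_Rint_le.
- exact: integr_measurable (integrB i0 (integrZ c ip)).
- exact: integrZ.
move=> y; rewrite -mulrBl normrM (ger0_norm (mulr_ge0 (th0 _) (th0 _))).
have [yd|yd] := leP `|y - x| d; last by have [-> _] := th_out yd; rewrite !mulr0.
by apply: ler_wpM2r; [exact: mulr_ge0|exact: h].
Qed.

(** The derivative of [th] has integral 0 and a first moment fixed by [Rint_moment], so it
    annihilates constants and returns the slopes; only the deviation of [eta] from the affine
    function counts, at the price C / d. Zero slopes serve for moduli of continuity, Taylor
    polynomials for [C11] functions. *)
Lemma moll_grad_close x (p0 p1 p2 om : R) :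
  (forall y, `|y - x| <= d ->
     `|eta y - (p0 + (p1 * (y.1 - x.1) + p2 * (y.2 - x.2)))| <= om) ->
  `|mconv eta th^`()%classic th x - p1| <= om * (C / d) /\
  `|mconv eta th th^`()%classic x - p2| <= om * (C / d).
Proof.
move=> h; have [_ i1 i2] := mconv_th_integrable x.
have [t1 e1] := moll_shift x.1; have [t2 e2] := moll_shift x.2.
have [d1 f1] := moll_dshift x.1; have [d2 f2] := moll_dshift x.2.
have [a1 g1] := moll_adshift x.1; have [a2 g2] := moll_adshift x.2.
have x1 := moll_xshift x.1; have x2 := moll_xshift x.2.
have [y1 k1] := moll_xdshift x.1; have [y2 k2] := moll_xdshift x.2.
have om0 (y : R * R) : `|y - x| <= d -> 0 <= om by move=> yd; apply: le_trans (h y yd).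
split.
- have [ipa epa] := Rint2_prod d1 t2; rewrite f1 mul0r in epa.
  have [ipb epb] := Rint2_prod y1 t2; rewrite k1 e2 mulr1 in epb.
  have [ipc epc] := Rint2_prod d1 x2; rewrite f1 mul0r in epc.
  have [ipn epn] := Rint2_prod a1 t2; rewrite e2 mulr1 in epn.
  have id := integrD (integrZ p0 ipa) (integrD (integrZ p1 ipb) (integrZ p2 ipc)).
  have -> : mconv eta th^`()%classic th x - p1 =
      \int[leb2]_y (eta y * (th^`()%classic (x.1 - y.1) * th (x.2 - y.2)) -
        (p0 * (th^`()%classic (x.1 - y.1) * th (x.2 - y.2)) +
         (p1 * ((y.1 - x.1) * th^`()%classic (x.1 - y.1) * th (x.2 - y.2)) +
          p2 * (th^`()%classic (x.1 - y.1) * ((y.2 - x.2) * th (x.2 - y.2)))))).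
    rewrite (RintB i1 id) (RintD (integrZ p0 ipa) (integrD (integrZ p1 ipb) (integrZ p2 ipc))).
    rewrite (RintD (integrZ p1 ipb) (integrZ p2 ipc)) (RintZ p0 ipa) (RintZ p1 ipb) (RintZ p2 ipc).
    by rewrite epa epb epc !mulr0 mulr1 addr0 add0r.
  (* If the ball of radius [d] were empty, [th] would vanish, against its unit mass; a point in the
     ball shows 0 <= om. *)
  have [[y0 yd0]|nod] := pselect (exists y : R * R, `|y - x| <= d); last first.
    rewrite (eq_Rint leb2 (g := fun=> 0)); last first.
      move=> y; have yd : d < `|y - x| by rewrite ltNge; apply/negP => yd; apply: nod; exists y.
      have [_ [z1 _]] := th_out yd.
      have -> : (y.1 - x.1) * th^`()%classic (x.1 - y.1) * th (x.2 - y.2) = 0.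
        by rewrite -mulrA z1 mulr0.
      have -> : th^`()%classic (x.1 - y.1) * ((y.2 - x.2) * th (x.2 - y.2)) = 0.
        by rewrite mulrCA z1 mulr0.
      by rewrite z1 !mulr0 !addr0 subr0.
    exfalso; apply: nod; exists x; rewrite subrr normr0 leNgt; apply/negP => dn.
    have z : forall s, th s = 0 by move=> s; apply: supth; apply: lt_le_trans dn _.
    have := moll_int hth; rewrite (eq_Rint leb1 (g := fun=> 0))//.
    by rewrite Rintegral_cst// mul0r => /eqP; rewrite eq_sym oner_eq0.
  have omp := om0 _ yd0.
  apply: (@le_trans _ _ (\int[leb2]_y (om * (`|th^`()%classic (x.1 - y.1)| * th (x.2 - y.2))))).
    apply: norm_Rint_le.
    + exact: integr_measurable (integrB i1 id).
    + exact: integrZ.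
    move=> y.
    have -> : eta y * (th^`()%classic (x.1 - y.1) * th (x.2 - y.2)) -
        (p0 * (th^`()%classic (x.1 - y.1) * th (x.2 - y.2)) +
         (p1 * ((y.1 - x.1) * th^`()%classic (x.1 - y.1) * th (x.2 - y.2)) +
          p2 * (th^`()%classic (x.1 - y.1) * ((y.2 - x.2) * th (x.2 - y.2))))) =
      (eta y - (p0 + (p1 * (y.1 - x.1) + p2 * (y.2 - x.2)))) *
      (th^`()%classic (x.1 - y.1) * th (x.2 - y.2)) by ring.
    rewrite normrM.
    have -> : `|th^`()%classic (x.1 - y.1)| * th (x.2 - y.2) =
      `|th^`()%classic (x.1 - y.1) * th (x.2 - y.2)|.
      by rewrite normrM (ger0_norm (th0 _)).
    have [yd|yd] := leP `|y - x| d; first by apply: ler_wpM2r => //; exact: h.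
    by have [_ [-> _]] := th_out yd; rewrite normr0 !mulr0.
  by rewrite (RintZ om ipn) ler_wpM2l// epn.
- have [ipa epa] := Rint2_prod t1 d2; rewrite f2 mulr0 in epa.
  have [ipb epb] := Rint2_prod x1 d2; rewrite f2 mulr0 in epb.
  have [ipc epc] := Rint2_prod t1 y2; rewrite k2 e1 mulr1 in epc.
  have [ipn epn] := Rint2_prod t1 a2; rewrite e1 mul1r in epn.
  have id := integrD (integrZ p0 ipa) (integrD (integrZ p1 ipb) (integrZ p2 ipc)).
  have -> : mconv eta th th^`()%classic x - p2 =
      \int[leb2]_y (eta y * (th (x.1 - y.1) * th^`()%classic (x.2 - y.2)) -
        (p0 * (th (x.1 - y.1) * th^`()%classic (x.2 - y.2)) +
         (p1 * ((y.1 - x.1) * th (x.1 - y.1) * th^`()%classic (x.2 - y.2)) +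
          p2 * (th (x.1 - y.1) * ((y.2 - x.2) * th^`()%classic (x.2 - y.2)))))).
    rewrite (RintB i2 id) (RintD (integrZ p0 ipa) (integrD (integrZ p1 ipb) (integrZ p2 ipc))).
    rewrite (RintD (integrZ p1 ipb) (integrZ p2 ipc)) (RintZ p0 ipa) (RintZ p1 ipb) (RintZ p2 ipc).
    by rewrite epa epb epc !mulr0 mulr1 !add0r.
  have [[y0 yd0]|nod] := pselect (exists y : R * R, `|y - x| <= d); last first.
    exfalso; apply: nod; exists x; rewrite subrr normr0 leNgt; apply/negP => dn.
    have z : forall s, th s = 0 by move=> s; apply: supth; apply: lt_le_trans dn _.
    have := moll_int hth; rewrite (eq_Rint leb1 (g := fun=> 0))//.
    by rewrite Rintegral_cst// mul0r => /eqP; rewrite eq_sym oner_eq0.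
  have omp := om0 _ yd0.
  apply: (@le_trans _ _ (\int[leb2]_y (om * (th (x.1 - y.1) * `|th^`()%classic (x.2 - y.2)|)))).
    apply: norm_Rint_le.
    + exact: integr_measurable (integrB i2 id).
    + exact: integrZ.
    move=> y.
    have -> : eta y * (th (x.1 - y.1) * th^`()%classic (x.2 - y.2)) -
        (p0 * (th (x.1 - y.1) * th^`()%classic (x.2 - y.2)) +
         (p1 * ((y.1 - x.1) * th (x.1 - y.1) * th^`()%classic (x.2 - y.2)) +
          p2 * (th (x.1 - y.1) * ((y.2 - x.2) * th^`()%classic (x.2 - y.2))))) =
      (eta y - (p0 + (p1 * (y.1 - x.1) + p2 * (y.2 - x.2)))) *
      (th (x.1 - y.1) * th^`()%classic (x.2 - y.2)) by ring.
    rewrite normrM.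
    have -> : th (x.1 - y.1) * `|th^`()%classic (x.2 - y.2)| =
      `|th (x.1 - y.1) * th^`()%classic (x.2 - y.2)|.
      by rewrite normrM (ger0_norm (th0 _)).
    have [yd|yd] := leP `|y - x| d; first by apply: ler_wpM2r => //; exact: h.
    by have [_ [_ ->]] := th_out yd; rewrite normr0 !mulr0.
  by rewrite (RintZ om ipn) ler_wpM2l// epn.
Qed.

End fixed_mollifier.
End mollification.

(** * Test functions with Lipschitz gradient *)

Section C11_functions.
Context {R : realType}.
Implicit Types (x y u : R * R) (psi : R * R -> R).

(** The constants are kept apart: the bound [L] on the gradient must be followed sharply through
    many compositions, while [M], which serves both the Lipschitz constant of the gradient and the
    Taylor remainder, only enters errors of second order in the time step. *)
Record C11 (psi g1 g2 : R * R -> R) (L M r : R) : Prop := MkC11 {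
  C11_grad : forall x, `|g1 x| <= L /\ `|g2 x| <= L;
  C11_grad_lip : forall x u,
    `|g1 (x + u) - g1 x| <= M * `|u| /\ `|g2 (x + u) - g2 x| <= M * `|u|;
  C11_taylor : forall x u,
    `|psi (x + u) - psi x - (g1 x * u.1 + g2 x * u.2)| <= M * `|u| ^+ 2;
  C11_supp : forall x, r < `|x| -> [/\ psi x = 0, g1 x = 0 & g2 x = 0] }.

(** Mean value theorem on the segment; two partial derivatives against the maximum norm give the
    factor 2. *)
Lemma lipschitz_of_gradient psi g1 g2 (L M : R) :
  (forall x, `|g1 x| <= L /\ `|g2 x| <= L) ->
  (forall x u, `|psi (x + u) - psi x - (g1 x * u.1 + g2 x * u.2)| <= M * `|u| ^+ 2) ->
  forall x u, `|psi (x + u) - psi x| <= 2 * L * `|u|.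
Proof.
move=> gL tay x u.
pose f (t : R) := psi (x + (t * u.1, t * u.2)).
pose f' (t : R) := g1 (x + (t * u.1, t * u.2)) * u.1 + g2 (x + (t * u.1, t * u.2)) * u.2.
have df t : is_derive t (1 : R) f (f' t).
  apply: (@is_derive_quadratic _ _ _ _ (M * `|u| ^+ 2) 1) => // h _.
  rewrite /f.
  have -> : x + ((t + h) * u.1, (t + h) * u.2) = x + (t * u.1, t * u.2) + (h * u.1, h * u.2).
    by rewrite -addrA; congr (_ + _); apply/pair_equal_spec; split => /=; ring.
  have := tay (x + (t * u.1, t * u.2)) (h * u.1, h * u.2).
  have -> : `|(h * u.1, h * u.2)| = `|h| * `|u|.
    by rewrite !plane_normE/= !normrM maxr_pMr.
  rewrite exprMn real_normK ?num_real// => H.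
  have -> : f' t * h = g1 (x + (t * u.1, t * u.2)) * (h * u.1) +
    g2 (x + (t * u.1, t * u.2)) * (h * u.2) by rewrite /f'; ring.
  by apply: le_trans H _; rewrite mulrCA mulrC.
have [c _] := mvt1 0 1 df; rewrite subr0 mulr1 /f !mul1r !mul0r.
have -> : x + (0, 0) = x by rewrite -[RHS]addr0.
have -> : (u.1, u.2) = u by case: (u).
move=> ->; rewrite /f'; apply: le_trans (ler_normD _ _) _; rewrite !normrM.
have [h1 h2] := gL (x + (c * u.1, c * u.2)).
have -> : 2 * L * `|u| = L * `|u| + L * `|u| by ring.
by apply: lerD; apply: ler_pM => //; [exact: plane_norm1|exact: plane_norm2].
Qed.

Lemma lipschitz_continuous psi (L : R) :
  (forall x u, `|psi (x + u) - psi x| <= L * `|u|) -> continuous psi.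
Proof.
move=> lip x; apply/cvgrPdist_le => e e0; near=> y.
have := lip x (y - x); rewrite [x + _]addrC subrK distrC => /le_trans; apply.
have L1 : 0 < `|L| + 1 by rewrite ltr_wpDl.
apply: (@le_trans _ _ ((`|L| + 1) * `|y - x|)).
  by rewrite ler_wpM2r// (le_trans (ler_norm _))// lerDl.
rewrite mulrC -ler_pdivlMr// distrC.
near: y; apply: cvgr_dist_le; first exact: cvg_id.
by rewrite divr_gt0.
Unshelve. all: by end_near. Qed.

Lemma lipschitz_measurable psi (L : R) :
  (forall x u, `|psi (x + u) - psi x| <= L * `|u|) ->
  measurable_fun setT (psi : plane -> R).
Proof. by move=> /lipschitz_continuous; exact: continuous_plane_measurable. Qed.

Lemma lipschitz_supp_bounded psi (L r : R) : 0 <= L ->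
  (forall x u, `|psi (x + u) - psi x| <= L * `|u|) ->
  (forall x, r < `|x| -> psi x = 0) -> forall x, `|psi x| <= L * (2 * `|r| + 1).
Proof.
move=> L0 lip sup x.
have [xr|xr] := leP `|x| r; last first.
  by rewrite sup// normr0 mulr_ge0// addr_ge0// mulr_ge0.
have r0 : 0 <= r by apply: le_trans xr.
pose y : R * R := (`|r| + 1, 0).
have yr : r < `|y|.
  apply: lt_le_trans (plane_norm1 y) => /=.
  by rewrite ger0_norm ?addr_ge0// (ger0_norm r0); lra.
have := lip x (y - x); rewrite [x + _]addrC subrK sup// sub0r normrN => h.
apply: le_trans h _; rewrite ler_wpM2l//.
apply: le_trans (ler_normB _ _) _.
have -> : `|y| = `|r| + 1.
  by rewrite plane_normE /y/= normr0 ger0_norm ?addr_ge0// max_l// addr_ge0.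
by move: xr; rewrite (ger0_norm r0); lra.
Qed.

Section C11_theory.
Variables (psi g1 g2 : R * R -> R) (L M r : R).
Hypothesis h : C11 psi g1 g2 L M r.

Lemma C11_lip x u : `|psi (x + u) - psi x| <= 2 * L * `|u|.
Proof. exact: lipschitz_of_gradient (C11_grad h) (C11_taylor h) x u. Qed.

Lemma C11_L0 : 0 <= L.
Proof. by have [g _] := C11_grad h 0; apply: le_trans g. Qed.

Lemma C11_M0 : 0 <= M.
Proof.
have [g _] := C11_grad_lip h 0 (1, 1).
have n1 : `|((1, 1) : R * R)| = 1 by rewrite plane_normE/= normr1 maxxx.
by move: g; rewrite n1 mulr1; exact: le_trans.
Qed.

Lemma C11_bounded : exists B, forall x, `|psi x| <= B.
Proof.
exists (2 * L * (2 * `|r| + 1)); apply: lipschitz_supp_bounded.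
- by rewrite mulr_ge0// C11_L0.
- exact: C11_lip.
- by move=> x /(C11_supp h)[].
Qed.

Lemma C11_measurable : [/\ measurable_fun setT (psi : plane -> R),
  measurable_fun setT (g1 : plane -> R) & measurable_fun setT (g2 : plane -> R)].
Proof.
split.
- exact: lipschitz_measurable C11_lip.
- by apply: (@lipschitz_measurable _ M) => x u; have [] := C11_grad_lip h x u.
- by apply: (@lipschitz_measurable _ M) => x u; have [] := C11_grad_lip h x u.
Qed.

Lemma C11_integrable : leb2.-integrable setT (EFin \o psi).
Proof.
have [B hB] := C11_bounded; have [m _ _] := C11_measurable.
by apply: bounded_supp_integrable2 m _ hB => x /(C11_supp h)[].
Qed.

Lemma C11_moll_close (C d : R) th : 0 <= d -> mollifier C d th -> forall x,
  `|mconv psi th th x - psi x| <= 2 * L * d /\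
  `|mconv psi th^`()%classic th x - g1 x| <= M * d ^+ 2 * (C / d) /\
  `|mconv psi th th^`()%classic x - g2 x| <= M * d ^+ 2 * (C / d).
Proof.
move=> d0 hth x; split.
  apply: (moll_close hth C11_integrable) => y yd.
  have := C11_lip x (y - x); rewrite [x + _]addrC subrK => /le_trans; apply.
  by rewrite ler_wpM2l// mulr_ge0// C11_L0.
apply: (moll_grad_close hth C11_integrable (p0 := psi x)) => y yd.
have := C11_taylor h x (y - x); rewrite [x + _]addrC subrK => t.
rewrite (_ : psi y - _ = psi y - psi x - (g1 x * (y - x).1 + g2 x * (y - x).2)).
  by apply: le_trans t _; rewrite ler_wpM2l ?C11_M0// lerXn2r ?nnegrE.
by rewrite opprD addrA.
Qed.

End C11_theory.

(** The gradient bound is L C whatever the width, so [L] survives the limit d -> 0 up to the factor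
    [C]. *)
Lemma lip_moll_grad psi (L r C d : R) th : 0 <= d -> 0 <= L -> mollifier C d th ->
  (forall x u, `|psi (x + u) - psi x| <= L * `|u|) ->
  (forall x, r < `|x| -> psi x = 0) -> forall x,
  `|mconv psi th th x - psi x| <= L * d /\
  `|mconv psi th^`()%classic th x| <= L * d * (C / d) /\
  `|mconv psi th th^`()%classic x| <= L * d * (C / d).
Proof.
move=> d0 L0 hth lip sup x.
have ip : leb2.-integrable setT (EFin \o psi).
  exact: bounded_supp_integrable2 (lipschitz_measurable lip) sup (lipschitz_supp_bounded L0 lip sup).
have hy y : `|y - x| <= d -> `|psi y - psi x| <= L * d.
  move=> yd; have := lip x (y - x); rewrite [x + _]addrC subrK => /le_trans; apply.
  exact: ler_wpM2l.
split; first exact: (moll_close hth ip).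
have := @moll_grad_close _ _ _ _ hth _ ip x (psi x) 0 0 (L * d).
rewrite !subr0; apply=> y yd.
by rewrite !mul0r !addr0; exact: hy.
Qed.

Lemma C11_le psi g1 g2 (L M r L' M' r' : R) : L <= L' -> M <= M' -> r <= r' ->
  C11 psi g1 g2 L M r -> C11 psi g1 g2 L' M' r'.
Proof.
move=> LL MM rr h; split.
- by move=> x; have [h1 h2] := C11_grad h x; split; apply: le_trans LL.
- move=> x u; have [h1 h2] := C11_grad_lip h x u.
  by have h3 := ler_wpM2r (normr_ge0 u) MM; split; apply: le_trans h3.
- move=> x u; apply: le_trans (C11_taylor h x u) _.
  by rewrite ler_wpM2r// sqr_ge0.
- by move=> x xr; apply: (C11_supp h); exact: le_lt_trans xr.
Qed.

(** [A] is chosen before [psi]: applied to the velocities at all times, it gives constants uniform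
    in time. *)
Lemma moll_C11 (C d : R) th : mollifier C d th -> exists2 A, 0 <= A &
  forall psi (r N : R), leb2.-integrable setT (EFin \o psi) ->
  (forall x, r < `|x| -> psi x = 0) -> \int[leb2]_y `|psi y| <= N ->
  C11 (mconv psi th th) (mconv psi th^`()%classic th) (mconv psi th th^`()%classic)
    (A * N) (A * N) (r + d).
Proof.
move=> hth.
have sth := moll_smooth hth; have [A hA] := moll_bounds hth.
have d0 := (smooth_deriven 0 sth).1; have d1 := (smooth_deriven 1 sth).1.
rewrite derive1n0 derive1n1 in d0; rewrite derive1n1 in d1.
have h0 s : `|th s| <= A by exact: (hA 0%N).
have h1 s : `|th^`()%classic s| <= A by have := hA 1%N s isT; rewrite derive1n1.
have h2 s : `|th^`(2)%classic s| <= A by exact: (hA 2%N).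
have m0 := smooth_measurable sth.
have m1 := smooth_measurable (smooth_derive sth).2.
have A0 : 0 <= A by apply: le_trans (h0 0).
have A2 : 0 <= A ^+ 2 by exact: sqr_ge0.
exists (3 * A ^+ 2); first by rewrite mulr_ge0.
move=> psi r N' ip sup NN'.
apply: (@C11_le _ _ _ (A ^+ 2 * N') (3 * A ^+ 2 * N') (r + d)) => //.
  have N'0 : 0 <= N' by apply: le_trans NN'; exact: Rint_ge0.
  by apply: ler_wpM2r => //; lra.
set N := \int[leb2]_y `|psi y| in NN'.
have N0 : 0 <= N by exact: Rint_ge0.
have AN : 0 <= A ^+ 2 * N by rewrite mulr_ge0.
apply: (@C11_le _ _ _ (A ^+ 2 * N) (3 * A ^+ 2 * N) (r + d)) => //.
- exact: ler_wpM2l.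
- by apply: ler_wpM2l => //; rewrite mulr_ge0.
split.
- by move=> x; split; apply: mconv_bound.
- move=> x u; have le23 : 2 * A ^+ 2 * N * `|u| <= 3 * A ^+ 2 * N * `|u|.
    by rewrite ler_wpM2r//; lra.
  split; apply: le_trans le23.
    exact: (mconv_lip ip d1 d0 h1 h2 h0 h1 m1 m0).
  exact: (mconv_lip ip d0 d1 h0 h1 h1 h2 m0 m1).
- move=> x u; exact: (mconv_taylor ip d0 d1 d0 d1 h0 h1 h2 h0 h1 h2 m0 m1 m0 m1).
- move=> x xr.
  have e (a b : R -> R) : (forall y, d < `|y - x| -> a (x.1 - y.1) * b (x.2 - y.2) = 0) ->
      mconv psi a b x = 0.
    move=> z; rewrite /mconv (eq_Rint leb2 (g := fun=> 0)) ?Rintegral_cst ?mul0r// => y.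
    have [yd|yd] := leP `|y - x| d; last by rewrite z// mulr0.
    rewrite sup ?mul0r//; have := ler_normD (x - y) y; rewrite subrK distrC.
    by lra.
  by split; apply: e => y yd; have [e0 [e1 e2]] := th_out hth yd.
Qed.

End C11_functions.

(** Spares formulas for higher derivatives: it suffices to exhibit a class stable under directional
    derivatives, here [tensor_span]. *)
Lemma Ck_closed (R : realType) (V : normedModType R) (P : (V -> R) -> Prop) :
  (forall f, P f -> (forall z, differentiable f z) /\ forall v, P ('D_v f)) ->
  forall k f, P f -> Ck k f.
Proof.
move=> h; elim=> [|k ih] f Pf /=.
  by move=> z; apply: differentiable_continuous; exact: (h f Pf).1.
by have [d D] := h f Pf; split=> // v; exact: ih.
Qed.

(** * Smooth test functions: convolutions in space times cutoffs in time *)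

Section test_functions.
Context {R : realType}.
Implicit Types (x y u : R * R).
Variables (eta : R * R -> R) (r d : R) (th chi : R -> R) (rc : R).
Hypotheses (ieta : leb2.-integrable setT (EFin \o eta))
  (eta0 : forall x, r < `|x| -> eta x = 0)
  (sth : smooth th) (supth : supp_in d th)
  (schi : smooth chi) (supchi : supp_in rc chi).

Lemma smooth_deriven_bounded (f : R -> R) (s : R) n : smooth f -> supp_in s f ->
  supp_in s f^`(n)%classic /\ exists A : R, forall t, `|f^`(n)%classic t| <= A.
Proof.
move=> sf sup; have sup' : supp_in s f^`(n)%classic.
  elim: n => [|n ih]; first by rewrite derive1n0.
  by rewrite derive1nS; apply: supp_in_derive ih; have [] := smooth_deriven n sf.
by split=> //; have [A _ h] := smooth_bounded (smooth_deriven n sf).2 sup'; exists A.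
Qed.

Definition tensor3 i j k (z : R * R * R) : R :=
  mconv eta th^`(i)%classic th^`(j)%classic z.1 * chi^`(k)%classic z.2.

Lemma tensor3_diff i j k z : differentiable (tensor3 i j k) z /\
  forall v, 'D_v (tensor3 i j k) z =
    tensor3 i.+1 j k z * v.1.1 + tensor3 i j.+1 k z * v.1.2 + tensor3 i j k.+1 z * v.2.
Proof.
have [A [i0 [i1 [i2 [j0 [j1 [j2 [k0 [k1 k2]]]]]]]]] : exists A : R,
    (forall t, `|th^`(i)%classic t| <= A) /\ (forall t, `|th^`(i.+1)%classic t| <= A) /\
    (forall t, `|th^`(i.+2)%classic t| <= A) /\ (forall t, `|th^`(j)%classic t| <= A) /\
    (forall t, `|th^`(j.+1)%classic t| <= A) /\ (forall t, `|th^`(j.+2)%classic t| <= A) /\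
    (forall t, `|chi^`(k)%classic t| <= A) /\ (forall t, `|chi^`(k.+1)%classic t| <= A) /\
    (forall t, `|chi^`(k.+2)%classic t| <= A).
  have b n := (smooth_deriven_bounded n sth supth).2.
  have c n := (smooth_deriven_bounded n schi supchi).2.
  have [A1 a1] := b i; have [A2 a2] := b i.+1; have [A3 a3] := b i.+2.
  have [A4 a4] := b j; have [A5 a5] := b j.+1; have [A6 a6] := b j.+2.
  have [A7 a7] := c k; have [A8 a8] := c k.+1; have [A9 a9] := c k.+2.
  have p1 := le_trans (normr_ge0 _) (a1 0); have p2 := le_trans (normr_ge0 _) (a2 0).
  have p3 := le_trans (normr_ge0 _) (a3 0); have p4 := le_trans (normr_ge0 _) (a4 0).
  have p5 := le_trans (normr_ge0 _) (a5 0); have p6 := le_trans (normr_ge0 _) (a6 0).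
  have p7 := le_trans (normr_ge0 _) (a7 0); have p8 := le_trans (normr_ge0 _) (a8 0).
  have p9 := le_trans (normr_ge0 _) (a9 0).
  exists (A1 + A2 + A3 + A4 + A5 + A6 + A7 + A8 + A9).
  split; [|split; [|split; [|split; [|split; [|split; [|split; [|split]]]]]]] => t.
  - by apply: le_trans (a1 t) _; lra.
  - by apply: le_trans (a2 t) _; lra.
  - by apply: le_trans (a3 t) _; lra.
  - by apply: le_trans (a4 t) _; lra.
  - by apply: le_trans (a5 t) _; lra.
  - by apply: le_trans (a6 t) _; lra.
  - by apply: le_trans (a7 t) _; lra.
  - by apply: le_trans (a8 t) _; lra.
  - by apply: le_trans (a9 t) _; lra.
have di n := (smooth_deriven n sth).1; have dk n := (smooth_deriven n schi).1.
have m n := smooth_measurable (smooth_deriven n sth).2.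
set N := \int[leb2]_y `|eta y|.
have N0 : 0 <= N by exact: Rint_ge0.
have A0 : 0 <= A by apply: le_trans (k0 0).
set P := mconv eta th^`(i)%classic th^`(j)%classic.
pose P1 := mconv eta th^`(i.+1)%classic th^`(j)%classic.
pose P2 := mconv eta th^`(i)%classic th^`(j.+1)%classic.
have hT x u : `|P (x + u) - P x - (P1 x * u.1 + P2 x * u.2)| <= 3 * A ^+ 2 * N * `|u| ^+ 2.
  exact: (mconv_taylor ieta (di i) (di i.+1) (di j) (di j.+1) i0 i1 i2 j0 j1 j2 (m i) (m i.+1) (m j) (m j.+1)).
have hL x u : `|P (x + u) - P x| <= 2 * A ^+ 2 * N * `|u|.
  exact: (mconv_lip ieta (di i) (di j) i0 i1 j0 j1 (m i) (m j)).
have hB x : `|P x| <= A ^+ 2 * N by exact: (mconv_bound ieta i0 j0 (m i) (m j)).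
have cT t h := taylor1 t h (dk k) (fun s t => lip1 s t (dk k.+1) k2).
have cL t h : `|chi^`(k)%classic (t + h) - chi^`(k)%classic t| <= A * `|h|.
  by have := lip1 t (t + h) (dk k) k1; rewrite addrAC subrr add0r.
apply: (quadratic_differentiable (C := 6 * A ^+ 3 * N)) => u.
have un1 : `|u.1| <= `|u| by rewrite [leRHS]prod_normE le_max lexx.
have un2 : `|u.2| <= `|u| by rewrite [leRHS]prod_normE le_max lexx orbT.
have u12 : `|u.1| ^+ 2 <= `|u| ^+ 2 by rewrite lerXn2r// nnegrE.
have u22 : u.2 ^+ 2 <= `|u| ^+ 2.
  by rewrite -[u.2 ^+ 2]real_normK ?num_real// lerXn2r// nnegrE.
rewrite /tensor3 -/P -/P1 -/P2.
have {}hT := hT z.1 u.1; have {}hL := hL z.1 u.1; have {}hB := hB z.1.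
have {}cT := cT z.2 u.2; have {}cL := cL z.2 u.2; have {}k0 := k0 z.2.
change (z + u).1 with (z.1 + u.1); change (z + u).2 with (z.2 + u.2).
move: hT hL hB cT cL k0.
move: (P (z.1 + u.1)) (P z.1) (P1 z.1) (P2 z.1) (chi^`(k)%classic (z.2 + u.2))
  (chi^`(k)%classic z.2) (chi^`(k.+1)%classic z.2).
move=> p' p p1 p2 c' c c1 hT hL hB cT cL k0.
have -> : p' * c' - p * c - (p1 * c * u.1.1 + p2 * c * u.1.2 + p * c1 * u.2) =
  (p' - p) * (c' - c) + ((p' - p - (p1 * u.1.1 + p2 * u.1.2)) * c + p * (c' - c - c1 * u.2)).
  by ring.
have -> : 6 * A ^+ 3 * N * `|u| ^+ 2 = (2 * A ^+ 2 * N * `|u|) * (A * `|u|) +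
   ((3 * A ^+ 2 * N * `|u| ^+ 2) * A + (A ^+ 2 * N) * (A * `|u| ^+ 2)) by ring.
have A2N : 0 <= A ^+ 2 * N by rewrite mulr_ge0// sqr_ge0.
apply: le_trans (ler_normD _ _) _; rewrite normrM; apply: lerD.
  apply: ler_pM => //.
    by apply: le_trans hL _; apply: ler_wpM2l => //; lra.
  by apply: le_trans cL _; exact: ler_wpM2l.
apply: le_trans (ler_normD _ _) _; rewrite !normrM; apply: lerD.
  apply: ler_pM => //.
  by apply: le_trans hT _; apply: ler_wpM2l => //; lra.
apply: ler_pM => //.
by apply: le_trans cT _; exact: ler_wpM2l.
Qed.

(** A directional derivative of a tensor combines three tensors, so the linear span is stable under
    derivation. *)
Inductive tensor_span : (R * R * R -> R) -> Prop :=
| span_tensor i j k : tensor_span (tensor3 i j k)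
| span_lin (a b : R) f g : tensor_span f -> tensor_span g ->
    tensor_span (fun z => a * f z + b * g z).

Lemma tensor_span_derive f : tensor_span f ->
  (forall z, differentiable f z) /\ forall v, tensor_span ('D_v f).
Proof.
elim=> {f} [i j k|a b f g sf [df Df] sg [dg Dg]].
  split=> [z|v]; first exact: (tensor3_diff i j k z).1.
  have -> : 'D_v (tensor3 i j k) = fun z =>
      v.1.1 * tensor3 i.+1 j k z + 1 * (v.1.2 * tensor3 i j.+1 k z + v.2 * tensor3 i j k.+1 z).
    by apply/funext => z; rewrite (tensor3_diff i j k z).2; ring.
  by apply: span_lin; [|apply: span_lin]; exact: span_tensor.
have e : (fun z => a * f z + b * g z) = (a *: f + b *: g) by apply/funext.
split=> [z|v].
  by rewrite e; apply: differentiableD; exact: differentiableZ.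
have -> : 'D_v (fun z => a * f z + b * g z) = fun z => a * 'D_v f z + b * 'D_v g z.
  apply/funext => z; rewrite e.
  have dfz : derivable f z v by exact/diff_derivable.
  have dgz : derivable g z v by exact/diff_derivable.
  rewrite deriveD; [|exact: derivableZ|exact: derivableZ].
  by rewrite !deriveZ.
exact: span_lin.
Qed.

Lemma mconv_supp (a b : R -> R) x : supp_in d a -> supp_in d b -> r + d < `|x| ->
  mconv eta a b x = 0.
Proof.
move=> sa sb xr.
rewrite /mconv (eq_Rint leb2 (g := fun=> 0)) ?Rintegral_cst ?mul0r// => y.
have [yr|yr] := leP `|y| r; last by rewrite eta0// mul0r.
have h : d < `|x - y| by have := ler_normD (x - y) y; rewrite subrK; lra.
move: h; rewrite ltNge plane_norm_le negb_and -!ltNge => /orP[] h.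
  by rewrite [a _]sa// mul0r mulr0.
by rewrite [b _]sb// !mulr0.
Qed.

Lemma test_function_tensor : test_function (fun z => mconv eta th th z.1 * chi z.2).
Proof.
have e : (fun z => mconv eta th th z.1 * chi z.2) = tensor3 0 0 0.
  by apply/funext => z; rewrite /tensor3 !derive1n0.
split; first by move=> k; rewrite e; apply: (Ck_closed tensor_span_derive); exact: span_tensor.
pose I (s : R) := [set t : R | -s <= t <= s].
have cI s : compact (I s).
  rewrite (_ : I s = [set` `[-s, s]%R]); first exact: segment_compact.
  by apply/seteqP; split => t /=; rewrite in_itv.
have cB := compact_setX (compact_setX (cI (r + d)) (cI (r + d))) (cI rc).
apply: (@subclosed_compact _ _ _ (@closed_closure _ _) cB).
have clB := compact_closed (@norm_hausdorff R _) cB.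
rewrite [X in _ `<=` X](closure_id _).1//.
apply: closure_subset => -[x t] /= /eqP h.
have xr : `|x| <= r + d.
  by rewrite leNgt; apply/negP => xr; apply: h; rewrite mconv_supp ?mul0r.
have tr : `|t| <= rc.
  by rewrite leNgt; apply/negP => tr; apply: h; rewrite supchi ?mulr0.
by move: xr; rewrite plane_norm_le => /andP[x1 x2]; split=> //; [split|]; rewrite /I/= -ler_norml.
Qed.

Lemma tensor_derivatives x (t : R) :
  [/\ dt (fun z => mconv eta th th z.1 * chi z.2) x t = mconv eta th th x * chi^`()%classic t,
      dx1 (fun z => mconv eta th th z.1 * chi z.2) x t = mconv eta th^`()%classic th x * chi t &
      dx2 (fun z => mconv eta th th z.1 * chi z.2) x t = mconv eta th th^`()%classic x * chi t].
Proof.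
have e : (fun z => mconv eta th th z.1 * chi z.2) = tensor3 0 0 0.
  by apply/funext => z; rewrite /tensor3 !derive1n0.
by split; rewrite /dt /dx1 /dx2 e (tensor3_diff 0 0 0 _).2 /tensor3 /= ?derive1n0 ?derive1n1; ring.
Qed.

End test_functions.

(** * The weak formulation *)

Section weak_flows.
Context {R : realType}.
Implicit Types (x y u : R * R) (g psi : R * R -> R) (w : R -> R * R -> R).

(** One constant for the weighted L^1 and L^oo norms of order 2, in the shape required by the
    singular integrals, whose density is the weighted |g|. *)
Definition controlled g (V : R) := [/\ measurable_fun setT (g : plane -> R),
  leb2.-integrable setT (EFin \o (fun y => sqweight y * `|g y|)),
  \int[leb2]_y (sqweight y * `|g y|) <= V &
  {ae leb2, forall y, sqweight y * `|g y| <= V}].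

Lemma controlled_integrable g V : controlled g V ->
  leb2.-integrable setT (EFin \o g) /\ \int[leb2]_y `|g y| <= V.
Proof.
move=> [mg iv vV _].
have h y : `|g y| <= sqweight y * `|g y| by rewrite ler_peMl// sqweight_ge1.
have ig : leb2.-integrable setT (EFin \o g) by exact: integr_le iv _.
split=> //; apply: le_trans vV; apply: (@le_Rint _ _ R leb2) => //.
exact: integr_norm.
Qed.

Lemma controlled_ge0 g V : controlled g V -> 0 <= V.
Proof. by move=> /controlled_integrable[_]; apply: le_trans; exact: Rint_ge0. Qed.

Lemma controlled0 V : 0 <= V -> controlled (fun=> 0) V.
Proof.
move=> V0; have e : (fun y : R * R => sqweight y * `|0 : R|) = fun=> 0.
  by apply/funext => y; rewrite normr0 mulr0.
split; rewrite ?e//.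
- exact: integrable0.
- by rewrite Rintegral_cst// mul0r.
- by apply: aeW => y; rewrite normr0 mulr0.
Qed.

Lemma controlled_wnorm g V : measurable_fun setT (g : plane -> R) ->
  (wnorm 1 2 g <= V%:E)%E -> (wnorm +oo 2 g <= V%:E)%E -> controlled g V.
Proof.
move=> mg h1 hoo.
have e y : `|japanese y ^+ 2 * g y| = sqweight y * `|g y|.
  by rewrite japanese_sqr normrM ger0_norm// ltW// sqweight_gt0.
have mv : measurable_fun setT ((fun y => sqweight y * `|g y|) : plane -> R).
  by apply: measurable_funM; [exact: measurable_sqweight|exact: measurableT_comp].
have v0 y : 0 <= sqweight y * `|g y| by rewrite mulr_ge0// ltW// sqweight_gt0.
have [iv vV] : leb2.-integrable setT (EFin \o (fun y => sqweight y * `|g y|)) /\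
    \int[leb2]_y (sqweight y * `|g y|) <= V.
  apply: integr_fin => //; move: h1; rewrite /wnorm Lnorm1.
  by under eq_integral do rewrite abse_EFin e.
(* The norm at +oo is an essential supremum only on a space of positive measure, which a box
   certifies. *)
split=> //; move: hoo; rewrite /wnorm unlock ifT; last first.
  apply: (@lt_le_trans _ _ (leb2 (box (0 : R * R) 1))).
    by rewrite leb2_box// expr1n mulr1 lte_fin.
  by apply: le_measure => //; rewrite inE; [exact: measurable_box|exact: measurableT].
move=> /ess_supP; apply: filterS => y /=.
by rewrite lee_fin e.
Qed.

(** A solution on [0, T] extended to all times under one bound [V], so that measurability and bounds
    carry no restriction on time. *)
Record weak_flow (T V : R) w : Prop := WeakFlow {
  flow_measurable : measurable_fun setT
    (fun z : measurableTypeR R * plane => w z.1 z.2);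
  flow_controlled : forall s, controlled (w s) V;
  flow_weak : forall (t : R) (phi : R * R * R -> R), 0 <= t <= T -> test_function phi ->
    \int[leb2]_x (w t x * phi (x, t)) - \int[leb2]_x (w 0 x * phi (x, 0)) =
    \int[leb1]_(s in `[0, t]) \int[leb2]_x (w s x *
      (dt phi x s + ((H (w s) x).1 * dx1 phi x s + (H (w s) x).2 * dx2 phi x s))) }.

Lemma weak_flow_of_solution (w0 : R * R -> R) w (T : R) : 0 <= T -> helical_euler_solution 2 w0 w ->
  exists w' V, weak_flow T V w' /\ forall t, 0 <= t <= T -> w' t = w t.
Proof.
move=> T0 [mw Lw bw _ weak].
have [V hV] := bw T.
pose I : set R := [set` `[0, T]%R].
pose D : set (measurableTypeR R * @plane R) := I `*` setT.
(* Extension by zero, since the common bound is known for times in [0, T] only. *)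
pose w' s := if 0 <= s <= T then w s else fun=> 0.
have mI : measurable (I : set (measurableTypeR R)) by exact: measurable_itv.
have mD : measurable D by exact: measurableX.
have V0 : 0 <= V.
  have h0 : (0 : R) <= 0 <= T by apply/andP.
  by have [h _] := hV 0 h0; rewrite -lee_fin; apply: le_trans h; exact: Lnorm_ge0.
exists w', V; split; last by move=> t h; rewrite /w' h.
split.
- rewrite (_ : (fun z => _) = (fun z : measurableTypeR R * @plane R => w z.1 z.2) \_ D).
    apply: (measurable_restrictT _ mD).1.
    refine (@measurable_funS _ _ _ _ _ _ _ _ _ mw).
      by apply: measurableX => //; exact: measurable_itv.
    by move=> z [/= + _]; rewrite /I/= in_itv/= => /andP[z0 _]; split=> //=; rewrite in_itv/= z0.
  apply/funext => z; rewrite /w' patchE; have [h|h] := boolP (z \in D).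
    by move: h; rewrite inE => -[/= + _]; rewrite /I/= in_itv/= => ->.
  by rewrite ifF//; apply/negbTE; apply: contra h => h; rewrite inE; split=> //=; rewrite /I/= in_itv.
- move=> s; rewrite /w'; case: ifPn => h; last exact: controlled0.
  have /andP[s0 _] := h; have [[mws _] _] := Lw s s0.
  by have [h1 h2] := hV s h; exact: controlled_wnorm.
move=> t phi /andP[t0 tT] hphi.
rewrite {1 2}/w' t0 tT lexx T0 /=; rewrite (weak t phi t0 hphi).
apply: eq_Rintegral => s; rewrite inE/= in_itv/= => /andP[s0 st].
by rewrite /w' s0 (le_trans st tT).
Qed.

Lemma Rint_itv (a b : R) (f : R -> R) :
  \int[leb1]_(s in `[a, b]) f s = \int[leb1]_s (\1_([set` `[a, b]%R]) s * f s).
Proof.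
rewrite Rintegral_mkcond; apply: eq_Rint => s.
rewrite patchE indicE; case: ifPn => /=; rewrite ?mul1r ?mul0r//.
Qed.

Lemma eq_of_le_small (X Y C : R) : (forall d, 0 < d -> d <= 1 -> `|X - Y| <= C * d) -> X = Y.
Proof.
move=> h; apply/eqP; rewrite -subr_eq0 -normr_le0 leNgt; apply/negP => h0.
have C1 : 0 < `|C| + 1 by rewrite ltr_wpDl.
pose d := Num.min 1 (`|X - Y| / (`|C| + 1) / 2).
have d0 : 0 < d by rewrite lt_min ltr01 !divr_gt0.
have d1 : d <= 1 by rewrite ge_min lexx.
have := h d d0 d1; rewrite leNgt => /negP; apply.
have d2 : (`|C| + 1) * d <= `|X - Y| / 2.
  have : d <= `|X - Y| / (`|C| + 1) / 2 by rewrite ge_min lexx orbT.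
  rewrite -(ler_pM2l C1); congr (_ <= _); field; exact: lt0r_neq0.
apply: le_lt_trans (_ : (`|C| + 1) * d < _).
  by rewrite ler_wpM2r ?(ltW d0)// (le_trans (ler_norm _))// lerDl.
by apply: le_lt_trans d2 _; lra.
Qed.

End weak_flows.

Section weak_form.
Context {R : realType}.
Implicit Types (x y u : R * R) (g psi : R * R -> R) (w : R -> R * R -> R).

Lemma indic_bounded_integrable (I : set (measurableTypeR R)) (f : R -> R) (C : R) :
  measurable I -> (leb1 I < +oo)%E -> measurable_fun setT (f : measurableTypeR R -> R) ->
  (forall s, `|f s| <= C) ->
  leb1.-integrable setT (EFin \o (fun s => \1_I s * f s)) /\
  `|\int[leb1]_s (\1_I s * f s)| <= C * fine (leb1 I).
Proof.
move=> mI fI mf fC.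
have iI := integr_indic (mu := leb1) mI fI (R := R).
have m : measurable_fun setT (fun s : measurableTypeR R => \1_I s * f s).
  by apply: measurable_funM => //; exact: measurable_indic.
have h s : `|\1_I s * f s| <= C * \1_I s.
  have h0 : 0 <= \1_I s :> R by rewrite indicE ler0n.
  by rewrite normrM (ger0_norm h0) mulrC ler_wpM2r.
have iC := integrZ C iI.
split; first exact: integr_le m iC h.
have := norm_Rint_le m iC h; rewrite (RintZ C iI).
by rewrite Rint_indic.
Qed.

Lemma drift_bound g V (b1 b2 q1 q2 : R * R -> R) (be r B : R) : controlled g V ->
  measurable_fun setT (b1 : plane -> R) -> measurable_fun setT (b2 : plane -> R) ->
  measurable_fun setT (q1 : plane -> R) -> measurable_fun setT (q2 : plane -> R) ->
  (forall x, r < `|x| -> q1 x = 0 /\ q2 x = 0) ->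
  (forall x, `|x| <= r -> `|b1 x| <= be /\ `|b2 x| <= be) ->
  (forall x, `|q1 x| <= B /\ `|q2 x| <= B) -> 0 <= be ->
  leb2.-integrable setT (EFin \o (fun x => g x * (b1 x * q1 x + b2 x * q2 x))) /\
  `|\int[leb2]_x (g x * (b1 x * q1 x + b2 x * q2 x))| <= 2 * be * B * V.
Proof.
move=> cg mb1 mb2 mq1 mq2 q0 bb qB be0.
have [ig gV] := controlled_integrable cg.
have B0 : 0 <= B by have [h _] := qB 0; apply: le_trans h.
have m : measurable_fun setT ((fun x => g x * (b1 x * q1 x + b2 x * q2 x)) : plane -> R).
  apply: measurable_funM; first exact: integr_measurable ig.
  by apply: measurable_funD; apply: measurable_funM.
have ib := integrZ (2 * be * B) (integr_norm ig).
have h x : `|g x * (b1 x * q1 x + b2 x * q2 x)| <= 2 * be * B * `|g x|.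
  rewrite normrM mulrC ler_wpM2r//.
  have [xr|xr] := leP `|x| r; last first.
    have [-> ->] := q0 x xr.
    by rewrite !mulr0 addr0 normr0 mulr_ge0// mulr_ge0.
  have [h1 h2] := bb x xr; have [h3 h4] := qB x.
  apply: le_trans (ler_normD _ _) _; rewrite !normrM.
  have -> : 2 * be * B = be * B + be * B by ring.
  by apply: lerD; apply: ler_pM.
split; first exact: integr_le m ib h.
apply: le_trans (norm_Rint_le m ib h) _.
rewrite (RintZ _ (integr_norm ig)) ler_wpM2l// mulr_ge0// mulr_ge0//.
Qed.

Variables (T V : R) (w : R -> R * R -> R).
Hypothesis hw : weak_flow T V w.

(** Arbitrary fields are allowed in place of a compactly supported gradient: the limit case is the
    field x itself, whose drift is the integral in [angular_cancellation]. *)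
Definition drift (q1 q2 : R * R -> R) (s : R) : R :=
  \int[leb2]_x (w s x * ((H (w s) x).1 * q1 x + (H (w s) x).2 * q2 x)).

Lemma flow_V0 : 0 <= V.
Proof. exact: controlled_ge0 (flow_controlled hw 0). Qed.

Lemma flow_H_le s x (r : R) : `|x| <= r ->
  `|(H (w s) x).1| <= 34 * V * (1 + r) /\ `|(H (w s) x).2| <= 34 * V * (1 + r).
Proof.
move=> xr; have [mg iv vV1 vVoo] := flow_controlled hw s.
have [h1 h2] := H_le mg iv vV1 vVoo x.
have h : 34 * V * (1 + `|x|) <= 34 * V * (1 + r).
  by apply: ler_wpM2l; [have := flow_V0; lra|rewrite lerD2l].
by split; [exact: le_trans h1 h|exact: le_trans h2 h].
Qed.

Lemma flow_measurable_H :
  measurable_fun setT (fun z : (measurableTypeR R * @plane R)%type => (H (w z.1) z.2).1) /\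
  measurable_fun setT (fun z : (measurableTypeR R * @plane R)%type => (H (w z.1) z.2).2).
Proof. exact: measurable_H (flow_measurable hw). Qed.

Lemma flow_measurable_Hs s :
  measurable_fun setT ((fun x => (H (w s) x).1) : plane -> R) /\
  measurable_fun setT ((fun x => (H (w s) x).2) : plane -> R).
Proof.
have [h1 h2] := flow_measurable_H.
by split; [exact: (measurable_fun_pair2 (s : measurableTypeR R) h1)|
           exact: (measurable_fun_pair2 (s : measurableTypeR R) h2)].
Qed.

Lemma drift_le (q1 q2 : R * R -> R) (r B : R) : 0 <= r ->
  measurable_fun setT (q1 : plane -> R) -> measurable_fun setT (q2 : plane -> R) ->
  (forall x, r < `|x| -> q1 x = 0 /\ q2 x = 0) ->
  (forall x, `|q1 x| <= B /\ `|q2 x| <= B) -> forall s,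
  leb2.-integrable setT (EFin \o (fun x =>
    w s x * ((H (w s) x).1 * q1 x + (H (w s) x).2 * q2 x))) /\
  `|drift q1 q2 s| <= 2 * (34 * V * (1 + r)) * B * V.
Proof.
move=> r0 mq1 mq2 q0 qB s.
have [m1 m2] := flow_measurable_Hs s.
apply: (drift_bound (flow_controlled hw s) m1 m2 mq1 mq2 q0 _ qB).
  by move=> x; exact: flow_H_le.
by rewrite mulr_ge0// ?mulr_ge0// ?flow_V0// addr_ge0.
Qed.

Lemma measurable_drift (q1 q2 : R * R -> R) :
  measurable_fun setT (q1 : plane -> R) -> measurable_fun setT (q2 : plane -> R) ->
  measurable_fun setT (drift q1 q2 : measurableTypeR R -> R).
Proof.
move=> mq1 mq2; have [m1 m2] := flow_measurable_H.
apply: (@measurable_Rint2 R _ (measurableTypeR R)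
  (fun s x => w s x * ((H (w s) x).1 * q1 x + (H (w s) x).2 * q2 x))).
apply: measurable_funM; first exact: flow_measurable hw.
apply: measurable_funD; apply: measurable_funM => //; apply: (measurableT_comp (f := _ : plane -> R)) => //;
  exact: measurable_snd.
Qed.

Lemma drift_diff_le (q1 q2 p1 p2 : R * R -> R) (r B : R) : 0 <= r ->
  measurable_fun setT (q1 : plane -> R) -> measurable_fun setT (q2 : plane -> R) ->
  measurable_fun setT (p1 : plane -> R) -> measurable_fun setT (p2 : plane -> R) ->
  (forall x, r < `|x| -> [/\ q1 x = 0, q2 x = 0, p1 x = 0 & p2 x = 0]) ->
  (exists A, forall x, `|q1 x| <= A /\ `|q2 x| <= A) ->
  (forall x, `|q1 x - p1 x| <= B /\ `|q2 x - p2 x| <= B) ->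
  forall s, `|drift q1 q2 s - drift p1 p2 s| <= 2 * (34 * V * (1 + r)) * B * V.
Proof.
move=> r0 mq1 mq2 mp1 mp2 z [A hA] hB s.
have zq x : r < `|x| -> q1 x = 0 /\ q2 x = 0 by move=> /z[].
have zp x : r < `|x| -> p1 x = 0 /\ p2 x = 0 by move=> /z[].
have hAp x : `|p1 x| <= A + B /\ `|p2 x| <= A + B.
  have [a1 a2] := hA x; have [b1 b2] := hB x.
  split.
    have := ler_normB (q1 x) (q1 x - p1 x); rewrite opprB addrC subrK => h.
    by apply: le_trans h _; exact: lerD.
  have := ler_normB (q2 x) (q2 x - p2 x); rewrite opprB addrC subrK => h.
  by apply: le_trans h _; exact: lerD.
have [iq _] := drift_le r0 mq1 mq2 zq hA s.
have [ip _] := drift_le r0 mp1 mp2 zp hAp s.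
have zd x : r < `|x| -> (fun x => q1 x - p1 x) x = 0 /\ (fun x => q2 x - p2 x) x = 0.
  by move=> /z[/= -> -> -> ->]; rewrite subrr.
have [_] := drift_le r0 (measurable_funB mq1 mp1) (measurable_funB mq2 mp2) zd hB s.
rewrite /drift -(RintB iq ip).
congr (`|_| <= _); apply: eq_Rint => x /=.
move: (w s x) (H (w s) x).1 (H (w s) x).2 (q1 x) (q2 x) (p1 x) (p2 x) => *; ring.
Qed.

End weak_form.

Section weak_form_C11.
Context {R : realType}.
Implicit Types (x y u : R * R) (g psi : R * R -> R).

Lemma plateau_derive0 (T t : R) : 0 <= t <= T -> (plateau T)^`()%classic t = 0.
Proof.
move=> /andP[t0 tT]; apply: derive1_unique.
apply: (@is_derive_quadratic _ _ _ _ 0 1) => // h h1.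
have := ler_norm h; have := ler_norm (- h); rewrite normrN => h2 h3.
by rewrite !plateau1 ?subrr ?mul0r ?subr0 ?normr0//; lra.
Qed.

Lemma supp_in_plateau (T : R) : supp_in (`|T| + 2) (plateau T).
Proof.
move=> t ht; apply: plateau0; apply/orP; have := ler_norm T; have := normr_ge0 T.
by have [t0|t0] := leP 0 t; [rewrite (ger0_norm t0) in ht; left|rewrite (ltr0_norm t0) in ht; right]; lra.
Qed.

Lemma Rint_close g V (psi psi' : R * R -> R) (e : R) : controlled g V ->
  measurable_fun setT (psi : plane -> R) -> measurable_fun setT (psi' : plane -> R) ->
  (exists B, forall x, `|psi x| <= B) -> (forall x, `|psi' x - psi x| <= e) ->
  `|\int[leb2]_x (g x * psi x) - \int[leb2]_x (g x * psi' x)| <= e * V.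
Proof.
move=> cg m m' [B hB] he.
have [ig gV] := controlled_integrable cg.
have e0 : 0 <= e by apply: le_trans (he 0).
have hB' x : `|psi' x| <= B + e.
  have := ler_normD (psi x) (psi' x - psi x); rewrite [X in `|X| <= _]addrC subrK => h.
  by apply: le_trans h _; exact: lerD.
have i1 := integrM m ig hB; have i2 := integrM m' ig hB'.
rewrite -(RintB i1 i2).
have ie := integrZ e (integr_norm ig).
apply: le_trans (norm_Rint_le (integr_measurable (integrB i1 i2)) ie _) _.
  move=> x; have -> : g x * psi x - g x * psi' x = - (psi' x - psi x) * g x by ring.
  by rewrite normrM normrN ler_wpM2r.
by rewrite (RintZ e (integr_norm ig)) ler_wpM2l.
Qed.

Variables (T V : R) (w : R -> R * R -> R).
Hypothesis hw : weak_flow T V w.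

Lemma time_integral_le (a b : R) (f : R -> R) (C : R) : a <= b ->
  measurable_fun setT (f : measurableTypeR R -> R) -> (forall s, `|f s| <= C) ->
  leb1.-integrable setT (EFin \o (fun s => \1_([set` `[a, b]%R]) s * f s)) /\
  `|\int[leb1]_s (\1_([set` `[a, b]%R]) s * f s)| <= C * (b - a).
Proof.
move=> ab mf fC; pose I : set R := [set` `[a, b]%R].
have lI : leb1 (I : set (measurableTypeR R)) = (b - a)%:E.
  have : @lebesgue_measure R I = (b - a)%:E.
    rewrite /I lebesgue_measure_itv/= lte_fin; case: ltP => // ba.
    by have -> : a = b; [exact/le_anti/andP|rewrite subrr].
  by [].
have mI : measurable (I : set (measurableTypeR R)) by exact: measurable_itv.
have := @indic_bounded_integrable R I f C mI _ mf fC.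
by rewrite lI ltry => /(_ isT).
Qed.

(** The convolution of [psi] with a mollifier of width d, times a plateau in time, is an admissible
    test function; the boundary terms and the drift change by O(d), and d tends to 0. *)
Lemma weak_C11 psi g1 g2 (L M r t : R) : 0 <= r -> C11 psi g1 g2 L M r -> 0 <= t <= T ->
  \int[leb2]_x (w t x * psi x) - \int[leb2]_x (w 0 x * psi x) =
  \int[leb1]_s (\1_([set` `[0, t]%R]) s * drift w g1 g2 s).
Proof.
move=> r0 h /andP[t0 tT].
have [mpsi mg1 mg2] := C11_measurable h.
have [B hB] := C11_bounded h.
have ipsi := C11_integrable h.
have [C C0 hC] := @mollifier_exists R.
have V0 := flow_V0 hw; have M0 := C11_M0 h.
(* Two boundary terms, each off by 2 L d V, and a drift whose gradient is off by M C d on the box of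
   radius r + 1, during the time t. *)
apply: (@eq_of_le_small _ _ _ (2 * (2 * L * V) + 2 * (34 * V * (1 + (r + 1))) * (M * C) * V * t)).
move=> d d0 d1.
have [th hth] := hC d d0.
have [A A0 hA] := moll_C11 hth.
have hd := hA psi r _ ipsi (fun x xr => let: And3 e _ _ := C11_supp h xr in e) (lexx _).
set A' := A * _ in hd.
have [md md1 md2] := C11_measurable hd.
have close := C11_moll_close h (ltW d0) hth.
have hphi := test_function_tensor ipsi (fun x xr => let: And3 e _ _ := C11_supp h xr in e)
  (moll_smooth hth) (moll_supp hth) (@smooth_plateau R T) (@supp_in_plateau T).
have tt : 0 <= t <= T by rewrite t0.
have tder x (s : R) := tensor_derivatives ipsi (moll_smooth hth) (moll_supp hth)
  (@smooth_plateau R T) (@supp_in_plateau T) x s.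
have := flow_weak hw tt hphi.
rewrite Rint_itv.
pose psid := mconv psi th th; pose g1d := mconv psi th^`()%classic th.
pose g2d := mconv psi th th^`()%classic.
have p1 (s : R) : 0 <= s <= t -> plateau T s = 1.
  by move=> /andP[s0 st]; apply: plateau1; lra.
have -> : \int[leb2]_x (w t x * (mconv psi th th (x, t).1 * plateau T (x, t).2)) =
   \int[leb2]_x (w t x * psid x).
  by apply: (eq_Rint leb2) => x /=; rewrite p1 ?mulr1// t0 lexx.
have -> : \int[leb2]_x (w 0 x * (mconv psi th th (x, 0 : R).1 * plateau T (x, 0 : R).2)) =
   \int[leb2]_x (w 0 x * psid x).
  by apply: (eq_Rint leb2) => x /=; rewrite p1 ?mulr1// lexx t0.
have hF F : (forall s, 0 <= s <= t -> F s = drift w g1d g2d s) ->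
    \int[leb1]_s (\1_([set` `[0, t]%R]) s * F s) =
    \int[leb1]_s (\1_([set` `[0, t]%R]) s * drift w g1d g2d s).
  move=> hF; apply: eq_Rint => s; rewrite indicE.
  have [|_] := boolP (s \in _); last by rewrite !mul0r.
  by rewrite inE/= in_itv/= => hs; rewrite hF.
move=> e; have {e}e := etrans e (hF _ _).
have {}e : \int[leb2]_x (w t x * psid x) - \int[leb2]_x (w 0 x * psid x) =
    \int[leb1]_s (\1_([set` `[0, t]%R]) s * drift w g1d g2d s).
  apply: e.
  move=> s /andP[s0 st]; apply: eq_Rint => x.
  have [-> -> ->] := tder x s.
  by rewrite plateau_derive0 ?p1 ?s0 ?st ?(le_trans st tT)// mulr0 add0r !mulr1.
have rd x : r + 1 < `|x| -> [/\ g1 x = 0, g2 x = 0, g1d x = 0 & g2d x = 0].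
  move=> xr; have xr0 : r < `|x| by apply: lt_trans xr; rewrite ltrDl.
  have [_ z1 z2] := C11_supp h xr0.
  have xr' : r + d < `|x| by apply: le_lt_trans xr; rewrite lerD2l.
  have [_ z3 z4] := C11_supp hd xr'.
  by split.
have cl1 : forall x, `|g1 x - g1d x| <= M * C * d /\ `|g2 x - g2d x| <= M * C * d.
  move=> x; have [_ [c1 c2]] := close x.
  have ec : M * d ^+ 2 * (C / d) = M * C * d by field; rewrite gt_eqF.
  by rewrite -[`|g1 x - _|]distrC -[`|g2 x - _|]distrC -ec.
have bg : exists A, forall x, `|g1 x| <= A /\ `|g2 x| <= A by exists L; exact: C11_grad h.
have r1 : 0 <= r + 1 by rewrite addr_ge0.
have dd := drift_diff_le hw r1 mg1 mg2 md1 md2 rd bg cl1.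
have mdr := measurable_drift hw mg1 mg2; have mdrd := measurable_drift hw md1 md2.
have bdr s : `|drift w g1 g2 s| <= 2 * (34 * V * (1 + r)) * L * V.
  have z x : r < `|x| -> g1 x = 0 /\ g2 x = 0 by move=> /(C11_supp h)[].
  exact: (drift_le hw r0 mg1 mg2 z (C11_grad h) s).2.
have bdrd s : `|drift w g1d g2d s| <= 2 * (34 * V * (1 + (r + d))) * A' * V.
  have z x : r + d < `|x| -> g1d x = 0 /\ g2d x = 0 by move=> /(C11_supp hd)[].
  have rd0 : 0 <= r + d by rewrite addr_ge0// ltW.
  exact: (drift_le hw rd0 md1 md2 z (C11_grad hd) s).2.
have [i1 _] := time_integral_le t0 mdr bdr.
have [i2 _] := time_integral_le t0 mdrd bdrd.
have [_ b3] := time_integral_le t0 (measurable_funB mdr mdrd) dd.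
have b1 := Rint_close (flow_controlled hw t) mpsi md (ex_intro _ B hB) (fun x => (close x).1).
have b2 := Rint_close (flow_controlled hw 0) mpsi md (ex_intro _ B hB) (fun x => (close x).1).
have e3 : \int[leb1]_s (\1_([set` `[0, t]%R]) s * (drift w g1 g2 s - drift w g1d g2d s)) =
   \int[leb1]_s (\1_([set` `[0, t]%R]) s * drift w g1 g2 s) -
   \int[leb1]_s (\1_([set` `[0, t]%R]) s * drift w g1d g2d s).
  rewrite -(RintB i1 i2); apply: eq_Rint => s; rewrite mulrBr//.
move: b1 b2 b3 e; rewrite {}e3 -/psid subr0.
move: (\int[leb2]_x (w t x * psi x)) (\int[leb2]_x (w 0 x * psi x))
  (\int[leb2]_x (w t x * psid x)) (\int[leb2]_x (w 0 x * psid x))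
  (\int[leb1]_s (\1_([set` `[0, t]%R]) s * drift w g1 g2 s))
  (\int[leb1]_s (\1_([set` `[0, t]%R]) s * drift w g1d g2d s)).
move=> X X0 Xd X0d Y Yd b1 b2 b3 e.
have -> : X - X0 - Y = (X - Xd) - (X0 - X0d) - (Y - Yd) by rewrite -e; ring.
apply: le_trans (ler_normB _ _) _; apply: le_trans (lerD (ler_normB _ _) (lexx _)) _.
apply: le_trans (lerD (lerD b1 b2) b3) _.
by rewrite le_eqVlt; apply/orP; left; apply/eqP; ring.
Qed.

End weak_form_C11.

(** * Lipschitz dependence on time *)

#[global] Instance ae_leb1_filter (R : realType) :
  Filter (nbhs (almost_everywhere (@leb1 R))).
Proof. exact: ae_filter_ringOfSetsType. Qed.

Section Lipschitz_in_time.
Context {R : realType}.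
Implicit Types (x y u : R * R) (g psi : R * R -> R).

Lemma le_of_le_small (X Y C : R) : 0 <= C ->
  (forall d, 0 < d -> d <= 1 -> X <= Y + C * d) -> X <= Y.
Proof.
move=> C0 h; suff e : Num.max X Y = Y by rewrite -e le_max lexx.
apply: (@eq_of_le_small _ _ _ C) => d d0 d1.
rewrite ger0_norm; last by rewrite subr_ge0 le_max lexx orbT.
rewrite lerBlDl ge_max h//= lerDl mulr_ge0// ltW//.
Qed.

Variables (T V : R) (w : R -> R * R -> R).
Hypothesis hw : weak_flow T V w.

Lemma ae_neq1 (a : R) : {ae leb1, forall s : R, s <> a}.
Proof.
exists [set a]; split.
- exact: measurable_set1.
- exact: lebesgue_measure_set1.
- by move=> s /= /contrapT.
Qed.

Lemma weak_C11_between psi g1 g2 (L M r s0 t : R) : 0 <= r -> C11 psi g1 g2 L M r ->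
  0 <= s0 -> s0 <= t -> t <= T ->
  \int[leb2]_x (w t x * psi x) - \int[leb2]_x (w s0 x * psi x) =
  \int[leb1]_s (\1_([set` `[s0, t]%R]) s * drift w g1 g2 s).
Proof.
move=> r0 h s00 s0t tT.
have t0 := le_trans s00 s0t.
have e1 := weak_C11 hw r0 h (_ : 0 <= t <= T); rewrite t0 tT in e1.
have e2 := weak_C11 hw r0 h (_ : 0 <= s0 <= T); rewrite s00 (le_trans s0t tT) in e2.
have [mpsi mg1 mg2] := C11_measurable h.
have mdr := measurable_drift hw mg1 mg2.
have bdr s : `|drift w g1 g2 s| <= 2 * (34 * V * (1 + r)) * L * V.
  have z x : r < `|x| -> g1 x = 0 /\ g2 x = 0 by move=> /(C11_supp h)[].
  exact: (drift_le hw r0 mg1 mg2 z (C11_grad h) s).2.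
have [i1 _] := time_integral_le t0 mdr bdr.
have [i2 _] := time_integral_le s00 mdr bdr.
have [i3 _] := time_integral_le s0t mdr bdr.
have e3 : \int[leb1]_s (\1_([set` `[0, t]%R]) s * drift w g1 g2 s) =
  \int[leb1]_s (\1_([set` `[0, s0]%R]) s * drift w g1 g2 s) +
  \int[leb1]_s (\1_([set` `[s0, t]%R]) s * drift w g1 g2 s).
  rewrite -(RintD i2 i3); apply: ae_eq_Rint.
  - exact: integr_measurable i1.
  - exact: integr_measurable (integrD i2 i3).
  apply: filterS (ae_neq1 s0) => s ss0.
  rewrite -mulrDl; congr (_ * _); rewrite !indicE !mem_setE !in_itv/=.
  have [h1|h1|//] := ltgtP s s0.
    have h2 : s <= t by apply: le_trans s0t; exact: ltW.
    by rewrite h2 !andbT addr0.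
  by rewrite (le_trans s00 (ltW h1)) andbF add0r.
have -> : \int[leb2]_x (w t x * psi x) - \int[leb2]_x (w s0 x * psi x) =
  (\int[leb2]_x (w t x * psi x) - \int[leb2]_x (w 0 x * psi x)) -
  (\int[leb2]_x (w s0 x * psi x) - \int[leb2]_x (w 0 x * psi x)) by ring.
by rewrite e1// e2// e3; ring.
Qed.

Lemma C11_in_time psi g1 g2 (L M r s0 t : R) : 0 <= r -> C11 psi g1 g2 L M r ->
  0 <= s0 -> s0 <= t -> t <= T ->
  `|\int[leb2]_x (w t x * psi x) - \int[leb2]_x (w s0 x * psi x)| <=
  2 * (34 * V * (1 + r)) * L * V * (t - s0).
Proof.
move=> r0 h s00 s0t tT; rewrite (weak_C11_between r0 h s00 s0t tT).
have [mpsi mg1 mg2] := C11_measurable h.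
have z x : r < `|x| -> g1 x = 0 /\ g2 x = 0 by move=> /(C11_supp h)[].
have bdr s := (drift_le hw r0 mg1 mg2 z (C11_grad h) s).2.
exact: (time_integral_le s0t (measurable_drift hw mg1 mg2) bdr).2.
Qed.

(** Meant for products of the mollified velocity with the gradient of a [C11] function, which are
    Lipschitz and no better. Mollifying them with [lip_moll_grad] leaves [L] as the only constant of
    regularity. *)
Lemma Lipschitz_in_time : exists2 C, 0 < C & forall psi (L r s0 t : R),
  0 <= r -> 0 <= L -> (forall x u, `|psi (x + u) - psi x| <= L * `|u|) ->
  (forall x, r < `|x| -> psi x = 0) -> 0 <= s0 -> s0 <= t -> t <= T ->
  `|\int[leb2]_x (w t x * psi x) - \int[leb2]_x (w s0 x * psi x)| <=
  C * (2 + r) * L * (t - s0).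
Proof.
have [C0 C00 hC] := @mollifier_exists R.
have V0 := flow_V0 hw.
exists (2 * 34 * V * C0 * V + 1); first by rewrite ltr_wpDl// !mulr_ge0// ltW.
move=> psi L r s0 t r0 L0 lip sup s00 s0t tT.
have ts : 0 <= t - s0 by rewrite subr_ge0.
apply: (@le_trans _ _ (2 * (34 * V * (2 + r)) * (L * C0) * V * (t - s0))); last first.
  rewrite ler_wpM2r//.
  have -> : 2 * (34 * V * (2 + r)) * (L * C0) * V = (2 * 34 * V * C0 * V) * ((2 + r) * L) by ring.
  have -> : (2 * 34 * V * C0 * V + 1) * (2 + r) * L = (2 * 34 * V * C0 * V + 1) * ((2 + r) * L) by ring.
  by rewrite ler_wpM2r ?lerDl// mulr_ge0// addr_ge0.
apply: (@le_of_le_small _ _ (2 * (L * V))); first by rewrite !mulr_ge0.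
move=> d d0 d1; have [th hth] := hC d d0.
have msi := lipschitz_measurable lip.
have hB := lipschitz_supp_bounded L0 lip sup.
have ip := bounded_supp_integrable2 msi sup hB.
have [A A0 hA] := moll_C11 hth.
have hd := hA psi r _ ip sup (lexx _).
set A' := A * _ in hd.
have close := lip_moll_grad (ltW d0) L0 hth lip sup.
have hd' : C11 (mconv psi th th) (mconv psi th^`()%classic th) (mconv psi th th^`()%classic)
    (L * C0) A' (r + 1).
  split.
  - move=> x; have [_] := close x.
    by have -> : L * d * (C0 / d) = L * C0 by field; rewrite gt_eqF.
  - exact: C11_grad_lip hd.
  - exact: C11_taylor hd.
  - move=> x xr; apply: (C11_supp hd); apply: le_lt_trans xr; by rewrite lerD2l.
have [md _ _] := C11_measurable hd.
have r1 : 0 <= r + 1 by rewrite addr_ge0.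
have h3 := C11_in_time r1 hd' s00 s0t tT.
have b1 := Rint_close (flow_controlled hw t) msi md (ex_intro _ _ hB) (fun x => (close x).1).
have b2 := Rint_close (flow_controlled hw s0) msi md (ex_intro _ _ hB) (fun x => (close x).1).
move: b1 b2 h3.
move: (\int[leb2]_x (w t x * psi x)) (\int[leb2]_x (w s0 x * psi x))
  (\int[leb2]_x (w t x * mconv psi th th x)) (\int[leb2]_x (w s0 x * mconv psi th th x)).
move=> X Y X' Y' b1 b2 h3.
have -> : X - Y = (X - X') - (Y - Y') + (X' - Y') by ring.
apply: le_trans (ler_normD _ _) _; apply: le_trans (lerD (ler_normB _ _) (lexx _)) _.
apply: le_trans (lerD (lerD b1 b2) h3) _.
by rewrite le_eqVlt; apply/orP; left; apply/eqP; ring.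
Qed.

End Lipschitz_in_time.

(** * Propagation of the sign *)

Section composition.
Context {R : realType}.
Implicit Types (x y u : R * R) (g psi : R * R -> R).

(** Two bounds on the gradient of the field are used. The sharp one, [G], holds on the box of radius
    r', which contains the support of the composition, and multiplies [L]; the crude global bound
    [Lb] enters the second-order constant alone. *)
Lemma C11_comp psi g1 g2 (B1 B2 p11 p12 p21 p22 : R * R -> R) (L M r Lb rb h G r' : R) :
  C11 psi g1 g2 L M r -> C11 B1 p11 p12 Lb Lb rb -> C11 B2 p21 p22 Lb Lb rb ->
  0 <= h -> 0 <= G ->
  (forall x, r' < `|x| -> r < `|(x.1 + h * B1 x, x.2 + h * B2 x)|) ->
  (forall x, `|x| <= r' -> [/\ `|p11 x| <= G, `|p12 x| <= G, `|p21 x| <= G & `|p22 x| <= G]) ->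
  let Phi x := (x.1 + h * B1 x, x.2 + h * B2 x) in
  C11 (psi \o Phi)
    (fun x => g1 (Phi x) * (1 + h * p11 x) + g2 (Phi x) * (h * p21 x))
    (fun x => g1 (Phi x) * (h * p12 x) + g2 (Phi x) * (1 + h * p22 x))
    (L * (1 + 2 * h * G)) (M * (1 + 2 * h * Lb) ^+ 2 + 2 * h * L * Lb) r'.
Proof.
move=> cp cb1 cb2 h0 G0 out fine Phi.
have L0 := C11_L0 cp; have M0 := C11_M0 cp; have Lb0 := C11_L0 cb1.
pose v x u := Phi (x + u) - Phi x.
have vE x u : (v x u).1 = u.1 + h * (B1 (x + u) - B1 x) /\
    (v x u).2 = u.2 + h * (B2 (x + u) - B2 x).
  by split; rewrite /v /Phi/=; ring.
have PE x u : Phi (x + u) = Phi x + v x u by rewrite /v [RHS]addrC subrK.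
have q0 : 0 <= 1 + 2 * h * Lb by rewrite addr_ge0// !mulr_ge0.
have vq x u : `|v x u| <= (1 + 2 * h * Lb) * `|u|.
  have [e1 e2] := vE x u; rewrite plane_normE ge_max e1 e2.
  have b1 := C11_lip cb1 x u; have b2 := C11_lip cb2 x u.
  have -> : (1 + 2 * h * Lb) * `|u| = `|u| + h * (2 * Lb * `|u|) by ring.
  apply/andP; split; apply: le_trans (ler_normD _ _) _; apply: lerD;
    rewrite ?plane_norm1 ?plane_norm2// normrM (ger0_norm h0) ler_wpM2l//.
have z x : r' < `|x| -> [/\ psi (Phi x) = 0, g1 (Phi x) = 0 & g2 (Phi x) = 0].
  by move=> xr; apply: (C11_supp cp); exact: out.
split.
- move=> x; have [xr|xr] := leP `|x| r'; last first.
    have [_ -> ->] := z x xr; rewrite !mul0r addr0 normr0.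
    by split; rewrite mulr_ge0// addr_ge0// !mulr_ge0.
  have [f1 f2 f3 f4] := fine x xr; have [a1 a2] := C11_grad cp (Phi x).
  have k (p : R) : `|p| <= G -> `|h * p| <= h * G.
    by move=> pG; rewrite normrM (ger0_norm h0) ler_wpM2l.
  have k1 (p : R) : `|p| <= G -> `|1 + h * p| <= 1 + h * G.
    by move=> pG; apply: le_trans (ler_normD _ _) _; rewrite normr1 lerD2l; exact: k.
  split; apply: le_trans (ler_normD _ _) _; rewrite !normrM.
    have -> : L * (1 + 2 * h * G) = L * (1 + h * G) + L * (h * G) by ring.
    by apply: lerD; apply: ler_pM => //; rewrite -?normrM; [exact: k1|exact: k].
  have -> : L * (1 + 2 * h * G) = L * (h * G) + L * (1 + h * G) by ring.
  by apply: lerD; apply: ler_pM => //; rewrite -?normrM; [exact: k|exact: k1].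
- move=> x u.
  have [a1 a2] := C11_grad cp (Phi x); have [l1 l2] := C11_grad_lip cp (Phi x) (v x u).
  rewrite -PE in l1 l2.
  have Mv : M * `|v x u| <= M * (1 + 2 * h * Lb) * `|u| by rewrite -mulrA ler_wpM2l.
  have {}l1 := le_trans l1 Mv; have {}l2 := le_trans l2 Mv.
  have [c11 c12] := C11_grad_lip cb1 x u; have [c21 c22] := C11_grad_lip cb2 x u.
  have [b11 b12] := C11_grad cb1 (x + u); have [b21 b22] := C11_grad cb2 (x + u).
  have main (a a' b b' p p' q q' : R) : `|a' - a| <= M * (1 + 2 * h * Lb) * `|u| ->
      `|b' - b| <= M * (1 + 2 * h * Lb) * `|u| -> `|a| <= L -> `|b| <= L ->
      `|p' - p| <= Lb * `|u| -> `|q' - q| <= Lb * `|u| -> `|p'| <= Lb -> `|q'| <= Lb ->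
      `|a' * (1 + h * p') + b' * (h * q') - (a * (1 + h * p) + b * (h * q))| <=
      (M * (1 + 2 * h * Lb) ^+ 2 + 2 * h * L * Lb) * `|u|.
    move=> h1 h2 h3 h4 h5 h6 h7 h8.
    have -> : a' * (1 + h * p') + b' * (h * q') - (a * (1 + h * p) + b * (h * q)) =
      (a' - a) * (1 + h * p') + (b' - b) * (h * q') + (a * (h * (p' - p)) + b * (h * (q' - q))).
      by ring.
    have -> : (M * (1 + 2 * h * Lb) ^+ 2 + 2 * h * L * Lb) * `|u| =
      M * (1 + 2 * h * Lb) * `|u| * (1 + h * Lb) + M * (1 + 2 * h * Lb) * `|u| * (h * Lb) +
      (L * (h * (Lb * `|u|)) + L * (h * (Lb * `|u|))) by ring.
    have k (p0 P : R) : `|p0| <= P -> `|h * p0| <= h * P.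
      by move=> pG; rewrite normrM (ger0_norm h0) ler_wpM2l.
    have k1 (p0 P : R) : `|p0| <= P -> `|1 + h * p0| <= 1 + h * P.
      by move=> pG; apply: le_trans (ler_normD _ _) _; rewrite normr1 lerD2l; exact: k.
    apply: le_trans (ler_normD _ _) _; apply: lerD; apply: le_trans (ler_normD _ _) _;
      apply: lerD; rewrite normrM; apply: ler_pM => //; by [exact: k1|exact: k].
  split; first exact: main.
  by rewrite [X in `|X - _|]addrC [X in `|_ - X|]addrC; apply: main.
- move=> x u.
  have [a1 a2] := C11_grad cp (Phi x).
  have t := C11_taylor cp (Phi x) (v x u); rewrite -PE in t.
  have [e1 e2] := vE x u.
  have t1 := C11_taylor cb1 x u; have t2 := C11_taylor cb2 x u.
  rewrite e1 e2 in t.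
  have vq2 : `|v x u| ^+ 2 <= (1 + 2 * h * Lb) ^+ 2 * `|u| ^+ 2.
    by rewrite -exprMn lerXn2r ?nnegrE// mulr_ge0.
  have {}t := le_trans t (ler_wpM2l M0 vq2).
  rewrite /comp.
  move: t t1 t2 a1 a2.
  move: (psi (Phi (x + u))) (psi (Phi x)) (g1 (Phi x)) (g2 (Phi x)) (B1 (x + u)) (B1 x)
    (B2 (x + u)) (B2 x) (p11 x) (p12 x) (p21 x) (p22 x) => P' P a b c c' d d' q11 q12 q21 q22.
  move=> t t1 t2 a1 a2.
  have -> : P' - P - ((a * (1 + h * q11) + b * (h * q21)) * u.1 +
      (a * (h * q12) + b * (1 + h * q22)) * u.2) =
    P' - P - (a * (u.1 + h * (c - c')) + b * (u.2 + h * (d - d'))) +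
    (a * (h * (c - c' - (q11 * u.1 + q12 * u.2))) + b * (h * (d - d' - (q21 * u.1 + q22 * u.2)))).
    by ring.
  have -> : (M * (1 + 2 * h * Lb) ^+ 2 + 2 * h * L * Lb) * `|u| ^+ 2 =
    M * ((1 + 2 * h * Lb) ^+ 2 * `|u| ^+ 2) +
    (L * (h * (Lb * `|u| ^+ 2)) + L * (h * (Lb * `|u| ^+ 2))) by ring.
  apply: le_trans (ler_normD _ _) _; apply: lerD => //.
  apply: le_trans (ler_normD _ _) _.
  by apply: lerD; rewrite normrM; apply: ler_pM => //; rewrite normrM (ger0_norm h0) ler_wpM2l.
- move=> x xr; have [e1 e2 e3] := z x xr.
  by split; rewrite /comp ?e1 ?e2 ?e3// !mul0r addr0.
Qed.

End composition.

(** * Mollified velocities *)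

Section mollified_velocity.
Context {R : realType}.
Implicit Types (x y u : R * R).

(* [be] controls the linear growth, [G] the gradient and [om] the distance to the
   velocity on the ball of radius [Rr - 1]; the constant [Lb] is much larger. *)
Record smooth_field (w : R -> R * R -> R) (be Lb G om Rr : R)
    (B1 B2 p11 p12 p21 p22 : R -> R * R -> R) : Prop := SmoothField {
  field_C11 : forall s, C11 (B1 s) (p11 s) (p12 s) Lb Lb (Rr + 1) /\
    C11 (B2 s) (p21 s) (p22 s) Lb Lb (Rr + 1);
  field_bound : forall s x, `|B1 s x| <= Lb /\ `|B2 s x| <= Lb;
  field_growth : forall s x, `|B1 s x| <= be * (2 + `|x|) /\ `|B2 s x| <= be * (2 + `|x|);
  field_grad : forall s x, `|x| <= Rr - 1 ->
    [/\ `|p11 s x| <= G, `|p12 s x| <= G, `|p21 s x| <= G & `|p22 s x| <= G];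
  field_close : forall s x, `|x| <= Rr - 1 ->
    `|B1 s x - (H (w s) x).1| <= om /\ `|B2 s x - (H (w s) x).2| <= om;
  field_measurable :
    measurable_fun setT (fun z : measurableTypeR R * @plane R => B1 z.1 z.2) /\
    measurable_fun setT (fun z : measurableTypeR R * @plane R => B2 z.1 z.2) }.

Variables (T V : R) (w : R -> R * R -> R).
Hypothesis hw : weak_flow T V w.

Lemma measurable_mconv (f : R -> R * R -> R) th : measurable_fun setT th ->
  measurable_fun setT (fun z : measurableTypeR R * @plane R => f z.1 z.2) ->
  measurable_fun setT (fun z : measurableTypeR R * @plane R => mconv (f z.1) th th z.2).
Proof.
move=> mth mf.
apply: (@measurable_Rint2 R _ (measurableTypeR R * @plane R)%type
  (fun z y => f z.1 y * (th (z.2.1 - y.1) * th (z.2.2 - y.2)))).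
have m1 : measurable_fun setT
    (fun z : (measurableTypeR R * @plane R) * @plane R => (z.1.1, z.2)).
  apply: measurable_fun_pair => /=.
    by apply: measurableT_comp; [exact: measurable_fst|exact: measurable_fst].
  exact: measurable_snd.
have m12 : measurable_fun setT (fun z : (measurableTypeR R * @plane R) * @plane R => z.1.2).
  by apply: measurableT_comp; [exact: measurable_snd|exact: measurable_fst].
apply: measurable_funM; first exact: (measurableT_comp mf m1).
apply: measurable_funM; apply: (measurableT_comp mth); apply: measurable_funB.
- exact: (measurableT_comp measurable_fst m12).
- by apply: measurableT_comp; [exact: measurable_fst|exact: measurable_snd].
- exact: (measurableT_comp measurable_snd m12).
- by apply: measurableT_comp; [exact: measurable_snd|exact: measurable_snd].
Qed.

(* The component [b] of the velocity is cut off outside a box, being only locally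
   integrable, before it is mollified. *)
Lemma mollify_component (b : R -> R * R -> R) (be Rr C d : R) th :
  measurable_fun setT (fun z : measurableTypeR R * @plane R => b z.1 z.2) ->
  0 <= be -> 0 <= Rr -> 0 < d -> d <= 1 -> mollifier C d th ->
  (forall s x, `|b s x| <= be * (1 + `|x|)) ->
  exists2 A, 0 <= A & forall (om : R),
  (forall s x y, `|x| <= Rr -> `|y| <= Rr -> `|y - x| <= d -> `|b s y - b s x| <= om) ->
  exists B p1 p2 : R -> R * R -> R,
  [/\ forall s, C11 (B s) (p1 s) (p2 s) A A (Rr + 1) /\ (forall x, `|B s x| <= A),
      forall s x, `|B s x| <= be * (2 + `|x|),
      forall s x, `|x| <= Rr - 1 -> `|B s x - b s x| <= om,
      forall s x, `|x| <= Rr - 1 -> `|p1 s x| <= om * (C / d) /\ `|p2 s x| <= om * (C / d) &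
      measurable_fun setT (fun z : measurableTypeR R * @plane R => B z.1 z.2)].
Proof.
move=> mb be0 Rr0 d0 d1 hth bb.
pose f s x := \1_(box (0 : R * R) Rr) x * b s x.
have mf : measurable_fun setT (fun z : measurableTypeR R * @plane R => f z.1 z.2).
  apply: measurable_funM => //.
  have mi : measurable_fun setT (\1_(box (0 : R * R) Rr) : @plane R -> R).
    by apply: measurable_indic; exact: measurable_box.
  by apply: (measurableT_comp mi); exact: measurable_snd.
have mfs s : measurable_fun setT (f s : plane -> R).
  exact: (measurable_fun_pair2 (s : measurableTypeR R) mf).
have fin s x : `|x| <= Rr -> f s x = b s x.
  by move=> xr; rewrite /f indicE mem_set ?mul1r//; rewrite /box/= subr0.
have fout s x : Rr < `|x| -> f s x = 0.
  move=> xr; rewrite /f indicE memNset ?mul0r//; rewrite /box/= subr0.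
  by apply/negP; rewrite -ltNge.
have fg s x : `|f s x| <= be * (1 + `|x|).
  have [xr|xr] := leP `|x| Rr; first by rewrite fin.
  by rewrite fout// normr0 mulr_ge0// addr_ge0.
have fb s x : `|f s x| <= be * (1 + Rr).
  have [xr|xr] := leP `|x| Rr; last by rewrite fout// normr0 mulr_ge0// addr_ge0.
  by apply: le_trans (fg s x) _; rewrite ler_wpM2l// lerD2l.
have fi s := bounded_supp_integrable2 (mfs s) (fout s) (fb s).
have iI : leb2.-integrable setT (EFin \o (\1_(box 0 Rr) : @plane R -> R)).
  by apply: integr_indic; [exact: measurable_box|rewrite leb2_box// ltry].
have fN s : \int[leb2]_y `|f s y| <= be * (1 + Rr) * (4 * Rr ^+ 2).
  have -> : 4 * Rr ^+ 2 = \int[leb2]_y (\1_(box (0 : R * R) Rr) y : R).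
    by rewrite Rint_indic ?leb2_box//; exact: measurable_box.
  rewrite -(RintZ _ iI); apply: (@le_Rint _ _ R leb2).
  - exact: integr_norm.
  - exact: integrZ.
  move=> y; have [yr|yr] := leP `|y| Rr.
    rewrite indicE mem_set ?mulr1 ?fb//; rewrite /box/= subr0//.
  rewrite fout// normr0 mulr_ge0 ?indicE// mulr_ge0// addr_ge0//.
have [A A0 hA] := moll_C11 hth.
set N := be * (1 + Rr) * (4 * Rr ^+ 2) in fN.
have N0 : 0 <= N by apply: le_trans (fN 0); exact: Rint_ge0.
have hC s := hA (f s) Rr N (fi s) (fout s) (fN s).
have AN : 0 <= A * N by rewrite mulr_ge0.
pose K := 2 * (A * N) * (2 * `|Rr + d| + 1).
have K0 : 0 <= K by rewrite mulr_ge0// ?mulr_ge0// addr_ge0// mulr_ge0.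
exists (A * N + K); first by rewrite addr_ge0.
move=> om hom.
exists (fun s => mconv (f s) th th), (fun s => mconv (f s) th^`()%classic th),
  (fun s => mconv (f s) th th^`()%classic).
(* Starting in the smaller box, d <= 1 keeps [y] in the box where the truncated component agrees
   with [b]. *)
have near s x : `|x| <= Rr - 1 -> forall y, `|y - x| <= d -> `|f s y - b s x| <= om.
  move=> xr y yd; have yr : `|y| <= Rr.
    have := ler_normD (y - x) x; rewrite subrK => h; apply: le_trans h _.
    by have := lerD yd xr; lra.
  by rewrite fin//; apply: hom => //; lra.
split.
- move=> s; split.
    by apply: C11_le (hC s); rewrite ?lerDl// lerD2l.
  move=> x; apply: (@le_trans _ _ K); last by rewrite lerDr.
  apply: lipschitz_supp_bounded (C11_lip (hC s)) _ _.
    by rewrite mulr_ge0.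
  by move=> y /(C11_supp (hC s))[].
- move=> s x; have := @moll_close _ _ _ _ hth _ (fi s) x 0 (be * (2 + `|x|)).
  rewrite subr0; apply=> y yd; rewrite subr0; apply: le_trans (fg s y) _.
  rewrite ler_wpM2l//; have := ler_normD (y - x) x; rewrite subrK => h.
  by have := le_trans h (lerD (le_trans yd d1) (lexx _)); lra.
- by move=> s x xr; apply: (moll_close hth (fi s)) => y yd; exact: near.
- move=> s x xr.
  have := @moll_grad_close _ _ _ _ hth _ (fi s) x (b s x) 0 0 om.
  rewrite !subr0; apply=> y yd.
  by rewrite !mul0r !addr0; exact: near.
- by apply: measurable_mconv => //; exact: smooth_measurable (moll_smooth hth).
Qed.

Lemma loglip_const_ge0 (r : R) : 0 <= r -> 0 <= loglip_const r.
Proof.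
move=> r0; have c1 : 0 <= 1 + r by apply: addr_ge0.
have c2 : 0 <= 1 + 2 * r ^+ 2.
  by apply: addr_ge0 => //; apply: mulr_ge0 => //; exact: sqr_ge0.
have c3 : (0 : R) <= 1800 by exact: ler0n.
have c4 : (0 : R) <= 34 by exact: ler0n.
exact: addr_ge0 (mulr_ge0 (mulr_ge0 c1 c3) c2) c4.
Qed.

(** [Lam] is fixed before [n]: at scale 2^-n the modulus is proportional to (n + 1) 2^-n, and
    dividing by the scale gives a gradient of order n + 1. The factor 1 + C in [Lam] covers both,
    while [Lb] comes after [n]. *)
Lemma smooth_field_exists (Rr : R) : 0 <= Rr -> exists2 Lam, 0 <= Lam & forall n : nat,
  exists2 Lb, 0 <= Lb & exists B1 B2 p11 p12 p21 p22,
  smooth_field w (34 * V) Lb (Lam * n.+1%:R) (Lam * n.+1%:R * (2 ^+ n)^-1) Rr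
    B1 B2 p11 p12 p21 p22.
Proof.
move=> Rr0; have [C C0 hC] := @mollifier_exists R; have V0 := flow_V0 hw.
have LL0 : 0 <= loglip_const Rr * V.
  exact: mulr_ge0 (loglip_const_ge0 Rr0) V0.
pose Lam := loglip_const Rr * V * (1 + C).
exists Lam; first by apply: mulr_ge0 LL0 _; rewrite addr_ge0// ltW.
move=> n; pose d : R := (2 ^+ n)^-1.
have d0 : 0 < d by rewrite invr_gt0 exprn_gt0.
have d1 : d <= 1 by rewrite invf_le1 ?exprn_gt0// exprn_ege1//; lra.
have [th hth] := hC d d0.
have [m1 m2] := flow_measurable_H hw.
have be0 : 0 <= 34 * V by rewrite mulr_ge0.
have Hle s x : `|(H (w s) x).1| <= 34 * V * (1 + `|x|) /\ `|(H (w s) x).2| <= 34 * V * (1 + `|x|).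
  by have [mg iv vV1 vVoo] := flow_controlled hw s; exact: H_le mg iv vV1 vVoo x.
have Hlip s x y : `|x| <= Rr -> `|y| <= Rr -> `|y - x| <= d ->
  `|(H (w s) y).1 - (H (w s) x).1| <= loglip_const Rr * V * n.+1%:R * d /\
  `|(H (w s) y).2 - (H (w s) x).2| <= loglip_const Rr * V * n.+1%:R * d.
  by move=> xr yr xy; have [mg iv vV1 vVoo] := flow_controlled hw s; exact: H_lip mg iv vV1 vVoo _ _ _ _ yr xr xy.
rewrite /Lam; move: (loglip_const Rr) LL0 Hlip => LL LL0 Hlip.
have [A1 A10 h1] := mollify_component (b := fun s x => (H (w s) x).1) m1 be0 Rr0 d0 d1 hth (fun s x => (Hle s x).1).
have [A2 A20 h2] := mollify_component (b := fun s x => (H (w s) x).2) m2 be0 Rr0 d0 d1 hth (fun s x => (Hle s x).2).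
have [B1 [p11 [p12 [c1 g1 k1 q1 mB1]]]] := h1 _ (fun s x y xr yr xy => (Hlip s x y xr yr xy).1).
have [B2 [p21 [p22 [c2 g2 k2 q2 mB2]]]] := h2 _ (fun s x y xr yr xy => (Hlip s x y xr yr xy).2).
exists (A1 + A2); first by rewrite addr_ge0.
exists B1, B2, p11, p12, p21, p22.
have n0 : 0 <= n.+1%:R :> R by exact: ler0n.
have Ln0 : 0 <= LL * V * n.+1%:R by exact: mulr_ge0.
have om_le : LL * V * n.+1%:R * d <= LL * V * (1 + C) * n.+1%:R * (2 ^+ n)^-1.
  rewrite -/d ler_wpM2r ?(ltW d0)//.
  have -> : LL * V * (1 + C) * n.+1%:R = LL * V * n.+1%:R * (1 + C) by ring.
  by rewrite ler_peMr// lerDl ltW.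
have G_le : LL * V * n.+1%:R * d * (C / d) <= LL * V * (1 + C) * n.+1%:R.
  have -> : LL * V * n.+1%:R * d * (C / d) = LL * V * n.+1%:R * C.
    by field; rewrite gt_eqF.
  have -> : LL * V * (1 + C) * n.+1%:R = LL * V * n.+1%:R * (1 + C) by ring.
  by rewrite ler_wpM2l// lerDr.
split.
- move=> s; split.
    by apply: C11_le (c1 s).1; rewrite ?lerDl.
  by apply: C11_le (c2 s).1; rewrite ?lerDr.
- move=> s x; split.
    by apply: le_trans ((c1 s).2 x) _; rewrite lerDl.
  by apply: le_trans ((c2 s).2 x) _; rewrite lerDr.
- by move=> s x; split.
- move=> s x xr; have [a1 a2] := q1 s x xr; have [a3 a4] := q2 s x xr.
  by split; apply: le_trans G_le.
- by move=> s x xr; split; [apply: le_trans (k1 s x xr) _|apply: le_trans (k2 s x xr) _].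
- by split.
Qed.

End mollified_velocity.

(** * One backward step *)

Section backward_step.
Context {R : realType}.
Implicit Types (x y u : R * R).

(** The arithmetic of a step, apart from the integrals. The hypotheses are, in order, the weak form,
    the choice of the time, Lipschitz continuity in time, the Taylor expansion and the distance
    between the two fields. *)
Lemma backward_step_bound (h K1 K2 K3 X1 X2 X3 X4 X5 D Bt : R) : 0 <= h ->
  X1 - X2 = D -> h * X3 <= Bt + h ^+ 2 -> `|X3 - X4| <= K1 * h ->
  X5 - (X2 + h * X4) <= K2 * h ^+ 2 -> `|D - Bt| <= K3 * h ->
  X5 - (h * K3 + (1 + K1 + K2) * h ^+ 2) <= X1.
Proof.
move=> h0 weak hs stim tay j3.
have hst : h * X4 <= h * X3 + K1 * h ^+ 2.
  have -> : h * X3 + K1 * h ^+ 2 = h * (X3 + K1 * h) by ring.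
  by rewrite ler_wpM2l//; move: stim; rewrite ler_norml => /andP[]; lra.
move: j3; rewrite ler_norml => /andP[j3 _].
have -> : h * K3 + (1 + K1 + K2) * h ^+ 2 = K3 * h + h ^+ 2 + K1 * h ^+ 2 + K2 * h ^+ 2 by ring.
lra.
Qed.

(** [f] is only measurable, so its mean need not be attained. If the bound failed at every time,
    integration would give I + (b - a)^2 <= I; the slack makes this absurd and has the order of the
    other errors. *)
Lemma below_mean (a b C : R) (f : R -> R) : a < b ->
  measurable_fun setT (f : measurableTypeR R -> R) -> (forall s, `|f s| <= C) ->
  exists2 s, a <= s <= b &
    (b - a) * f s <= \int[leb1]_s (\1_([set` `[a, b]%R]) s * f s) + (b - a) ^+ 2.
Proof.
move=> ab mf fC; apply: contrapT => no.
have [i1 _] := time_integral_le (ltW ab) mf fC.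
set I := \int[leb1]_s _ in no *.
have ba : 0 < b - a by rewrite subr_gt0.
pose m := (I + (b - a) ^+ 2) / (b - a).
have hm s : a <= s <= b -> m <= f s.
  move=> hs; rewrite /m ler_pdivrMr// leNgt; apply/negP => h; apply: no; exists s => //.
  by rewrite mulrC ltW.
have mc : measurable_fun setT (cst m : measurableTypeR R -> R) by exact: measurable_cst.
have [i2 _] := time_integral_le (ltW ab) mc (fun s => lexx `|m|).
have lI : leb1 ([set` `[a, b]%R] : set (measurableTypeR R)) = (b - a)%:E.
  have : @lebesgue_measure R [set` `[a, b]%R] = (b - a)%:E.
    by rewrite lebesgue_measure_itv/= lte_fin ab.
  by [].
have e2 : \int[leb1]_s (\1_([set` `[a, b]%R]) s * m) = m * (b - a).
  rewrite (eq_Rint leb1 (g := fun s => m * \1_([set` `[a, b]%R]) s)).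
    rewrite (@RintZ _ _ R leb1); last first.
      by apply: integr_indic; [exact: measurable_itv|rewrite lI ltry].
    rewrite Rint_indic; last exact: measurable_itv.
    by rewrite lI.
  by move=> s; rewrite mulrC.
have : m * (b - a) <= I.
  rewrite -e2; apply: (@le_Rint _ _ R leb1) => // s.
  rewrite indicE; have [h|h] := boolP (s \in _); last by rewrite !mul0r.
  by rewrite !mul1r; apply: hm; move: h; rewrite inE/= in_itv.
rewrite /m divfK ?gt_eqF// gerDl leNgt => /negP; apply.
by rewrite exprn_gt0.
Qed.

Variables (T V : R) (w : R -> R * R -> R).
Hypothesis hw : weak_flow T V w.
Variables (be Lb G om Rr : R) (B1 B2 p11 p12 p21 p22 : R -> R * R -> R).
Hypothesis hF : smooth_field w be Lb G om Rr B1 B2 p11 p12 p21 p22.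
Hypotheses (be0 : 0 <= be) (G0 : 0 <= G) (om0 : 0 <= om).

(** [psi'] is psi composed with one explicit Euler step of the mollified field, frozen at a well
    chosen time. [K] depends on psi only through the caps [Lx] and [Mx], so it serves all steps of a
    block. The radius evolves through r + 2, as the field grows like be (2 + |x|). *)
Lemma backward_step (Lx Mx : R) : exists2 K, 0 <= K &
  forall psi g1 g2 (L M r h s0 : R), C11 psi g1 g2 L M r -> L <= Lx -> M <= Mx ->
  0 <= r -> 0 < h -> h * be <= 1 / 2 -> (r + 2) * (1 + 2 * h * be) <= Rr + 1 ->
  0 <= s0 -> s0 + h <= T ->
  exists psi' g1' g2',
  [/\ C11 psi' g1' g2' (L * (1 + 2 * h * G)) (M * (1 + 2 * h * Lb) ^+ 2 + 2 * h * L * Lb)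
        ((r + 2) * (1 + 2 * h * be) - 2),
      (forall x, 0 <= psi x) -> forall x, 0 <= psi' x &
      \int[leb2]_x (w s0 x * psi' x) - (h * (2 * om * L * V) + K * h ^+ 2) <=
      \int[leb2]_x (w (s0 + h) x * psi x)].
Proof.
have [C C0 hC] := Lipschitz_in_time hw.
have V0 := flow_V0 hw.
have Lb0 : 0 <= Lb := C11_L0 (field_C11 hF 0).1.
(* In order: the slack of [below_mean], the variation of the pairing between s0 and the chosen time,
   and the Taylor error of the Euler step. *)
pose K := 1 + C * (`|Rr| + 2) * (2 * (2 * Lb * `|Lx| + Lb * `|Mx|)) + `|Mx| * Lb ^+ 2 * V.
have K0 : 0 <= K.
  rewrite /K addr_ge0//; last by rewrite mulr_ge0// mulr_ge0// sqr_ge0.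
  rewrite addr_ge0// mulr_ge0//.
    by rewrite mulr_ge0// ?(ltW C0)// addr_ge0.
  by rewrite mulr_ge0// addr_ge0// !mulr_ge0.
exists K => // psi g1 g2 L M r h s0 cp LLx MMx r0 h0 hbe rR s00 stT.
have L0 := C11_L0 cp; have M0 := C11_M0 cp; have hge0 := ltW h0.
have rr' : r + 2 <= (r + 2) * (1 + 2 * h * be).
  by rewrite ler_peMr ?addr_ge0// lerDl !mulr_ge0.
have rRr : r <= Rr - 1 by have := le_trans rr' rR; lra.
have [mpsi mg1 mg2] := C11_measurable cp.
have zg x : r < `|x| -> g1 x = 0 /\ g2 x = 0 by move=> /(C11_supp cp)[].
have mBs s : measurable_fun setT (B1 s : plane -> R) /\ measurable_fun setT (B2 s : plane -> R).
  have [m1 m2] := field_measurable hF.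
  by split; [exact: (measurable_fun_pair2 (s : measurableTypeR R) m1)|
             exact: (measurable_fun_pair2 (s : measurableTypeR R) m2)].
pose beta s := \int[leb2]_x (w s x * (B1 s x * g1 x + B2 s x * g2 x)).
have hbeta s := drift_bound (flow_controlled hw s) (mBs s).1 (mBs s).2 mg1 mg2 zg
  (fun x _ => field_bound hF s x) (C11_grad cp) Lb0.
have mbeta : measurable_fun setT (beta : measurableTypeR R -> R).
  have [m1 m2] := field_measurable hF.
  apply: (@measurable_Rint2 R _ (measurableTypeR R)
    (fun s x => w s x * (B1 s x * g1 x + B2 s x * g2 x))).
  apply: measurable_funM; first exact: flow_measurable hw.
  apply: measurable_funD; apply: measurable_funM => //;
    apply: (measurableT_comp (f := _ : plane -> R)) => //; exact: measurable_snd.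
have s0h : s0 < s0 + h by rewrite ltrDl.
have [s /andP[s0s ssh] hs] := below_mean s0h mbeta (fun s => (hbeta s).2).
rewrite [s0 + h]addrC addrK [h + s0]addrC in hs.
(* [eta] is the source term of the mollified transport at the selected time. *)
pose eta x := B1 s x * g1 x + B2 s x * g2 x.
pose Phi x := (x.1 + h * B1 s x, x.2 + h * B2 s x).
have [cb1 cb2] := field_C11 hF s.
have etaL x u : `|eta (x + u) - eta x| <= 2 * (2 * Lb * L + Lb * M) * `|u|.
  have [l1 l2] := C11_grad_lip cp x u; have [a1 a2] := C11_grad cp (x + u).
  have k1 := C11_lip cb1 x u; have k2 := C11_lip cb2 x u.
  have [f1 f2] := field_bound hF s x.
  rewrite /eta.
  have -> : B1 s (x + u) * g1 (x + u) + B2 s (x + u) * g2 (x + u) -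
      (B1 s x * g1 x + B2 s x * g2 x) =
    (B1 s (x + u) - B1 s x) * g1 (x + u) + B1 s x * (g1 (x + u) - g1 x) +
    ((B2 s (x + u) - B2 s x) * g2 (x + u) + B2 s x * (g2 (x + u) - g2 x)) by ring.
  have -> : 2 * (2 * Lb * L + Lb * M) * `|u| = 2 * Lb * `|u| * L + Lb * (M * `|u|) +
    (2 * Lb * `|u| * L + Lb * (M * `|u|)) by ring.
  by apply: le_trans (ler_normD _ _) _; apply: lerD; apply: le_trans (ler_normD _ _) _;
    apply: lerD; rewrite normrM; apply: ler_pM.
have eta0 x : r < `|x| -> eta x = 0.
  by move=> xr; have [z1 z2] := zg x xr; rewrite /eta z1 z2 !mulr0 addr0.
have Le0 : 0 <= 2 * (2 * Lb * L + Lb * M) by rewrite mulr_ge0// addr_ge0// !mulr_ge0.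
have stim := hC eta _ r s0 s r0 Le0 etaL eta0 s00 s0s (le_trans ssh stT).
pose r' := (r + 2) * (1 + 2 * h * be) - 2.
have r'R : r' <= Rr - 1 by rewrite /r'; lra.
(* A point sent into the box of radius r satisfies (|x| + 2) (1 - q) <= r + 2 with q = h be, and (1
   + 2 q) (1 - q) >= 1 for 0 <= q <= 1 / 2. *)
have out x : r' < `|x| -> r < `|Phi x|.
  move=> xr; have [f1 f2] := field_growth hF s x.
  have d : `|x| <= `|Phi x| + h * (be * (2 + `|x|)).
    rewrite [X in X <= _]plane_normE ge_max; apply/andP; split.
      have -> : x.1 = (Phi x).1 - h * B1 s x by rewrite /Phi/= addrK.
      apply: le_trans (ler_normB _ _) _; apply: lerD; first exact: plane_norm1.
      by rewrite normrM (ger0_norm hge0) ler_wpM2l.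
    have -> : x.2 = (Phi x).2 - h * B2 s x by rewrite /Phi/= addrK.
    apply: le_trans (ler_normB _ _) _; apply: lerD; first exact: plane_norm2.
    by rewrite normrM (ger0_norm hge0) ler_wpM2l.
  rewrite /r' in xr; move: (`|x|) (`|Phi x|) xr d => X P xr d.
  have hb0 : 0 <= h * be by rewrite mulr_ge0.
  move: hb0 hbe d xr; rewrite mulrA -(mulrA 2); move: (h * be) => q q0 q1 d xr.
  have e1 : (X + 2) * (1 - q) <= P + 2 by move: d; rewrite mulrDr; lra.
  have q2 : 0 < 1 - q by lra.
  have e2 : (r + 2) * (1 + 2 * q) * (1 - q) < (X + 2) * (1 - q) by rewrite ltr_pM2r//; lra.
  have e3 : r + 2 <= (r + 2) * (1 + 2 * q) * (1 - q).
    rewrite -mulrA ler_peMr ?addr_ge0//.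
    have : 0 <= q * (1 - 2 * q) by rewrite mulr_ge0//; lra.
    lra.
  by have := lt_le_trans (le_lt_trans e3 e2) e1; rewrite ltrD2r.
have fine x : `|x| <= r' -> [/\ `|p11 s x| <= G, `|p12 s x| <= G, `|p21 s x| <= G & `|p22 s x| <= G].
  by move=> xr; apply: field_grad hF s x (le_trans xr r'R).
have cp' := C11_comp cp cb1 cb2 hge0 G0 out fine.
exists (psi \o Phi), (fun x => g1 (Phi x) * (1 + h * p11 s x) + g2 (Phi x) * (h * p21 s x)),
  (fun x => g1 (Phi x) * (h * p12 s x) + g2 (Phi x) * (1 + h * p22 s x)).
split => //.
  by move=> psi0 x; exact: psi0.
have [mpsi' _ _] := C11_measurable cp'.
have [Bp hBp] := C11_bounded cp; have [Bp' hBp'] := C11_bounded cp'.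
have [iw wV] := controlled_integrable (flow_controlled hw s0).
have meta : measurable_fun setT (eta : plane -> R) by exact: lipschitz_measurable etaL.
have Beta := lipschitz_supp_bounded Le0 etaL eta0.
have i1 := integrM mpsi iw hBp.
have i2 := integrM mpsi' iw hBp'.
have i3 := integrM meta iw Beta.
(* Second-order Taylor error of one explicit Euler step. *)
have tay : \int[leb2]_x (w s0 x * (psi \o Phi) x) -
    (\int[leb2]_x (w s0 x * psi x) + h * \int[leb2]_x (w s0 x * eta x)) <= M * (h * Lb) ^+ 2 * V.
  rewrite -(RintZ h i3) -(RintD i1 (integrZ h i3)) -(RintB i2 (integrD i1 (integrZ h i3))).
  apply: le_trans (ler_norm _) _.
  have iV := integrZ (M * (h * Lb) ^+ 2) (integr_norm iw).
  apply: le_trans (norm_Rint_le (integr_measurable (integrB i2 (integrD i1 (integrZ h i3)))) iV _) _.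
    move=> x; have [f1 f2] := field_bound hF s x.
    have := C11_taylor cp x (h * B1 s x, h * B2 s x) => /= t.
    have -> : w s0 x * psi (Phi x) - (w s0 x * psi x + h * (w s0 x * eta x)) =
      (psi (x + (h * B1 s x, h * B2 s x)) - psi x - (g1 x * (h * B1 s x) + g2 x * (h * B2 s x))) * w s0 x.
      by rewrite /eta /Phi; have -> : (x.1 + h * B1 s x, x.2 + h * B2 s x) = x + (h * B1 s x, h * B2 s x) by []; ring.
    rewrite normrM ler_wpM2r//; apply: le_trans t _; rewrite ler_wpM2l//.
    rewrite lerXn2r ?nnegrE// ?mulr_ge0// plane_norm_le/= !normrM (ger0_norm hge0).
    by rewrite !ler_wpM2l.
  by rewrite (RintZ _ (integr_norm iw)) ler_wpM2l// mulr_ge0// sqr_ge0.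
have weak := weak_C11_between hw r0 cp s00 (ltW s0h) stT.
have mdr := measurable_drift hw mg1 mg2.
have bdr s' := (drift_le hw r0 mg1 mg2 zg (C11_grad cp) s').2.
have cl s' : `|drift w g1 g2 s' - beta s'| <= 2 * om * L * V.
  have [iH _] := drift_le hw r0 mg1 mg2 zg (C11_grad cp) s'.
  have [iB _] := hbeta s'.
  rewrite /drift /beta -(RintB iH iB).
  have [mH1 mH2] := flow_measurable_Hs hw s'.
  have [mB1 mB2] := mBs s'.
  have cls x : `|x| <= r -> `|(H (w s') x).1 - B1 s' x| <= om /\ `|(H (w s') x).2 - B2 s' x| <= om.
    by move=> xr; have [f1 f2] := field_close hF s' (le_trans xr rRr); split; rewrite distrC.
  have [_] := drift_bound (flow_controlled hw s') (measurable_funB mH1 mB1)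
    (measurable_funB mH2 mB2) mg1 mg2 zg cls (C11_grad cp) om0.
  congr (`|_| <= _); apply: eq_Rint => x /=.
  move: (w s' x) (H (w s') x).1 (H (w s') x).2 (g1 x) (g2 x) (B1 s' x) (B2 s' x) => *; ring.
have [j1 _] := time_integral_le (ltW s0h) mdr bdr.
have [j2 _] := time_integral_le (ltW s0h) mbeta (fun s => (hbeta s).2).
have [_ j3] := time_integral_le (ltW s0h) (measurable_funB mdr mbeta) cl.
have e3 : \int[leb1]_s' (\1_([set` `[s0, s0 + h]%R]) s' * (drift w g1 g2 s' - beta s')) =
   \int[leb1]_s' (\1_([set` `[s0, s0 + h]%R]) s' * drift w g1 g2 s') -
   \int[leb1]_s' (\1_([set` `[s0, s0 + h]%R]) s' * beta s').
  by rewrite -(RintB j1 j2); apply: eq_Rint => s'; rewrite mulrBr.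
rewrite {}e3 in j3; rewrite [s0 + h - s0]addrC addKr in j3.
have hetas : beta s = \int[leb2]_x (w s x * eta x) by [].
rewrite {}hetas in hs.
have Lx0 : `|Lx| = Lx by rewrite ger0_norm// (le_trans L0).
have Mx0 : `|Mx| = Mx by rewrite ger0_norm// (le_trans M0).
have Kb : C * (2 + r) * (2 * (2 * Lb * L + Lb * M)) * (s - s0) <=
    C * (`|Rr| + 2) * (2 * (2 * Lb * `|Lx| + Lb * `|Mx|)) * h.
  apply: ler_pM.
  - by rewrite mulr_ge0// mulr_ge0// ?(ltW C0)// addr_ge0.
  - by rewrite subr_ge0.
  - apply: ler_pM => //; first by rewrite mulr_ge0// ?(ltW C0)// addr_ge0.
      by rewrite ler_wpM2l// ?(ltW C0)//; have := ler_norm Rr; lra.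
    by rewrite Lx0 Mx0 ler_wpM2l//; apply: lerD; rewrite ler_wpM2l// mulr_ge0.
  - by rewrite lerBlDl.
have Mb : M * (h * Lb) ^+ 2 * V <= `|Mx| * Lb ^+ 2 * V * h ^+ 2.
  have -> : M * (h * Lb) ^+ 2 * V = M * (Lb ^+ 2 * V * h ^+ 2) by ring.
  have -> : `|Mx| * Lb ^+ 2 * V * h ^+ 2 = `|Mx| * (Lb ^+ 2 * V * h ^+ 2) by ring.
  by rewrite Mx0 ler_wpM2r// mulr_ge0 ?sqr_ge0// mulr_ge0// sqr_ge0.
have {}stim := le_trans stim Kb.
have {}tay := le_trans tay Mb.
rewrite /K; move: weak hs stim tay j3; rewrite /comp.
move: (C * (`|Rr| + 2) * (2 * (2 * Lb * `|Lx| + Lb * `|Mx|))) (`|Mx| * Lb ^+ 2 * V) => K1 K2.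
move: (2 * om * L * V) => K3.
move: (\int[leb1]_s' (\1_([set` `[s0, s0 + h]%R]) s' * drift w g1 g2 s'))
   (\int[leb1]_s' (\1_([set` `[s0, s0 + h]%R]) s' * beta s')).
move: (\int[leb2]_x (w (s0 + h) x * psi x)) (\int[leb2]_x (w s0 x * psi x))
  (\int[leb2]_x (w s x * eta x)) (\int[leb2]_x (w s0 x * eta x))
  (\int[leb2]_x (w s0 x * psi (Phi x))) => X1 X2 X3 X4 X5 D Bt weak hs stim tay j3.
exact: backward_step_bound hge0 weak hs stim tay j3.
Qed.

End backward_step.

(** * Iteration over a short block, then over the whole time interval *)

Section backward_iteration.
Context {R : realType}.
Implicit Types (x y u : R * R).

Section steps.
Variables (T V : R) (w : R -> R * R -> R).
Hypothesis hw : weak_flow T V w.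
Variables (be Lb G om Rr : R) (B1 B2 p11 p12 p21 p22 : R -> R * R -> R).
Hypothesis hF : smooth_field w be Lb G om Rr B1 B2 p11 p12 p21 p22.
Hypotheses (be0 : 0 <= be) (G0 : 0 <= G) (om0 : 0 <= om).

(** The caps bound the final products, hence every intermediate stage, all factors being at least 1.
    Adding [Lx] to [M] makes its affine recursion geometric: M q^2 + 2 h L Lb + Lx <= (M + Lx) q^2
    with q = 1 + 2 h Lb. *)
Lemma backward_steps (Lx Mx : R) : exists2 K, 0 <= K & forall (h s0 : R),
  0 < h -> h * be <= 1 / 2 -> 0 <= s0 ->
  forall (N : nat) psi g1 g2 (L M r : R), C11 psi g1 g2 L M r -> 0 <= r ->
  (forall x, 0 <= psi x) -> s0 + N%:R * h <= T ->
  L * (1 + 2 * h * G) ^+ N <= Lx ->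
  (M + Lx) * ((1 + 2 * h * Lb) ^+ 2) ^+ N <= Mx ->
  (r + 2) * (1 + 2 * h * be) ^+ N <= Rr + 1 ->
  (forall psi' g1' g2' (L' M' r' : R), C11 psi' g1' g2' L' M' r' -> 0 <= r' ->
     r' + 2 <= (r + 2) * (1 + 2 * h * be) ^+ N ->
     (forall x, 0 <= psi' x) -> 0 <= \int[leb2]_x (w s0 x * psi' x)) ->
  - (N%:R * (h * (2 * om * Lx * V) + K * h ^+ 2)) <=
    \int[leb2]_x (w (s0 + N%:R * h) x * psi x).
Proof.
have [K K0 hK] := backward_step hw hF be0 G0 om0 Lx Mx.
have V0 := flow_V0 hw.
have Lb0 : 0 <= Lb := C11_L0 (field_C11 hF 0).1.
exists K => // h s0 h0 hbe s00; elim=> [|N ih] psi g1 g2 L M r cp r0 psi0 sT hL hM hr hs0.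
  by rewrite !mul0r oppr0 addr0; apply: hs0 cp _ _ _ => //; rewrite expr0 mulr1.
have L0 := C11_L0 cp; have M0 := C11_M0 cp; have hge0 := ltW h0.
have qG : 1 <= 1 + 2 * h * G by rewrite lerDl !mulr_ge0.
have qL : 1 <= 1 + 2 * h * Lb by rewrite lerDl !mulr_ge0.
have qb : 1 <= 1 + 2 * h * be by rewrite lerDl !mulr_ge0.
have LLx : L <= Lx by apply: le_trans hL; rewrite ler_peMr// exprn_ege1.
have Lx0 : 0 <= Lx by apply: le_trans LLx.
have MMx : M <= Mx.
  apply: le_trans hM; apply: (@le_trans _ _ (M + Lx)); first by rewrite lerDl.
  by rewrite ler_peMr ?addr_ge0// exprn_ege1// exprn_ege1.
have r2 : 0 <= r + 2 by rewrite addr_ge0.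
have rR : (r + 2) * (1 + 2 * h * be) <= Rr + 1.
  apply: le_trans hr; rewrite exprS mulrA ler_peMr// ?exprn_ege1//.
  by rewrite mulr_ge0// (le_trans ler01).
have hN : 0 <= N%:R * h by rewrite mulr_ge0.
have eN : s0 + N.+1%:R * h = s0 + N%:R * h + h by rewrite -natr1 mulrDl mul1r addrA.
have st : s0 + N%:R * h + h <= T by rewrite -eN.
have sN0 : 0 <= s0 + N%:R * h by rewrite addr_ge0.
have [psi' [g1' [g2' [cp' pos' low]]]] :=
  hK _ _ _ _ _ _ h _ cp LLx MMx r0 h0 hbe rR sN0 st.
have r'0 : 0 <= (r + 2) * (1 + 2 * h * be) - 2.
  rewrite subr_ge0; apply: (@le_trans _ _ (r + 2)); first by rewrite lerDr.
  by rewrite ler_peMr.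
have sT' : s0 + N%:R * h <= T by apply: le_trans st; rewrite lerDl.
have := ih _ _ _ _ _ _ cp' r'0 (pos' psi0) sT'.
rewrite subrK => H.
have {}H : - (N%:R * (h * (2 * om * Lx * V) + K * h ^+ 2)) <=
    \int[leb2]_x (w (s0 + N%:R * h) x * psi' x).
  apply: H.
  - by rewrite -mulrA -exprS.
  - apply: le_trans hM; rewrite [in leRHS]exprS mulrA ler_wpM2r ?exprn_ge0 ?(le_trans ler01)//.
    have Lh : 0 <= h * Lb by rewrite mulr_ge0.
    have := ler_wpM2r Lh LLx; have := mulr_ge0 Lx0 Lh; have := mulr_ge0 Lx0 (sqr_ge0 (h * Lb)).
    by nra.
  - by rewrite -mulrA -exprS.
  - by move=> *; apply: hs0; eauto; rewrite exprS mulrA.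
rewrite eN; apply: le_trans low.
have omL : h * (2 * om * L * V) <= h * (2 * om * Lx * V).
  by rewrite ler_wpM2l// ler_wpM2r// ler_wpM2l// mulr_ge0.
move: H omL; rewrite -natr1 mulrDl mul1r.
move: (\int[leb2]_x (w (s0 + N%:R * h) x * psi' x)) => I H omL.
lra.
Qed.

End steps.

Lemma expr_le_expR (a : R) (N : nat) : 0 <= a -> (1 + a) ^+ N <= expR (N%:R * a).
Proof.
move=> a0; rewrite mulrC expRM_natr lerXn2r ?nnegrE ?expR_ge0 ?addr_ge0//.
exact: expR_ge1Dx.
Qed.

(** Bernoulli's inequality for (5/4)^n trades the linear factor for the larger ratio 15/16, the
    product of 5/4 and 3/4. *)
Lemma geometric_beats_linear (n : nat) : n.+1%:R * (3 / 4) ^+ n <= 4 * (15 / 16) ^+ n :> R.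
Proof.
have h : 4 + n%:R <= 4 * (5 / 4) ^+ n :> R.
  elim: n => [|n ih]; first by rewrite expr0; lra.
  rewrite exprS -[n.+1%:R]natr1; have n0 : 0 <= n%:R :> R by exact: ler0n.
  by move: ih; move: ((5 / 4) ^+ n) => q ih; lra.
have -> : 15 / 16 = (5 / 4) * (3 / 4) :> R by field.
rewrite [(5 / 4 * (3 / 4)) ^+ n]exprMn [leRHS]mulrA ler_wpM2r ?exprn_ge0//; last by lra.
Qed.

Variables (T V : R) (w : R -> R * R -> R).
Hypothesis hw : weak_flow T V w.

(** Pulling a test function back from t to 0 multiplies r + 2 by at most exp(2 be t); the radius
    must stay below Rr - 1, where the mollified field is close to the velocity, hence the bound Rr +
    1. *)
Definition nonneg_upto (be Rr t : R) := forall psi g1 g2 (L M r : R),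
  C11 psi g1 g2 L M r -> 0 <= r -> (r + 2) * expR (2 * be * t) <= Rr + 1 ->
  (forall x, 0 <= psi x) -> 0 <= \int[leb2]_x (w t x * psi x).

Lemma nonneg_block (be Rr Lam s0 t : R) : 0 <= be -> 0 <= Lam ->
  (forall n : nat, exists2 Lb, 0 <= Lb & exists B1 B2 p11 p12 p21 p22,
     smooth_field w be Lb (Lam * n.+1%:R) (Lam * n.+1%:R * (2 ^+ n)^-1) Rr
       B1 B2 p11 p12 p21 p22) ->
  0 <= s0 -> s0 < t -> t <= T -> expR (2 * Lam * (t - s0)) <= 3 / 2 ->
  nonneg_upto be Rr s0 -> nonneg_upto be Rr t.
Proof.
move=> be0 Lam0 hF s00 st tT small ihs psi g1 g2 L M r cp r0 rR psi0.
have V0 := flow_V0 hw; have L0 := C11_L0 cp; have M0 := C11_M0 cp.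
set tau := t - s0 in small.
have tau0 : 0 < tau by rewrite subr_gt0.
set I := \int[leb2]_x _.
(* From tau (2 om Lx V) with om = Lam (n + 1) / 2^n and Lx = L (3/2)^(n+1), as [eE] verifies. *)
pose c := 3 * tau * Lam * L * V.
have c0 : 0 <= c by rewrite !mulr_ge0// ltW.
suff In n : - (c * (n.+1%:R * (3 / 4) ^+ n)) <= I.
  have h n : - (4 * c) * (15 / 16) ^+ n <= I.
    apply: le_trans (In n); rewrite mulNr lerN2 (mulrC 4) -[leRHS]mulrA.
    by rewrite ler_wpM2l// geometric_beats_linear.
  have q1 : `|(15 / 16 : R)| < 1 by rewrite ger0_norm; lra.
  have cv := cvg_expr q1.
  have cv2 : (fun n : nat => - (4 * c) * (15 / 16) ^+ n) @ \oo --> (- (4 * c) * 0 : R).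
    by apply: cvgM => //; exact: cvg_cst.
  by have := cvgn_le cv2 h; rewrite mulr0.
have [Lb Lb0 [B1 [B2 [p11 [p12 [p21 [p22 F]]]]]]] := hF n.
set G := Lam * n.+1%:R in F; set om := G * _ in F.
have G0 : 0 <= G by rewrite mulr_ge0.
have om0 : 0 <= om by rewrite mulr_ge0// invr_ge0 exprn_ge0.
(* The gradient grows at most by exp(2 G tau), the power n + 1 of exp(2 Lam tau), which [small]
   bounds by 3 / 2. *)
pose Lx := L * (3 / 2) ^+ n.+1.
pose Mx := (M + Lx) * expR (4 * Lb * tau).
have Lx0 : 0 <= Lx by rewrite mulr_ge0// exprn_ge0//; lra.
have [K K0 hK] := backward_steps hw F be0 G0 om0 Lx Mx.
have eE : c * (n.+1%:R * (3 / 4) ^+ n) = tau * (2 * om * Lx * V).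
  have e : (3 / 4) ^+ n = (3 / 2) ^+ n * (2 ^+ n)^-1 :> R by rewrite -exprVn -exprMn; congr (_ ^+ _); field.
  rewrite /c /om /G /Lx exprS e; field.
  by rewrite expf_neq0.
rewrite eE.
apply: (@le_of_le_small _ _ _ (K * tau)); first by rewrite mulr_ge0// ltW.
move=> d d0 _.
(* Enough steps for both h <= d and h be <= 1 / 2. *)
pose N := (Num.truncn (tau / d + 2 * tau * be)).+1.
have N0 : (0 : R) < N%:R by rewrite ltr0n.
have hN : tau / d + 2 * tau * be < N%:R by exact: truncnS_gt.
pose h := tau / N%:R.
have h0 : 0 < h by rewrite divr_gt0.
have Nh : N%:R * h = tau by rewrite /h mulrC divfK ?gt_eqF.
have tb0 : 0 <= 2 * tau * be by rewrite !mulr_ge0// ltW.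
have td0 : 0 <= tau / d by rewrite divr_ge0// ltW.
have hd : h <= d.
  rewrite /h ler_pdivrMr// mulrC -ler_pdivrMr//; lra.
have hbe : h * be <= 1 / 2.
  by rewrite /h mulrAC ler_pdivrMr//; lra.
have sN : s0 + N%:R * h = t by rewrite Nh /tau addrC subrK.
have hge0 := ltW h0.
have a1 : 0 <= 2 * h * be by apply: mulr_ge0 => //; apply: mulr_ge0.
have a2 : 0 <= 2 * h * G by apply: mulr_ge0 => //; apply: mulr_ge0.
have a3 : 0 <= 2 * h * Lb by apply: mulr_ge0 => //; apply: mulr_ge0.
have rexp : (r + 2) * (1 + 2 * h * be) ^+ N <= (r + 2) * expR (2 * be * tau).
  rewrite ler_wpM2l ?addr_ge0//; apply: le_trans (expr_le_expR N a1) _.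
  by rewrite -Nh le_eqVlt; apply/orP; left; apply/eqP; congr expR; ring.
have rt : (r + 2) * expR (2 * be * tau) * expR (2 * be * s0) <= Rr + 1.
  rewrite -mulrA -expRD; apply: le_trans rR; rewrite le_eqVlt; apply/orP; left; apply/eqP.
  by congr (_ * expR _); rewrite /tau; ring.
have es1 : 1 <= expR (2 * be * s0) by rewrite -expR0 ler_expR !mulr_ge0.
have := hK h s0 h0 hbe s00 N psi g1 g2 L M r cp r0 psi0.
rewrite sN => /(_ tT) H.
have {H} : - (N%:R * (h * (2 * om * Lx * V) + K * h ^+ 2)) <= I.
  apply: H.
  - apply: ler_wpM2l => //; apply: le_trans (expr_le_expR N a2) _.
    have -> : N%:R * (2 * h * G) = n.+1%:R * (2 * Lam * tau) by rewrite -Nh /G; ring.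
    rewrite mulrC expRM_natr lerXn2r ?nnegrE ?expR_ge0//; lra.
  - rewrite /Mx ler_wpM2l ?addr_ge0// -exprM.
    apply: le_trans (expr_le_expR (2 * N) a3) _.
    rewrite natrM -Nh le_eqVlt; apply/orP; left; apply/eqP; congr expR; ring.
  - apply: le_trans rexp _; apply: le_trans rt; rewrite ler_peMr// mulr_ge0 ?expR_ge0// addr_ge0//.
  - move=> psi' g1' g2' L' M' r' cp' r'0 r'le psi'0; apply: (ihs _ _ _ _ _ _ cp') => //.
    by apply: le_trans rt; rewrite ler_wpM2r ?expR_ge0//; exact: le_trans r'le rexp.
have -> : N%:R * (h * (2 * om * Lx * V) + K * h ^+ 2) = tau * (2 * om * Lx * V) + K * tau * h.
  by rewrite -Nh; ring.
have : K * tau * h <= K * tau * d by rewrite ler_wpM2l// mulr_ge0// ltW.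
by move: I (2 * om * Lx * V) => I E; lra.
Qed.

Lemma weak_flow_nonneg : {ae leb2, forall x, 0 <= w 0 x} -> forall t, 0 <= t <= T ->
  forall psi g1 g2 (L M r : R), C11 psi g1 g2 L M r -> (forall x, 0 <= psi x) ->
  0 <= \int[leb2]_x (w t x * psi x).
Proof.
move=> w0 t0 /andP[t00 t0T] psi0 h1 h2 L0 M0 r0 cp0 pos0.
have V0 := flow_V0 hw.
pose be := 34 * V; have be0 : 0 <= be by rewrite mulr_ge0.
pose r0' := Num.max r0 0.
have r00 : 0 <= r0' by rewrite le_max lexx orbT.
have {}cp0 : C11 psi0 h1 h2 L0 M0 r0' by apply: C11_le cp0; rewrite ?lexx// le_max lexx.
(* Room for the support to grow over the whole of [0, T]. *)
pose Rr := (r0' + 2) * expR (2 * be * T).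
have Rr0 : 0 <= Rr by rewrite mulr_ge0 ?expR_ge0// addr_ge0.
have [Lam Lam0 hF] := smooth_field_exists hw Rr0.
(* [Lam] depends on [Rr] but not on the scale, so finitely many blocks of this length cover [0, T];
   the + 1 keeps the denominator positive. *)
pose tau0 := ln (3 / 2) / (2 * Lam + 1) : R.
have ln0 : 0 < ln (3 / 2 : R) by rewrite ln_gt0//; lra.
have tau00 : 0 < tau0 by rewrite divr_gt0// ltr_wpDl// mulr_ge0.
have small (s : R) : 0 <= s -> s <= tau0 -> expR (2 * Lam * s) <= 3 / 2.
  have p : (3 / 2 : R) \is Num.pos by rewrite posrE; lra.
  move=> s0 st; rewrite -[leRHS](lnK p).
  rewrite ler_expR; apply: (@le_trans _ _ (2 * Lam * tau0)).
    by rewrite ler_wpM2l// mulr_ge0.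
  rewrite /tau0 mulrA ler_pdivrMr; last by rewrite ltr_wpDl// mulr_ge0.
  by rewrite mulrC ler_wpM2l ?(ltW ln0)// lerDl.
have claim (k : nat) t : 0 <= t -> t <= T -> t <= k%:R * tau0 -> nonneg_upto be Rr t.
  elim: k t => [|k ih] t tt0 tT tk.
    have -> : t = 0 by apply: le_anti; rewrite tt0 andbT -[leRHS](mul0r tau0).
    move=> psi g1 g2 L M r cp _ _ pos.
    have [iw _] := controlled_integrable (flow_controlled hw 0).
    have [m _ _] := C11_measurable cp; have [B hB] := C11_bounded cp.
    have i := integrM m iw hB.
    have e : \int[@leb2 R]_x (0 : R) = 0 by rewrite Rintegral_cst// mul0r.
    rewrite -[leLHS]e.
    apply: (@ae_le_Rint _ _ R leb2) => //; first exact: integrable0.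
    by apply: filterS w0 => x hx; rewrite mulr_ge0.
  have [tk'|tk'] := leP t (k%:R * tau0); first exact: ih.
  pose s0 := Num.max 0 (t - tau0).
  have s0t : s0 < t.
    rewrite gt_max ltrBlDr ltrDl tau00 andbT.
    by apply: le_lt_trans tk'; rewrite mulr_ge0// ltW.
  have s00 : 0 <= s0 by rewrite le_max lexx.
  apply: (nonneg_block be0 Lam0 hF s00 s0t tT).
    apply: small; first by rewrite subr_ge0 ltW.
    by rewrite lerBlDl -lerBlDr le_max lexx orbT.
  apply: ih => //; first exact: ltW (lt_le_trans s0t tT).
  rewrite ge_max mulr_ge0 ?(ltW tau00)//= lerBlDr.
  by apply: le_trans tk _; rewrite -natr1 mulrDl mul1r.
pose k := (Num.truncn (T / tau0)).+1.
apply: (claim k t0 t00 t0T _ psi0 h1 h2 L0 M0 r0' cp0 r00) => //.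
  rewrite -ler_pdivrMr//; apply: le_trans (ltW (truncnS_gt _)).
  by rewrite ler_wpM2r// invr_ge0 ltW.
apply: (@le_trans _ _ Rr); last by rewrite lerDl.
by rewrite /Rr ler_wpM2l ?addr_ge0// ler_expR ler_wpM2l// mulr_ge0.
Qed.

End backward_iteration.

(** * Conservation of mass and of the second moment *)

Section conservation_laws.
Context {R : realType}.
Implicit Types (x y u : R * R) (psi : R * R -> R).

Lemma controlled_sqweight g (V : R) : controlled g V ->
  forall f (C : R), measurable_fun setT (f : @plane R -> R) -> (forall x, `|f x| <= C * sqweight x) ->
  leb2.-integrable setT (EFin \o (fun x => g x * f x)).
Proof.
move=> [mg iv _ _] f C mf fC.
apply: (@integr_le _ _ _ leb2 _ (fun x => C * (sqweight x * `|g x|))).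
- exact: measurable_funM.
- exact: integrZ.
by move=> x; rewrite normrM mulrC mulrA ler_wpM2r.
Qed.

Lemma cvg_Rint_controlled g (V : R) : controlled g V ->
  forall (f : nat -> R * R -> R) (F : R * R -> R) (C : R),
  (forall n, measurable_fun setT (f n : @plane R -> R)) ->
  measurable_fun setT (F : @plane R -> R) ->
  (forall n x, `|f n x| <= C * sqweight x) -> (forall x, f ^~ x @ \oo --> F x) ->
  (fun n => \int[leb2]_x (g x * f n x)) @ \oo --> \int[leb2]_x (g x * F x).
Proof.
move=> [mg iv _ _] f F C mf mF fC cv.
apply: (@cvg_Rint _ _ R leb2 _ _ (fun x => C * (sqweight x * `|g x|))).
- by move=> n; exact: measurable_funM.
- exact: measurable_funM.
- exact: integrZ.
- by move=> n x; rewrite normrM mulrC mulrA ler_wpM2r.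
- by move=> x; apply: cvgM; [exact: cvg_cst|exact: cv].
Qed.

Section conservation.
Variables (T V : R) (w : R -> R * R -> R).
Hypothesis hw : weak_flow T V w.

(** Dominated convergence in space, then in time. For psi of quadratic growth with gradient of
    linear growth, the linear growth of the velocity gives a flux bounded by a multiple of <x>^2,
    the weight under which w is integrable uniformly in time. *)
Lemma conservation (psi : nat -> R * R -> R) (g1 g2 : nat -> R * R -> R)
    (P Q1 Q2 : R * R -> R) (C t : R) :
  (forall n, exists L M r, 0 <= r /\ C11 (psi n) (g1 n) (g2 n) L M r) ->
  measurable_fun setT (P : plane -> R) ->
  measurable_fun setT (Q1 : plane -> R) -> measurable_fun setT (Q2 : plane -> R) ->
  (forall n x, [/\ `|psi n x| <= C * sqweight x, `|g1 n x| <= C * (1 + `|x|) &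
     `|g2 n x| <= C * (1 + `|x|)]) ->
  (forall x, [/\ psi ^~ x @ \oo --> P x, g1 ^~ x @ \oo --> Q1 x & g2 ^~ x @ \oo --> Q2 x]) ->
  (forall s, drift w Q1 Q2 s = 0) -> 0 <= t <= T ->
  \int[leb2]_x (w t x * P x) = \int[leb2]_x (w 0 x * P x).
Proof.
move=> hC mP mQ1 mQ2 hb hcv drift0 /andP[t0 tT].
have V0 := flow_V0 hw.
have C0 : 0 <= C by have [h _ _] := hb 0%N 0; move: (le_trans (normr_ge0 _) h); rewrite pmulr_lge0 ?sqweight_gt0.
have mn n : [/\ measurable_fun setT (psi n : plane -> R), measurable_fun setT (g1 n : plane -> R) &
    measurable_fun setT (g2 n : plane -> R)].
  by have [L [M [r [_ h]]]] := hC n; exact: C11_measurable h.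
have lim s : (fun n => \int[leb2]_x (w s x * psi n x)) @ \oo --> \int[leb2]_x (w s x * P x).
  apply: (cvg_Rint_controlled (flow_controlled hw s) (C := C)) => //.
  - by move=> n; have [] := mn n.
  - by move=> n x; have [] := hb n x.
  - by move=> x; have [] := hcv x.
(* Two products, together with (1 + |x|)^2 <= 8<x>^2. *)
pose D := 34 * V * C * 16.
have D0 : 0 <= D by rewrite !mulr_ge0.
have flux s n x : `|(H (w s) x).1 * g1 n x + (H (w s) x).2 * g2 n x| <= D * sqweight x.
  have [mg iv vV1 vVoo] := flow_controlled hw s.
  have [h1 h2] := H_le mg iv vV1 vVoo x.
  have [_ b1 b2] := hb n x; have n1 := norm_le_sqweight x.
  have nx : (1 + `|x|) ^+ 2 <= 8 * sqweight x.
    have x2 : `|x| ^+ 2 <= sqweight x.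
      rewrite plane_normE /sqweight; have s1 := sqr_ge0 x.1; have s2 := sqr_ge0 x.2.
      by rewrite /Num.max; case: ifP => _; rewrite real_normK ?num_real//; lra.
    have sg := sqweight_ge1 x.
    have := sqr_ge0 (1 - `|x|); lra.
  move: h1 h2 b1 b2 nx; move: (H (w s) x).1 (H (w s) x).2 (g1 n x) (g2 n x) => a b c d h1 h2 b1 b2 nx.
  apply: le_trans (ler_normD _ _) _; rewrite !normrM.
  apply: (@le_trans _ _ (2 * (34 * V * C) * (1 + `|x|) ^+ 2)).
    have -> : 2 * (34 * V * C) * (1 + `|x|) ^+ 2 =
      34 * V * (1 + `|x|) * (C * (1 + `|x|)) + 34 * V * (1 + `|x|) * (C * (1 + `|x|)) by ring.
    by apply: lerD; apply: ler_pM.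
  have -> : D * sqweight x = 2 * (34 * V * C) * (8 * sqweight x) by rewrite /D; ring.
  by rewrite ler_wpM2l// !mulr_ge0.
have mH s := flow_measurable_Hs hw s.
have mfl s n : measurable_fun setT ((fun x => (H (w s) x).1 * g1 n x + (H (w s) x).2 * g2 n x) : plane -> R).
  have [_ m1 m2] := mn n; have [a1 a2] := mH s.
  by apply: measurable_funD; exact: measurable_funM.
have dlim s : (fun n => drift w (g1 n) (g2 n) s) @ \oo --> (0 : R).
  rewrite -(drift0 s).
  apply: (cvg_Rint_controlled (flow_controlled hw s) (mfl s) _ (fun n x => flux s n x)).
    have [a1 a2] := mH s.
    by apply: measurable_funD; exact: measurable_funM.
  move=> x; have [_ c1 c2] := hcv x.
  by apply: cvgD; apply: cvgM => //; exact: cvg_cst.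
have dle s n : `|drift w (g1 n) (g2 n) s| <= D * V.
  have [mg iv vV1 vVoo] := flow_controlled hw s.
  have iD := integrZ D iv.
  apply: le_trans (_ : \int[leb2]_x (D * (sqweight x * `|w s x|)) <= _); last first.
    by rewrite (RintZ D iv) ler_wpM2l.
  apply: norm_Rint_le => //; first exact: measurable_funM mg (mfl s n).
  by move=> x; rewrite normrM mulrC mulrA ler_wpM2r.
pose I : set R := [set` `[0, t]%R].
have mI : measurable (I : set (measurableTypeR R)) by exact: measurable_itv.
have mId : measurable_fun setT (\1_I : measurableTypeR R -> R) by exact: measurable_indic.
have md n : measurable_fun setT (drift w (g1 n) (g2 n) : measurableTypeR R -> R).
  by have [_ m1 m2] := mn n; exact: (measurable_drift hw m1 m2).
have mDV : measurable_fun setT (cst (D * V) : measurableTypeR R -> R) by exact: measurable_cst.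
have [iDV _] := time_integral_le t0 mDV (fun s => lexx `|D * V|).
have tlim : (fun n => \int[leb1]_s (\1_I s * drift w (g1 n) (g2 n) s)) @ \oo -->
    \int[leb1]_s (0 : R).
  apply: (@cvg_Rint _ _ R leb1 _ _ (fun s => \1_I s * (D * V))) => //.
  - by move=> n; exact: measurable_funM.
  - move=> n s; have h0 : 0 <= \1_I s :> R by rewrite indicE ler0n.
    by rewrite normrM (ger0_norm h0) ler_wpM2l.
  - move=> s; rewrite -[X in _ --> X](mulr0 (\1_I s)).
    by apply: cvgM; [exact: cvg_cst|exact: dlim].
rewrite Rintegral_cst// mul0r in tlim.
have e n : \int[leb2]_x (w t x * psi n x) - \int[leb2]_x (w 0 x * psi n x) =
    \int[leb1]_s (\1_I s * drift w (g1 n) (g2 n) s).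
  have [L [M [r [r0 h]]]] := hC n.
  by apply: (weak_C11 hw r0 h); rewrite t0.
have lim2 := cvgB (lim t) (lim 0).
have {}lim2 : (fun n => \int[leb1]_s (\1_I s * drift w (g1 n) (g2 n) s)) @ \oo -->
    \int[leb2]_x (w t x * P x) - \int[leb2]_x (w 0 x * P x).
  by rewrite -(funext e); exact: lim2.
apply/eqP; rewrite -subr_eq0; apply/eqP.
exact: (cvg_unique _ lim2 tlim).
Qed.

End conservation.
End conservation_laws.

(** * Cutoffs and the two conserved quantities *)

Section moments.
Context {R : realType}.
Implicit Types (x y u : R * R) (psi : R * R -> R).

Lemma C11_tensor (al be : R -> R) (s : R) : smooth al -> smooth be ->
  supp_in s al -> supp_in s be -> exists L M,
  C11 (fun x => al x.1 * be x.2) (fun x => al^`()%classic x.1 * be x.2)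
    (fun x => al x.1 * be^`()%classic x.2) L M s.
Proof.
move=> sal sbe pal pbe.
have [A [a0 [a1 [a2 [b0 [b1 b2]]]]]] : exists A : R, (forall t, `|al t| <= A) /\
    (forall t, `|al^`()%classic t| <= A) /\ (forall t, `|al^`(2)%classic t| <= A) /\
    (forall t, `|be t| <= A) /\
    (forall t, `|be^`()%classic t| <= A) /\ (forall t, `|be^`(2)%classic t| <= A).
  have ba n := (smooth_deriven_bounded n sal pal).2.
  have bb n := (smooth_deriven_bounded n sbe pbe).2.
  have [A1 h1] := ba 0%N; have [A2 h2] := ba 1%N; have [A3 h3] := ba 2%N.
  have [A4 h4] := bb 0%N; have [A5 h5] := bb 1%N; have [A6 h6] := bb 2%N.
  rewrite derive1n0 in h1 h4; rewrite derive1n1 in h2 h5.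
  have p1 := le_trans (normr_ge0 _) (h1 0); have p2 := le_trans (normr_ge0 _) (h2 0).
  have p3 := le_trans (normr_ge0 _) (h3 0); have p4 := le_trans (normr_ge0 _) (h4 0).
  have p5 := le_trans (normr_ge0 _) (h5 0); have p6 := le_trans (normr_ge0 _) (h6 0).
  exists (A1 + A2 + A3 + A4 + A5 + A6).
  split; [|split; [|split; [|split; [|split]]]] => t.
  - by apply: le_trans (h1 t) _; lra.
  - by apply: le_trans (h2 t) _; lra.
  - by apply: le_trans (h3 t) _; lra.
  - by apply: le_trans (h4 t) _; lra.
  - by apply: le_trans (h5 t) _; lra.
  - by apply: le_trans (h6 t) _; lra.
have da0 := (smooth_derive sal).1; have db0 := (smooth_derive sbe).1.
have da1 := (smooth_deriven 1 sal).1; have db1 := (smooth_deriven 1 sbe).1.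
rewrite derive1n1 in da1 db1.
have A0 : 0 <= A by apply: le_trans (a0 0).
have A20 : 0 <= A ^+ 2 by exact: sqr_ge0.
have bnd (p q : R) : `|p| <= A -> `|q| <= A -> `|p * q| <= A ^+ 2.
  by move=> pA qA; rewrite normrM expr2; apply: ler_pM.
exists (A ^+ 2), (3 * A ^+ 2); split.
- by move=> x; split; exact: bnd.
- move=> x u; have le23 : 2 * A ^+ 2 * `|u| <= 3 * A ^+ 2 * `|u|.
    by rewrite ler_wpM2r//; lra.
  split; apply: le_trans le23.
    exact: (tensor_lip da1 db0 a1 a2 b0 b1 x.1 x.2 (plane_norm1 u) (plane_norm2 u)).
  exact: (tensor_lip da0 db1 a0 a1 b1 b2 x.1 x.2 (plane_norm1 u) (plane_norm2 u)).
- move=> x u.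
  exact: (tensor_taylor da0 da1 db0 db1 a0 a1 a2 b0 b1 b2 x.1 x.2 (plane_norm1 u) (plane_norm2 u)).
- move=> x; rewrite ltNge plane_norm_le negb_and -!ltNge => /orP[] h.
    by rewrite pal// (supp_in_derive sal pal)// !mul0r.
  by rewrite pbe// (supp_in_derive sbe pbe)// !mulr0.
Qed.

Lemma C11_add psi g1 g2 psi' g1' g2' (L M L' M' r : R) :
  C11 psi g1 g2 L M r -> C11 psi' g1' g2' L' M' r ->
  C11 (fun x => psi x + psi' x) (fun x => g1 x + g1' x) (fun x => g2 x + g2' x)
    (L + L') (M + M') r.
Proof.
move=> h h'; split.
- move=> x; have [a b] := C11_grad h x; have [c d] := C11_grad h' x.
  by split; apply: le_trans (ler_normD _ _) _; exact: lerD.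
- move=> x u; have [a b] := C11_grad_lip h x u; have [c d] := C11_grad_lip h' x u.
  by rewrite !mulrDl; split; rewrite opprD addrACA; apply: le_trans (ler_normD _ _) _; exact: lerD.
- move=> x u; have a := C11_taylor h x u; have c := C11_taylor h' x u.
  have -> : psi (x + u) + psi' (x + u) - (psi x + psi' x) -
      ((g1 x + g1' x) * u.1 + (g2 x + g2' x) * u.2) =
    (psi (x + u) - psi x - (g1 x * u.1 + g2 x * u.2)) +
    (psi' (x + u) - psi' x - (g1' x * u.1 + g2' x * u.2)) by ring.
  by rewrite mulrDl; apply: le_trans (ler_normD _ _) _; exact: lerD.
- by move=> x xr; have [-> -> ->] := C11_supp h xr; have [-> -> ->] := C11_supp h' xr; rewrite addr0.
Qed.

(** Equal to 1 for |s| <= n + 1 and to 0 for |s| >= 2 (n + 1); the trailing + 0 matches the shape of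
    [Cder_affine]. *)
Definition cutoff (n : nat) (s : R) : R := plateau 0 (n.+1%:R^-1 * s + 0).

Lemma smooth_cutoff n : smooth (cutoff n).
Proof. by move=> k; apply: Cder_affine; exact: smooth_plateau. Qed.

Lemma cutoff_bounds n s : 0 <= cutoff n s <= 1.
Proof. by rewrite plateau_ge0 plateau_le1. Qed.

Lemma cutoff1 n s : `|s| <= n.+1%:R -> cutoff n s = 1.
Proof.
move=> sn; have n0 : (0 : R) < n.+1%:R by rewrite ltr0n.
have : `|n.+1%:R^-1 * s| <= 1.
  by rewrite normrM gtr0_norm ?invr_gt0// mulrC ler_pdivrMr// mul1r.
rewrite /cutoff addr0; move: (n.+1%:R^-1 * s) => z.
by rewrite ler_norml => /andP[h1 h2]; apply: plateau1; lra.
Qed.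

Lemma supp_in_cutoff n : supp_in (2 * n.+1%:R) (cutoff n).
Proof.
move=> s sn; have n0 : (0 : R) < n.+1%:R by rewrite ltr0n.
apply: plateau0; have : 2 <= `|n.+1%:R^-1 * s|.
  by rewrite normrM gtr0_norm ?invr_gt0// mulrC ler_pdivlMr// ltW.
by rewrite addr0 add0r ler_normr => /orP[h|h]; apply/orP; [left|right; rewrite lerNr].
Qed.

Lemma cutoff_derive : exists2 A, 0 < A & forall n s, `|(cutoff n)^`()%classic s| <= A / n.+1%:R.
Proof.
have [A A0 hA] := smooth_bounded (smooth_derive (@smooth_plateau R 0)).2
  (supp_in_derive (@smooth_plateau R 0) (@supp_in_plateau R 0)).
exists A => // n s; have n0 : (0 : R) < n.+1%:R by rewrite ltr0n.
have -> : (cutoff n)^`()%classic s = (plateau 0)^`()%classic (n.+1%:R^-1 * s + 0) * n.+1%:R^-1.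
  apply: derive1_unique.
  have [dp _] := smooth_derive (@smooth_plateau R 0).
  exact: (@is_derive_compf R (plateau 0) (fun t => n.+1%:R^-1 * t + 0) s _ _
    (dp (n.+1%:R^-1 * s + 0)) (is_derive_affine n.+1%:R^-1 0 s)).
by rewrite normrM [X in _ * X]gtr0_norm ?invr_gt0// ler_wpM2r// invr_ge0 ltW.
Qed.

Lemma cutoff_cvg s : cutoff ^~ s @ \oo --> (1 : R).
Proof.
apply: cvg_near_cst; near=> n; apply: cutoff1.
apply: (@le_trans _ _ n%:R); last by rewrite ler_nat.
by near: n; exact: nbhs_infty_ger.
Unshelve. all: by end_near. Qed.

Lemma cutoff_derive_cvg s : (fun n => (cutoff n)^`()%classic s) @ \oo --> (0 : R).
Proof.
have [A A0 hA] := cutoff_derive.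
have h1 : (fun n : nat => A * harmonic n) @ \oo --> (0 : R).
  by rewrite -[X in _ --> X](mulr0 A); apply: cvgM; [exact: cvg_cst|exact: cvg_harmonic].
have h2 : (fun n : nat => - (A * harmonic n)) @ \oo --> (0 : R).
  by rewrite -[X in _ --> X]oppr0; exact: cvgN.
apply: (squeeze_cvgr _ h2 h1); apply: nearW => n.
by have := hA n s; rewrite ler_norml.
Qed.

Section conserved.
Variables (T V : R) (w : R -> R * R -> R).
Hypothesis hw : weak_flow T V w.

(** The gradients of the cutoffs are bounded and tend to 0 pointwise, so the limiting drift is that
    of the zero field. *)
Lemma mass_conservation t : 0 <= t <= T -> \int[leb2]_x w t x = \int[leb2]_x w 0 x.
Proof.
move=> tT; have [A A0 hA] := cutoff_derive.
have e s : \int[leb2]_x w s x = \int[leb2]_x (w s x * 1).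
  by apply: eq_Rint => x; rewrite mulr1.
rewrite !e.
have cb n s : `|cutoff n s| <= 1 by have /andP[h0 h1] := cutoff_bounds n s; rewrite ger0_norm.
have hA1 n s : `|(cutoff n)^`()%classic s| <= A.
  apply: le_trans (hA n s) _; rewrite ler_pdivrMr ?ltr0n//.
  by rewrite ler_peMr ?ler1n ?(ltW A0).
apply: (conservation hw (psi := fun n x => cutoff n x.1 * cutoff n x.2)
  (g1 := fun n x => (cutoff n)^`()%classic x.1 * cutoff n x.2)
  (g2 := fun n x => cutoff n x.1 * (cutoff n)^`()%classic x.2)
  (P := fun=> 1) (Q1 := fun=> 0) (Q2 := fun=> 0) (C := 1 + A)) => //.
- move=> n; have [L [M h]] := C11_tensor (@smooth_cutoff n) (@smooth_cutoff n)
    (@supp_in_cutoff n) (@supp_in_cutoff n).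
  by exists L, M, (2 * n.+1%:R); split => //; rewrite mulr_ge0.
- have nn (p q : R) : `|p| <= 1 -> `|q| <= A -> `|p * q| <= A.
    by move=> hp hq; rewrite normrM -[leRHS]mul1r; apply: ler_pM.
  move=> n x; have x0 : A <= (1 + A) * (1 + `|x|).
    by have := mulr_ge0 (ltW A0) (normr_ge0 x); have := normr_ge0 x; lra.
  split.
  + have : `|cutoff n x.1 * cutoff n x.2| <= 1.
      by rewrite normrM -[leRHS]mul1r; apply: ler_pM.
    move=> /le_trans; apply; rewrite -[leLHS]mul1r; apply: ler_pM => //; first by rewrite lerDl ltW.
    exact: sqweight_ge1.
  + by rewrite mulrC; apply: le_trans (nn _ _ _ _) x0.
  + by apply: le_trans (nn _ _ _ _) x0.
- move=> x; split.
  + by rewrite -[X in _ --> X]mul1r; apply: cvgM; exact: cutoff_cvg.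
  + by rewrite -[X in _ --> X](mul0r 1); apply: cvgM; [exact: cutoff_derive_cvg|exact: cutoff_cvg].
  + by rewrite -[X in _ --> X](mulr0 1); apply: cvgM; [exact: cutoff_cvg|exact: cutoff_derive_cvg].
- move=> s; rewrite /drift (eq_Rint leb2 (g := fun=> 0)); first by rewrite Rintegral_cst// mul0r.
  move=> x; move: (w s x) (H (w s) x).1 (H (w s) x).2 => *; ring.
Qed.

(** Half of |x|^2 has gradient x, so the limiting drift is the integral that [angular_cancellation]
    shows to vanish. *)
Lemma moment_conservation t : 0 <= t <= T ->
  \int[leb2]_x (w t x * (x.1 ^+ 2 + x.2 ^+ 2)) = \int[leb2]_x (w 0 x * (x.1 ^+ 2 + x.2 ^+ 2)).
Proof.
move=> tT; have [A A0 hA] := cutoff_derive.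
have mx1 : measurable_fun setT ((fun x => x.1) : @plane R -> R) by exact: measurable_fst.
have mx2 : measurable_fun setT ((fun x => x.2) : @plane R -> R) by exact: measurable_snd.
have mh : measurable_fun setT ((fun x => (1 / 2) * (x.1 ^+ 2 + x.2 ^+ 2)) : @plane R -> R).
  by apply: measurable_funM => //; apply: measurable_funD; exact: measurable_funX.
have e s : \int[leb2]_x (w s x * (x.1 ^+ 2 + x.2 ^+ 2)) =
    2 * \int[leb2]_x (w s x * ((1 / 2) * (x.1 ^+ 2 + x.2 ^+ 2))).
  have i := controlled_sqweight (flow_controlled hw s) (C := 1 / 2) mh _.
  rewrite -(@RintZ _ _ R leb2); first by apply: eq_Rint => x; field.
  apply: i => x; have s1 := sqr_ge0 x.1; have s2 := sqr_ge0 x.2.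
  by rewrite ger0_norm ?mulr_ge0 ?addr_ge0// ler_wpM2l// /sqweight; lra.
rewrite !e; congr (2 * _).
have cb n s : `|cutoff n s| <= 1 by have /andP[h0 h1] := cutoff_bounds n s; rewrite ger0_norm.
pose sq n (s : R) := 1 / 2 * (s * s) * cutoff n s.
pose sq' n (s : R) := s * cutoff n s + 1 / 2 * (s * s) * (cutoff n)^`()%classic s.
have ssq n : smooth (sq n).
  apply: smoothM; last exact: smooth_cutoff.
  apply: smoothM; first by move=> k; exact: Cder_cst.
  by apply: smoothM; exact: smooth_id.
have dsq n s : (sq n)^`()%classic s = sq' n s.
  apply: derive1_unique; have [dc _] := smooth_derive (@smooth_cutoff n).
  have d1 : is_derive s 1 (fun s : R => 1 / 2 * (s * s)) s.
    apply: (@is_derive_quadratic _ _ _ _ (1 / 2) 1) => // h _.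
    have -> : 1 / 2 * ((s + h) * (s + h)) - 1 / 2 * (s * s) - s * h = 1 / 2 * h ^+ 2 by field.
    by rewrite ger0_norm// mulr_ge0// sqr_ge0.
  exact: (is_deriveMf d1 (dc s)).
have psq n : supp_in (2 * n.+1%:R) (sq n).
  by move=> s sn; rewrite /sq supp_in_cutoff// mulr0.
have bsq n s : `|sq n s| <= s ^+ 2.
  rewrite /sq normrM; apply: le_trans (_ : `|1 / 2 * (s * s)| * 1 <= _); first by rewrite ler_wpM2l.
  have s2 := sqr_ge0 s; rewrite mulr1 -expr2 ger0_norm; last by apply: mulr_ge0.
  move: s2; move: (s ^+ 2) => z; lra.
(* The derivative of the cutoff is [O(1/n)] and lives where [s <= 2 n]. *)
have bdc n s : `|s * (cutoff n)^`()%classic s| <= 2 * A.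
  have [sn|sn] := leP `|s| (2 * n.+1%:R); last first.
    by rewrite (supp_in_derive (@smooth_cutoff n) (@supp_in_cutoff n))// mulr0 normr0 mulr_ge0// ltW.
  rewrite normrM; have -> : 2 * A = 2 * n.+1%:R * (A / n.+1%:R) by rewrite mulrACA divff ?mulr1// pnatr_eq0.
  exact: ler_pM.
have bsq' n s : `|sq' n s| <= (1 + A) * `|s|.
  rewrite /sq'; apply: le_trans (ler_normD _ _) _; rewrite mulrDl [1 * `|s|]mul1r; apply: lerD.
    by rewrite normrM -[leRHS]mulr1 ler_wpM2l.
  have -> : 1 / 2 * (s * s) * (cutoff n)^`()%classic s = (1 / 2 * s) * (s * (cutoff n)^`()%classic s) by ring.
  rewrite normrM; have -> : A * `|s| = 1 / 2 * `|s| * (2 * A) by field.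
  by apply: ler_pM => //; rewrite normrM ger0_norm.
(* On the support |s| <= 2 (n + 1), so the quadratic factor is at most |s| (n + 1), and the
   derivative of the cutoff in the other variable brings A / (n + 1). *)
have bmix n p s : `|(cutoff n)^`()%classic p * sq n s| <= A * `|s|.
  rewrite normrM mulrC.
  have [sn|sn] := leP `|s| (2 * n.+1%:R); last first.
    by rewrite psq// normr0 mul0r mulr_ge0// ltW.
  have h : `|sq n s| <= `|s| * n.+1%:R.
    rewrite /sq normrM; apply: le_trans (_ : `|1 / 2 * (s * s)| * 1 <= _); first by rewrite ler_wpM2l.
    have h12 : (0 : R) <= 1 / 2 by [].
    rewrite mulr1 normrM (ger0_norm h12) [`|s * s|]normrM mulrCA ler_wpM2l//.
    by move: sn; move: (`|s|) => a sn; lra.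
  have -> : A * `|s| = (`|s| * n.+1%:R) * (A / n.+1%:R).
    by rewrite mulrACA divff ?mulr1 1?mulrC// pnatr_eq0.
  exact: ler_pM.
have sq_cvg (s : R) : sq ^~ s @ \oo --> 1 / 2 * (s * s).
  by rewrite -[X in _ --> X]mulr1; apply: cvgM; [exact: cvg_cst|exact: cutoff_cvg].
have sq'_cvg (s : R) : sq' ^~ s @ \oo --> s.
  have : sq' ^~ s @ \oo --> s * 1 + 1 / 2 * (s * s) * 0.
    apply: cvgD; apply: cvgM; by [exact: cvg_cst|exact: cutoff_cvg|exact: cutoff_derive_cvg].
  by rewrite mulr0 mulr1 addr0.
apply: (conservation hw
  (psi := fun n x => sq n x.1 * cutoff n x.2 + cutoff n x.1 * sq n x.2)
  (g1 := fun n x => (sq n)^`()%classic x.1 * cutoff n x.2 + (cutoff n)^`()%classic x.1 * sq n x.2)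
  (g2 := fun n x => sq n x.1 * (cutoff n)^`()%classic x.2 + cutoff n x.1 * (sq n)^`()%classic x.2)
  (Q1 := fun x => x.1) (Q2 := fun x => x.2) (C := 2 + 2 * A)) => //.
- move=> n.
  have [L [M h]] := C11_tensor (ssq n) (@smooth_cutoff n) (psq n) (@supp_in_cutoff n).
  have [L' [M' h']] := C11_tensor (@smooth_cutoff n) (ssq n) (@supp_in_cutoff n) (psq n).
  exists (L + L'), (M + M'), (2 * n.+1%:R); split; first by rewrite mulr_ge0.
  exact: C11_add h h'.
- move=> n x; have n1 := plane_norm1 x; have n2 := plane_norm2 x.
  have k (p q P : R) : `|p| <= P -> `|q| <= 1 -> `|p * q| <= P.
    by move=> hp hq; rewrite normrM -[leRHS]mulr1; apply: ler_pM.
  have s1 := sqr_ge0 x.1; have s2 := sqr_ge0 x.2.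
  have Ax := mulr_ge0 (ltW A0) (normr_ge0 x).
  have l1 := ler_wpM2l (ltW A0) n1; have l2 := ler_wpM2l (ltW A0) n2.
  have x0 := normr_ge0 x.
  split; apply: le_trans (ler_normD _ _) _.
  + apply: le_trans (lerD (k _ _ _ (bsq n x.1) (cb n x.2)) (_ : _ <= x.2 ^+ 2)) _.
      by rewrite mulrC; exact: k.
    have := mulr_ge0 (ltW A0) s1; have := mulr_ge0 (ltW A0) s2.
    by rewrite /sqweight; lra.
  + rewrite dsq; apply: le_trans (lerD (k _ _ _ (bsq' n x.1) (cb n x.2)) (bmix n x.1 x.2)) _.
    lra.
  + rewrite dsq [sq n x.1 * _]mulrC [cutoff n x.1 * _]mulrC.
    apply: le_trans (lerD (bmix n x.2 x.1) (k _ _ _ (bsq' n x.2) (cb n x.1))) _.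
    lra.
- move=> x; split.
  + have -> : 1 / 2 * (x.1 ^+ 2 + x.2 ^+ 2) = 1 / 2 * (x.1 * x.1) * 1 + 1 * (1 / 2 * (x.2 * x.2)) by ring.
    by apply: cvgD; apply: cvgM; by [exact: sq_cvg|exact: cutoff_cvg].
  + have -> : (fun n => (sq n)^`()%classic x.1 * cutoff n x.2 + (cutoff n)^`()%classic x.1 * sq n x.2) =
      (fun n => sq' n x.1 * cutoff n x.2 + (cutoff n)^`()%classic x.1 * sq n x.2).
      by apply/funext => n; rewrite dsq.
    have -> : nbhs x.1 = nbhs (x.1 * 1 + 0 * (1 / 2 * (x.2 * x.2))) by congr nbhs; ring.
    apply: cvgD; apply: cvgM; by [exact: sq'_cvg|exact: cutoff_cvg|exact: sq_cvg|exact: cutoff_derive_cvg].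
  + have -> : (fun n => sq n x.1 * (cutoff n)^`()%classic x.2 + cutoff n x.1 * (sq n)^`()%classic x.2) =
      (fun n => sq n x.1 * (cutoff n)^`()%classic x.2 + cutoff n x.1 * sq' n x.2).
      by apply/funext => n; rewrite dsq.
    have -> : nbhs x.2 = nbhs ((1 / 2 * (x.1 * x.1)) * 0 + 1 * x.2) by congr nbhs; ring.
    apply: cvgD; apply: cvgM; by [exact: sq'_cvg|exact: cutoff_cvg|exact: sq_cvg|exact: cutoff_derive_cvg].
- move=> s; have [mg iv vV1 vVoo] := flow_controlled hw s.
  rewrite -[RHS](angular_cancellation mg iv vV1 vVoo); apply: eq_Rint => x.
  by move: (w s x) (H (w s) x).1 (H (w s) x).2 => a b c; ring.
Qed.

End conserved.
End moments.

(** * Positivity against continuous functions of quadratic growth *)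

Section positivity.
Context {R : realType}.
Implicit Types (x y u : R * R).

Lemma continuous_near (F : R * R -> R) x (e : R) : continuous F -> 0 < e ->
  exists2 d, 0 < d & forall y, `|y - x| < d -> `|F y - F x| <= e.
Proof.
move=> cF e0; have := cF x; move=> /cvgrPdist_le/(_ e e0)/nbhs_normP[d /= d0 hd].
exists d => // y yd; rewrite distrC; apply: hd => /=.
by rewrite distrC.
Qed.

Lemma sqweight_shift x y : `|y - x| <= 1 -> sqweight y <= 5 * sqweight x.
Proof.
rewrite plane_norm_le => /andP[/= h1 h2].
have k (a b : R) : `|a - b| <= 1 -> a ^+ 2 <= 2 * b ^+ 2 + 2.
  move=> ab; have : (a - b) ^+ 2 <= 1.
    by rewrite -[(a - b) ^+ 2]real_normK ?num_real// exprn_ile1.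
  by have := sqr_ge0 (a - 2 * b); lra.
have := k _ _ h1; have := k _ _ h2; have := sqr_ge0 x.1; have := sqr_ge0 x.2.
rewrite /sqweight; lra.
Qed.

Lemma sqweight_le_norm x (r : R) : `|x| <= r -> sqweight x <= 1 + 2 * r ^+ 2.
Proof.
rewrite plane_norm_le => /andP[h1 h2].
have k (a : R) : `|a| <= r -> a ^+ 2 <= r ^+ 2.
  by move=> ar; rewrite -[a ^+ 2]real_normK ?num_real// lerXn2r ?nnegrE// (le_trans _ ar).
by have := k _ h1; have := k _ h2; rewrite /sqweight; lra.
Qed.

Variables (T V : R) (w : R -> R * R -> R).
Hypothesis hw : weak_flow T V w.
Hypothesis w0 : {ae leb2, forall x, 0 <= w 0 x}.

(** Extends positivity from [C11] functions. Truncating F and mollifying at width 1 / (n + 1)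
    preserves the sign; the weight varies by a factor at most 5 over distance 1, so that dominated
    convergence applies. *)
Lemma nonneg_continuous (F : R * R -> R) (C t : R) : 0 <= t <= T -> continuous F ->
  (forall x, 0 <= F x <= C * sqweight x) -> 0 <= \int[leb2]_x (w t x * F x).
Proof.
move=> tT cF FC.
have C0 : 0 <= C.
  have /andP[h1 h2] := FC 0; move: (le_trans h1 h2).
  by rewrite pmulr_lge0// sqweight_gt0.
have [A A0 hA] := @mollifier_exists R.
have n0 n : (0 : R) < n.+1%:R by rewrite ltr0n.
have hth n : exists th, mollifier A (n.+1%:R^-1) th by apply: hA; rewrite invr_gt0.
have {hth} [th hth] := choice hth.
pose q n x := cutoff n x.1 * cutoff n x.2 : R.
pose eta n x := F x * q n x.
have q01 n x : 0 <= q n x <= 1.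
  have /andP[a b] := cutoff_bounds n x.1; have /andP[c d] := cutoff_bounds n x.2.
  by rewrite /q mulr_ge0//= mulr_ile1.
have eta_b n x : 0 <= eta n x <= C * sqweight x.
  have /andP[a b] := q01 n x; have /andP[c d] := FC x.
  by rewrite /eta mulr_ge0//= (le_trans _ d)// ler_piMr.
have eta_s n x : 2 * n.+1%:R < `|x| -> eta n x = 0.
  rewrite ltNge plane_norm_le negb_and -!ltNge /eta /q => /orP[] h.
    by rewrite [cutoff n x.1]supp_in_cutoff// mul0r mulr0.
  by rewrite [cutoff n x.2]supp_in_cutoff// !mulr0.
have meta n : measurable_fun setT (eta n : plane -> R).
  apply: measurable_funM; first exact: continuous_plane_measurable.
  have mc := smooth_measurable (@smooth_cutoff R n).
  by apply: measurable_funM; apply: (measurableT_comp mc); [exact: measurable_fst|exact: measurable_snd].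
have eta_B n x : `|eta n x| <= C * (1 + 2 * (2 * n.+1%:R) ^+ 2).
  have [xr|xr] := leP `|x| (2 * n.+1%:R); last first.
    by rewrite eta_s// normr0 mulr_ge0// addr_ge0// mulr_ge0// sqr_ge0.
  have /andP[a b] := eta_b n x; rewrite ger0_norm//; apply: le_trans b _.
  by rewrite ler_wpM2l//; exact: sqweight_le_norm.
have ieta n := bounded_supp_integrable2 (meta n) (@eta_s n) (@eta_B n).
pose f n := mconv (eta n) (th n) (th n).
have f0 n x : 0 <= f n x.
  apply: Rint_ge0 => y; rewrite mulr_ge0//; first by have /andP[] := eta_b n y.
  by rewrite mulr_ge0//; exact: moll_ge0 (hth n) _.
have d1 n : n.+1%:R^-1 <= 1 :> R by rewrite invf_le1// ler1n.
have fC n : exists g1 g2 L M r, C11 (f n) g1 g2 L M r.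
  have [B _ hB] := moll_C11 (hth n).
  have h := hB (eta n) _ _ (ieta n) (@eta_s n) (lexx _).
  by eexists; eexists; eexists; eexists; eexists; exact: h.
have fn n : 0 <= \int[leb2]_x (w t x * f n x).
  have [g1 [g2 [L [M [r h]]]]] := fC n.
  exact: (weak_flow_nonneg hw w0 tT h (f0 n)).
have fb n x : `|f n x| <= C * 5 * sqweight x.
  have := @moll_close _ _ _ _ (hth n) _ (ieta n) x 0 (C * 5 * sqweight x).
  rewrite subr0; apply=> y yd; rewrite subr0; have /andP[a b] := eta_b n y.
  rewrite ger0_norm//; apply: le_trans b _; rewrite -mulrA ler_wpM2l// sqweight_shift//.
  exact: le_trans yd (d1 n).
have fm n : measurable_fun setT (f n : plane -> R).
  by have [g1 [g2 [L [M [r h]]]]] := fC n; have [] := C11_measurable h.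
have fcv x : f ^~ x @ \oo --> F x.
  apply/cvgrPdist_le => e e0.
  have [d d0 hd] := continuous_near x cF e0.
  near=> n; rewrite distrC; apply: (moll_close (hth n) (ieta n)) => y yd.
  have y1 : `|y| <= n.+1%:R.
    have := ler_normD (y - x) x; rewrite subrK => h; apply: le_trans h _.
    apply: le_trans (lerD (le_trans yd (d1 n)) (lexx _)) _.
    rewrite -natr1 addrC lerD2r.
    by near: n; exact: nbhs_infty_ger.
  have e1 : q n y = 1.
    move: y1; rewrite plane_norm_le => /andP[h1 h2].
    by rewrite /q !cutoff1// mulr1.
  rewrite /eta e1 mulr1; apply: hd; apply: le_lt_trans yd _.
  rewrite invf_plt ?posrE//; apply: (@le_lt_trans _ _ n%:R); last by rewrite ltr_nat.
  by near: n; exact: nbhs_infty_ger.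
have mF : measurable_fun setT (F : plane -> R) by exact: continuous_plane_measurable.
exact: cvgn_ge (cvg_Rint_controlled (flow_controlled hw t) fm mF fb fcv) fn.
Unshelve. all: by end_near. Qed.

End positivity.

(** * Concentration at the origin *)

Section concentration.
Context {R : realType}.
Implicit Types (x y u : R * R).

Lemma enorm2_sqr x : enorm2 x ^+ 2 = x.1 ^+ 2 + x.2 ^+ 2.
Proof. by rewrite /enorm2 sqr_sqrtr// addr_ge0// sqr_ge0. Qed.

Lemma continuous_sq : continuous (fun x : R * R => x.1 ^+ 2 + x.2 ^+ 2).
Proof.
have h (p : R * R -> R) : continuous p -> continuous (fun x => p x ^+ 2).
  by move=> cp x; exact: (cvgM (cp x) (cp x)).
by move=> x; apply: cvgD; apply: h => y; [exact: cvg_fst|exact: cvg_snd].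
Qed.

Lemma sq_le_sqweight x : 0 <= x.1 ^+ 2 + x.2 ^+ 2 <= sqweight x.
Proof. by rewrite addr_ge0 ?sqr_ge0//= /sqweight -addrA lerDr. Qed.

Variables (g : R * R -> R) (V m : R).
Hypotheses (cg : controlled g V) (g1 : \int[leb2]_x g x = 1)
  (gm : \int[leb2]_x (g x * (x.1 ^+ 2 + x.2 ^+ 2)) <= m).
Hypothesis gF : forall (F : R * R -> R) (C : R), continuous F ->
  (forall x, 0 <= F x <= C * sqweight x) -> 0 <= \int[leb2]_x (g x * F x).

Let igsq : leb2.-integrable setT (EFin \o (fun x => g x * (x.1 ^+ 2 + x.2 ^+ 2))).
Proof.
apply: (controlled_sqweight cg (C := 1)).
  exact: continuous_plane_measurable continuous_sq.
by move=> x; have /andP[h1 h2] := sq_le_sqweight x; rewrite mul1r ger0_norm.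
Qed.

(** Positivity of [g] is available in its dual form [gF], so the indicator of the outside is reached
    as the limit of the powers of min(1, s) with s = |x|^2 / rho^2, each of which lies below s. *)
Lemma chebyshev_outside (rho : R) : 0 < rho ->
  (\int[leb2]_(x in [set x | (rho <= enorm2 x)%R]) (g x)%:E <= (m / rho ^+ 2)%:E)%E.
Proof.
move=> rho0; have rho2 : 0 < rho ^+ 2 by rewrite exprn_gt0.
pose s x : R := (x.1 ^+ 2 + x.2 ^+ 2) * (rho ^+ 2)^-1.
pose mn x := Num.min 1 (s x).
(* The extra factor makes the exponent j + 1, so that already the first function lies below s. *)
pose th j x := mn x * mn x ^+ j.
have cs : continuous s by move=> x; apply: cvgM; [exact: continuous_sq|exact: cvg_cst].
have cmn : continuous mn.
  move=> x; apply: (@continuous_min _ _ (fun=> 1) s x); [exact: cvg_cst|exact: cs].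
have cth j : continuous (th j).
  elim: j => [|j ih] x.
    by apply: cvgM; [exact: cmn|exact: cvg_cst].
  have -> : th j.+1 = fun z => th j z * mn z.
    by apply/funext => z; rewrite /th exprSr mulrA.
  by apply: cvgM; [exact: ih|exact: cmn].
have s0 x : 0 <= s x.
  by have /andP[h _] := sq_le_sqweight x; rewrite mulr_ge0// invr_ge0 ltW.
have mn01 x : 0 <= mn x <= 1 by rewrite le_min ler01 s0 ge_min lexx.
have th1 j x : 0 <= th j x <= mn x.
  have /andP[a b] := mn01 x; rewrite /th mulr_ge0 ?exprn_ge0//=.
  by rewrite ler_piMr// exprn_ile1.
have mns x : mn x <= s x by rewrite ge_min lexx orbT.
pose A : set (@plane R) := [set x | rho <= enorm2 x].
have AE x : (x \in A) = (1 <= s x).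
  rewrite /s -enorm2_sqr ler_pdivlMr// mul1r; apply/idP/idP.
    rewrite inE /A/= => h; rewrite lerXn2r ?nnegrE ?(ltW rho0)//; exact: sqrtr_ge0.
  by move=> h; rewrite inE /A/= -(@ler_pXn2r _ 2)// ?nnegrE ?(ltW rho0)//; exact: sqrtr_ge0.
have mA : measurable A.
  have ms : measurable_fun setT (s : plane -> R) by exact: continuous_plane_measurable.
  have -> : A = setT `&` s @^-1` [set` `[1, +oo[%R].
    by apply/seteqP; split=> x; rewrite setTI /= in_itv/= andbT -AE inE.
  by apply: ms => //; exact: measurable_itv.
have m1A : measurable_fun setT (\1_A : @plane R -> R) by exact: measurable_indic.
have sw x := sqweight_ge1 x.
have lim : (fun j => \int[leb2]_x (g x * th j x)) @ \oo --> \int[leb2]_x (g x * \1_A x).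
  apply: (cvg_Rint_controlled cg (C := 1)) => //.
  - by move=> j; exact: continuous_plane_measurable.
  - move=> j x; have /andP[a b] := th1 j x; have /andP[c d] := mn01 x.
    by rewrite ger0_norm// mul1r (le_trans b)// (le_trans d).
  move=> x; rewrite indicE AE /th /mn; have [sx|sx] := leP 1 (s x).
    rewrite (_ : (fun j => _) = cst 1); first exact: cvg_cst.
    by apply/funext => j; rewrite expr1n mulr1.
  rewrite -[X in _ --> X](mulr0 (s x)); apply: cvgM; first exact: cvg_cst.
  by apply: cvg_expr; rewrite ger0_norm.
have ith j : leb2.-integrable setT (EFin \o (fun x => g x * th j x)).
  apply: (controlled_sqweight cg (C := 1)); first exact: continuous_plane_measurable.
  move=> x; have /andP[a b] := th1 j x; have /andP[c d] := mn01 x.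
  by rewrite ger0_norm// mul1r (le_trans b)// (le_trans d).
have iA : leb2.-integrable setT (EFin \o (fun x => g x * \1_A x)).
  apply: (controlled_sqweight cg (C := 1)) => // x.
  by rewrite mul1r ger0_norm indicE ?ler0n// (le_trans _ (sw x))// lern1 leq_b1.
have bound j : \int[leb2]_x (g x * th j x) <= m / rho ^+ 2.
  have cF : continuous (fun x => s x - th j x) by move=> x; apply: cvgB; [exact: cs|exact: cth].
  have := gF (C := (rho ^+ 2)^-1) cF _ => h.
  have {h} : 0 <= \int[leb2]_x (g x * (s x - th j x)).
    apply: h => x; have /andP[a b] := th1 j x.
    rewrite subr_ge0 (le_trans b)//=; apply: (@le_trans _ _ (s x)); first by rewrite gerBl.
    rewrite /s mulrC ler_wpM2l ?invr_ge0 ?(ltW rho2)//.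
    by have /andP[] := sq_le_sqweight x.
  have e x : g x * (s x - th j x) = (rho ^+ 2)^-1 * (g x * (x.1 ^+ 2 + x.2 ^+ 2)) - g x * th j x.
    by rewrite /s; ring.
  rewrite (eq_Rint leb2 e) (RintB (integrZ _ igsq) (ith j)) (RintZ _ igsq) subr_ge0.
  move=> /le_trans; apply; rewrite mulrC ler_wpM2r// invr_ge0 ltW//.
rewrite integral_mkcond (_ : _ \_ _ = EFin \o (fun x => g x * \1_A x)).
  by rewrite -(EFin_Rint iA) lee_fin; exact: cvgn_le lim bound.
apply/funext => x; rewrite patchE /= indicE; case: ifPn => h.
  by rewrite mulr1.
by rewrite mulr0.
Qed.

(** Closeness near 0 and boundedness elsewhere give |f - f(0)| <= eta + k |x|^2 everywhere, with k =
    2 B / d^2, which is then integrated against [g] by duality. *)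
Lemma concentration_at_0 (f : R * R -> R) (B eta d : R) : continuous f ->
  (forall x, `|f x| <= B) -> 0 <= eta -> 0 < d ->
  (forall x, `|x| < d -> `|f x - f 0| <= eta) ->
  `|\int[leb2]_x (g x * f x) - f 0| <= eta + 2 * B / d ^+ 2 * m.
Proof.
move=> cf fB eta0 d0 fd.
have B0 : 0 <= B by apply: le_trans (fB 0).
have [ig _] := controlled_integrable cg.
have mf : measurable_fun setT (f : plane -> R) by exact: continuous_plane_measurable.
have igf := integrM mf ig fB.
have d2 : 0 < d ^+ 2 by rewrite exprn_gt0.
pose k := 2 * B / d ^+ 2.
have k0 : 0 <= k by rewrite mulr_ge0 ?invr_ge0 ?(ltW d2)// mulr_ge0.
have f2B x : `|f x - f 0| <= 2 * B.
  by apply: le_trans (ler_normB _ _) _; have := fB x; have := fB 0; lra.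
have main x : `|f x - f 0| <= eta + k * (x.1 ^+ 2 + x.2 ^+ 2).
  have /andP[q0 _] := sq_le_sqweight x.
  have [xd|xd] := ltP `|x| d; first by apply: le_trans (fd x xd) _; rewrite lerDl mulr_ge0.
  apply: le_trans (f2B x) _; apply: (@le_trans _ _ (k * (x.1 ^+ 2 + x.2 ^+ 2))); last by rewrite lerDr.
  rewrite /k mulrAC ler_pdivlMr// ler_wpM2l ?mulr_ge0//.
  have s1 := sqr_ge0 x.1; have s2 := sqr_ge0 x.2.
  apply: (@le_trans _ _ (`|x| ^+ 2)).
    by rewrite lerXn2r ?nnegrE// ltW.
  rewrite plane_normE /Num.max; case: ifP => _; rewrite real_normK ?num_real//.
    by rewrite lerDr.
  by rewrite lerDl.
(* Both signs c = 1 and c = -1 give a nonnegative function [F] of quadratic growth, to which [gF]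
   applies; unit mass produces the value f(0). *)
have half (c : R) : `|c| = 1 -> - c * (\int[leb2]_x (g x * f x) - f 0) <= eta + k * m.
  move=> c1.
  pose F x := eta + k * (x.1 ^+ 2 + x.2 ^+ 2) + c * (f x - f 0).
  have cF : continuous F.
    move=> x; apply: cvgD.
      apply: cvgD; first exact: cvg_cst.
      by apply: cvgM; [exact: cvg_cst|exact: continuous_sq].
    apply: cvgM; first exact: cvg_cst.
    by apply: cvgB; [exact: cf|exact: cvg_cst].
  have hF : 0 <= \int[leb2]_x (g x * F x).
    apply: (gF (C := eta + k + 2 * B) cF) => x.
    have /andP[q0 q1] := sq_le_sqweight x; have sw := sqweight_ge1 x.
    have cn : `|c * (f x - f 0)| = `|f x - f 0| by rewrite normrM c1 mul1r.
    have h1 := main x; have h2 := f2B x; rewrite -cn in h1 h2.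
    have {h1} /andP[h1 _] : - (eta + k * (x.1 ^+ 2 + x.2 ^+ 2)) <= c * (f x - f 0) <=
      eta + k * (x.1 ^+ 2 + x.2 ^+ 2) by rewrite -ler_norml.
    apply/andP; split; first by rewrite /F addrC -lerBlDr sub0r.
    have h3 := le_trans (ler_norm _) h2.
    have e1 : eta <= eta * sqweight x by rewrite ler_peMr.
    have e2 : 2 * B <= 2 * B * sqweight x by rewrite ler_peMr// mulr_ge0.
    have e3 := ler_wpM2l k0 q1.
    have -> : (eta + k + 2 * B) * sqweight x = eta * sqweight x + k * sqweight x + 2 * B * sqweight x by ring.
    by apply: lerD; [apply: lerD|exact: le_trans h3 e2].
  have e x : g x * F x = (eta - c * f 0) * g x + k * (g x * (x.1 ^+ 2 + x.2 ^+ 2)) + c * (g x * f x).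
    by rewrite /F; ring.
  move: hF; rewrite (eq_Rint leb2 e) (RintD (integrD (integrZ _ ig) (integrZ _ igsq)) (integrZ _ igf)).
  rewrite (RintD (integrZ _ ig) (integrZ _ igsq)) (RintZ _ ig) (RintZ _ igsq) (RintZ _ igf) g1.
  have := ler_wpM2l k0 gm.
  move: (\int[leb2]_x (g x * (x.1 ^+ 2 + x.2 ^+ 2))) (\int[leb2]_x (g x * f x)) => I J h1 h2.
  by move: h1; move: (k * I) h2 => kI; move: (k * m) (f 0) => km f0; lra.
have n1 : `|(-1 : R)| = 1 by rewrite normrN normr1.
have h1 := half 1 (normr1 _); have h2 := half (-1) n1.
rewrite mulN1r in h1; rewrite opprK mul1r in h2.
by rewrite ler_norml -/k lerNl h1.
Qed.

End concentration.

(** The flow is taken on [0, t] itself. [V] may depend on the time and on the solution: it ensures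
    convergence of the integrals and never enters the final estimates, which involve the mass and
    [m] alone. *)
Lemma solution_properties (R : realType) (v0 : R * R -> R) (w : R -> R * R -> R) (m t : R) :
  helical_euler_solution 2 v0 w -> measurable_fun setT (v0 : plane -> R) ->
  {ae leb2, forall x, 0 <= v0 x} -> (\int[leb2]_x (v0 x)%:E = 1)%E ->
  (\int[leb2]_x (enorm2 x ^+ 2 * v0 x)%:E <= m%:E)%E -> 0 <= t ->
  exists V, [/\ controlled (w t) V, \int[leb2]_x w t x = 1,
    \int[leb2]_x (w t x * (x.1 ^+ 2 + x.2 ^+ 2)) <= m &
    forall (F : R * R -> R) (C : R), continuous F ->
      (forall x, 0 <= F x <= C * sqweight x) -> 0 <= \int[leb2]_x (w t x * F x)].
Proof.
move=> sol mv0 pos mass moment t0.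
have [w' [V [hw ew]]] := weak_flow_of_solution t0 sol.
have [_ _ _ init _] := sol.
have tt : 0 <= t <= t by rewrite t0 lexx.
have t00 : (0 : R) <= 0 <= t by rewrite lexx.
have e0 : {ae leb2, forall x, w' 0 x = v0 x} by rewrite (ew 0 t00).
have pos' : {ae leb2, forall x, 0 <= w' 0 x}.
  by apply: filterS2 e0 pos => x ->.
have c0 := flow_controlled hw 0.
have [i0 _] := controlled_integrable c0.
have msq : measurable_fun setT ((fun x => x.1 ^+ 2 + x.2 ^+ 2) : @plane R -> R).
  exact: continuous_plane_measurable (@continuous_sq R).
have isq : leb2.-integrable setT (EFin \o (fun x => w' 0 x * (x.1 ^+ 2 + x.2 ^+ 2))).
  apply: (controlled_sqweight c0 (C := 1)) => // x.
  by have /andP[h1 h2] := sq_le_sqweight x; rewrite mul1r ger0_norm.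
exists V; split.
- by rewrite -(ew t tt); exact: flow_controlled hw t.
- rewrite -(ew t tt) (mass_conservation hw tt) (ae_eq_Rint _ mv0 e0).
    by rewrite /Rintegral mass.
  exact: integr_measurable i0.
- rewrite -(ew t tt) (moment_conservation hw tt) -lee_fin (EFin_Rint isq).
  apply: le_trans moment; rewrite le_eqVlt; apply/orP; left; apply/eqP.
  apply: ae_eq_integral => //.
  + exact: measurable_int isq.
  + apply/measurable_EFinP; apply: measurable_funM => //.
    have -> : (fun x : R * R => enorm2 x ^+ 2) = (fun x => x.1 ^+ 2 + x.2 ^+ 2).
      by apply/funext => x; exact: enorm2_sqr.
    exact: msq.
  + apply: filterS e0 => x ex _ /=.
    by rewrite ex enorm2_sqr mulrC.
- by rewrite -(ew t tt) => F C cF hF; exact: (nonneg_continuous hw pos' tt cF hF).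
Qed.

Theorem theorem2p9 (R : realType) (eps0 : R) (heps0 : 0 < eps0)
  (w0 : R -> R * R -> R) (w : R -> R -> R * R -> R)
  (hw0 : forall eps : R, 0 < eps < eps0 -> (Lpm 1 2 `&` Lpm +oo 2) (w0 eps))
  (hw : forall eps : R, 0 < eps < eps0 ->
     helical_euler_solution 2 (w0 eps) (w eps))
  (hnonneg : forall eps : R, 0 < eps < eps0 ->
     {ae leb2, forall x, 0 <= w0 eps x})
  (hmass : forall eps : R, 0 < eps < eps0 ->
     (\int[leb2]_x (w0 eps x)%:E = 1)%E)
  (hmoment : exists2 C : R, 0 < C & forall eps : R, 0 < eps < eps0 ->
     (\int[leb2]_x (enorm2 x ^+ 2 * w0 eps x)%:E <= (C * eps ^+ 2)%:E)%E) :
  (exists2 C : R, 0 < C &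
     forall eps alpha t : R, 0 < eps < eps0 -> alpha < 1 -> 0 <= t ->
     (\int[leb2]_(x in [set x | (eps `^ alpha <= enorm2 x)%R]) (w eps t x)%:E
        <= (C * eps `^ (2 - 2 * alpha))%:E)%E) /\
  (forall t : R, 0 <= t ->
     cvg_in_distribution 0^'+ (fun eps : R => w eps t) \d_((0, 0) : plane)).
Proof.
have [C C0 hC] := hmoment.
have props eps t he t0 := solution_properties (hw eps he) (hw0 eps he).1.1 (hnonneg eps he)
  (hmass eps he) (hC eps he) (t0 : 0 <= t).
split.
  (* The constant of the moment hypothesis serves for all exponents and times; Chebyshev's quotient
     is eps^2 divided by the square of eps^alpha. *)
  exists C => // eps alpha t he _ t0.
  have [V [cg g1 gm gF]] := props eps t he t0.
  have /andP[e0 _] := he.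
  have := chebyshev_outside cg gm gF (powR_gt0 alpha e0).
  move=> /le_trans; apply; rewrite lee_fin le_eqVlt; apply/orP; left; apply/eqP.
  rewrite -mulrA; congr (_ * _).
  rewrite powRD; last by rewrite (gt_eqF e0) implybT.
  rewrite powRN mulrC [2 * alpha]mulrC powRrM !powR_mulrn ?powR_ge0 ?(ltW e0)//.
  by rewrite mulrC.
move=> t t0 f cf [B fB].
have mf : measurable_fun setT (f : plane -> R) by exact: continuous_plane_measurable.
rewrite integral_dirac//; last exact/measurable_EFinP.
rewrite diracT mul1e; apply/fine_cvgP.
have near0 : \forall eps \near (0 : R)^'+, 0 < eps < eps0.
  near=> eps; apply/andP; split; near: eps; [exact: nbhs_right_gt|exact: nbhs_right_lt].
have eM eps x : (f x * w eps t x)%:E = (w eps t x * f x)%:E by rewrite mulrC.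
split.
  apply: filterS near0 => eps he.
  have [V [cg _ _ _]] := props eps t he t0.
  have [ig _] := controlled_integrable cg.
  under eq_integral do rewrite eM.
  apply: integrable_fin_num => //; exact: integrM mf ig fB.
have B0 : 0 <= B by apply: le_trans (fB 0).
apply/cvgrPdist_le => e e0.
have e20 : 0 < e / 2 by rewrite divr_gt0.
have [d d0 fd] := continuous_near 0 cf e20.
have fd' x : `|x| < d -> `|f x - f 0| <= e / 2.
  by move=> xd; apply: fd; rewrite subr0.
pose k := 2 * B / d ^+ 2 * C.
have k0 : 0 <= k by rewrite !mulr_ge0 ?(ltW C0)// invr_ge0 exprn_ge0// ltW.
near=> eps.
have he : 0 < eps < eps0 by near: eps; exact: near0.
have eps1 : eps <= 1 by near: eps; exact: nbhs_right_le.
have epse : eps <= e / 2 / (k + 1).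
  by near: eps; apply: nbhs_right_le; rewrite divr_gt0// ltr_wpDl.
have /andP[ep0 _] := he.
have [V [cg g1 gm gF]] := props eps t he t0.
have h := concentration_at_0 cg g1 gm gF cf fB (ltW e20) d0 fd'.
rewrite distrC /=.
have -> : fine (\int[leb2]_x (f x * w eps t x)%:E)%E = \int[leb2]_x (w eps t x * f x).
  by congr fine; apply: eq_integral => x _.
apply: le_trans h _.
have -> : 2 * B / d ^+ 2 * (C * eps ^+ 2) = k * eps ^+ 2 by rewrite /k; ring.
have h1 : k * eps ^+ 2 <= k * eps.
  by rewrite ler_wpM2l// expr2 ler_piMr// ltW.
have h2 : k * eps <= (k + 1) * eps by rewrite ler_wpM2r ?(ltW ep0)// lerDl.
have h3 : (k + 1) * eps <= e / 2 by rewrite mulrC -ler_pdivlMr// ltr_wpDl.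
lra.
Unshelve. all: by end_near. Qed.
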